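(* Let $m\geq 3$ and $n\geq\left\lceil\frac{m^3-2m-5}{2}\right\rceil$ be integers such that it is not the case that both $m$ is even and $n$ is odd. Then the configuration $A_0(m,n)$ is superabundant and non-defective.
   Context: Work over $\mathbb{C}$. Let $\mathbb{P}^{m,n}=\mathbb{P}^m\times\mathbb{P}^n$ with bigraded coordinate ring $R=\mathbb{C}[x_0,\dots,x_m,y_0,\dots,y_n]$, where $\deg x_i=(1,0)$ and $\deg y_j=(0,1)$. A bihomogeneous $f\in R$ is singular at a point $P\in\mathbb{P}^{m,n}$ if all its partial derivatives vanish at $P$. Put $\overline{s}(m,n)=\left\lfloor\frac{(m+1)(n-m+2)}{2}\right\rfloor+1$. For $n\geq m-2$, $A_0(m,n)$ denotes the configuration of $\overline{s}(m,n)$ double points supported at general points of $\mathbb{P}^{m,n}$. Let $\mathcal{I}(1,2)$ be the vector space of bidegree $(1,2)$ forms in $R$ that are singular at all these points. The virtual dimension of $A_0(m,n)$ is $\operatorname{vdim}A_0(m,n)=(m+1)\binom{n+2}{2}-\overline{s}(m,n)\,(m+n+1)$. The configuration $A_0(m,n)$ is superabundant if $\operatorname{vdim}A_0(m,n)\leq 0$, and non-defective if, for a general choice of the points, $\dim_{\mathbb{C}}\mathcal{I}(1,2)=\max\{0,\operatorname{vdim}A_0(m,n)\}$. *)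

(* Defs.v *)
From HB Require Import structures.
From mathcomp Require Import all_boot all_order all_algebra.
From mathcomp Require Import reals complex.
From mathcomp Require Import mpoly.

Set Implicit Arguments.
Unset Strict Implicit.
Unset Printing Implicit Defensive.

Import GRing.Theory Num.Theory.

Local Open Scope ring_scope.

(* The truncated subtraction is exact in the intended range n >= m - 2. *)
Definition sbar (m n : nat) : nat := ((m.+1 * (n + 2 - m))./2).+1.

Definition vdim (m n : nat) : int :=
  (m.+1 * 'C(n.+2, 2))%:Z - (sbar m n * (m + n + 1))%:Z.

Definition superabundant (m n : nat) : Prop := vdim m n <= 0.

(* P^k as the set of lines of K^(k+1). *)
Definition proj (K : fieldType) (k : nat) : Type :=
  {L : {vspace 'rV[K]_k.+1} | \dim L == 1%N}.

Definition biproj (K : fieldType) (m n : nat) : Type :=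
  (proj K m * proj K n)%type.

(* Homogeneous coordinates of a point of P^k: vpick chooses a generator of the
   line. Below, only (multi)homogeneous conditions are tested on this generator,
   so they do not depend on the choice; see singular_atP and
   multihomog_rescale. *)
Definition hcoord (K : fieldType) (k : nat) (L : proj K k) : 'rV[K]_k.+1 :=
  vpick (val L).

(* Variables 0, ..., m are the x_i, variables m+1, ..., m+n+1 are the y_j. *)
Definition nvars (m n : nat) : nat := m.+1 + n.+1.

Definition coords (K : fieldType) (m n : nat) (P : biproj K m n) :
    'rV[K]_(nvars m n) :=
  row_mx (hcoord P.1) (hcoord P.2).

Section Bigraded.
Variables (K : fieldType) (m n : nat).
Local Notation N := (nvars m n).

Definition xdeg (a : 'X_{1..N}) : nat := \sum_(i < m.+1) a (lshift n.+1 i).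
Definition ydeg (a : 'X_{1..N}) : nat := \sum_(j < n.+1) a (rshift m.+1 j).

Definition bihomog (d e : nat) (f : {mpoly K[N]}) : bool :=
  all (fun a => (xdeg a == d) && (ydeg a == e)) (msupp f).

Definition singular_vec (f : {mpoly K[N]}) (v : 'rV[K]_N) : Prop :=
  forall i : 'I_N, (f^`M(i)).@[v 0] = 0.

Definition singular_at (f : {mpoly K[N]}) (P : biproj K m n) : Prop :=
  singular_vec f (coords P).

(* The finite-dimensional space of forms of total degree 3. *)
Definition form3 : vectType K := dhomog (m + n.+1).+1 K 3.

Definition form3_poly (f : form3) : {mpoly K[N]} := val f.
Definition form3_coef (a : 'X_{1..N}) (f : form3) : K^o := (form3_poly f)@_a.
Definition form3_pder (v : 'rV[K]_N) (i : 'I_N) (f : form3) : K^o :=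
  ((form3_poly f)^`M(i)).@[v 0].

(* The first intersection kills the coefficients of the monomials of bidegree
   other than (1, 2), the second one makes all partial derivatives vanish at the
   points; see mem_sing_forms. *)
Definition sing_forms (s : nat) (P : 'I_s -> biproj K m n) : {vspace form3} :=
  (\bigcap_(a : 'X_{1..N < 4} | ~~ ((xdeg a == 1) && (ydeg a == 2)))
      lker (linfun (form3_coef a))
   :&: \bigcap_(k < s) \bigcap_(i < N)
      lker (linfun (form3_pder (coords (P k)) i)))%VS.

End Bigraded.

Section General.
Variables (K : fieldType) (m n s : nat).
Local Notation N := (nvars m n).
Local Notation pts := ('I_s -> biproj K m n).

(* Multihomogeneous polynomials on (P^m x P^n)^s: variable mxvec_index k i is
   the i-th coordinate of the k-th point. *)
Definition mxdeg (a : 'X_{1..s * N}) (k : 'I_s) : nat :=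
  \sum_(i < m.+1) a (mxvec_index k (lshift n.+1 i)).
Definition mydeg (a : 'X_{1..s * N}) (k : 'I_s) : nat :=
  \sum_(j < n.+1) a (mxvec_index k (rshift m.+1 j)).

Definition multihomog (F : {mpoly K[s * N]}) : Prop :=
  exists d e : 'I_s -> nat, forall a, a \in msupp F ->
    forall k, mxdeg a k = d k /\ mydeg a k = e k.

Definition mcoords (P : pts) : 'rV[K]_(s * N) :=
  mxvec (\matrix_(k, i) coords (P k) 0 i).

Definition zariski_closed (Z : pts -> Prop) : Prop :=
  exists S : {mpoly K[s * N]} -> Prop,
    (forall F, S F -> multihomog F) /\
    (forall P, Z P <-> forall F, S F -> F.@[mcoords P 0] = 0).

Definition zariski_open (U : pts -> Prop) : Prop :=
  zariski_closed (fun P => ~ U P).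

Definition for_general_points (Q : pts -> Prop) : Prop :=
  exists U : pts -> Prop,
    [/\ zariski_open U, exists P, U P & forall P, U P -> Q P].

End General.

Definition non_defective (K : fieldType) (m n : nat) : Prop :=
  for_general_points (fun P : 'I_(sbar m n) -> biproj K m n =>
    (\dim (sing_forms P))%:Z = Num.max 0 (vdim m n)).

Section Facts.
Variables (K : fieldType) (m n : nat).
Local Notation N := (nvars m n).

Fact form3_coef_linear (a : 'X_{1..N}) : linear (@form3_coef K m n a).
Proof.
move=> c f g; rewrite /form3_coef.
have -> : form3_poly (c *: f + g) = c *: form3_poly f + form3_poly g by [].
by rewrite mcoeffD mcoeffZ.
Qed.
HB.instance Definition _ (a : 'X_{1..N}) :=
  GRing.isLinear.Build K (form3 K m n) K^o _ (form3_coef a)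
    (form3_coef_linear a).

Fact form3_pder_linear (v : 'rV[K]_N) i : linear (@form3_pder K m n v i).
Proof.
move=> c f g; rewrite /form3_pder.
have -> : form3_poly (c *: f + g) = c *: form3_poly f + form3_poly g by [].
by rewrite mderivD mderivZ mevalD mevalZ.
Qed.
HB.instance Definition _ (v : 'rV[K]_N) i :=
  GRing.isLinear.Build K (form3 K m n) K^o _ (form3_pder v i)
    (form3_pder_linear v i).

Lemma mdeg_bideg (a : 'X_{1..N}) : mdeg a = (xdeg a + ydeg a)%N.
Proof. by rewrite mdegE big_split_ord. Qed.

Lemma memv_bigcap (vT : vectType K) (I : finType) (Q : pred I)
    (V : I -> {vspace vT}) (f : vT) :
  reflect (forall i, Q i -> f \in V i) (f \in \bigcap_(i | Q i) V i)%VS.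
Proof.
apply: (iffP subv_bigcapP) => H i Qi; last by rewrite -memvE; apply: H.
by rewrite memvE; apply: H.
Qed.

Lemma mem_sing_forms s (P : 'I_s -> biproj K m n) (f : form3 K m n) :
  f \in sing_forms P <->
  bihomog 1 2 (form3_poly f) /\ forall k, singular_at (form3_poly f) (P k).
Proof.
rewrite /sing_forms memv_cap; split.
- case/andP=> /memv_bigcap H1 /memv_bigcap H2; split.
  + apply/allP => a fa; apply/negPn/negP => nb.
    have da : (mdeg a < 4)%N.
      by rewrite (dhomog_mf (dhomog_is_dhomog f) fa).
    have := H1 (BMultinom da) nb.
    rewrite memv_ker lfunE /= /form3_coef => /eqP /= E.
    by move: fa; rewrite mcoeff_msupp E eqxx.
  + move=> k i; move/memv_bigcap: (H2 k isT) => /(_ i isT).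
    by rewrite memv_ker lfunE => /eqP.
- case=> /allP H1 H2; apply/andP; split; apply/memv_bigcap.
  + move=> a nb; rewrite memv_ker lfunE /= /form3_coef; apply/eqP.
    by apply: memN_msupp_eq0; apply: contra nb => /H1.
  + move=> k _; apply/memv_bigcap => i _; rewrite memv_ker lfunE /=.
    by apply/eqP; apply: H2.
Qed.

Lemma form3_polyK (f : {mpoly K[N]}) :
  bihomog 1 2 f -> exists g : form3 K m n, form3_poly g = f.
Proof.
move=> /allP Hf.
have h : f \is 3.-homog.
  apply/dhomogP => a /Hf /andP[/eqP xa /eqP ya].
  by rewrite /= mdeg_bideg xa ya.
by exists (DHomog h).
Qed.

Lemma hcoord_neq0 k (L : proj K k) : hcoord L != 0.
Proof.
rewrite /hcoord vpick0; case: L => L /= /eqP dL.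
by apply/eqP => L0; rewrite L0 dimv0 in dL.
Qed.

Lemma hcoordP k (L : proj K k) (x : 'rV[K]_k.+1) :
  x \in val L -> x != 0 -> exists2 c, c != 0 & x = c *: hcoord L.
Proof.
move=> xL x0; have hL : val L = <[hcoord L]>%VS.
  apply/esym/eqP; rewrite eqEdim -memvE memv_pick /= dim_vline hcoord_neq0.
  by case: (L) => ? /= /eqP->.
move: xL; rewrite hL => /vlineP[c xE]; exists c => //.
by apply: contraNneq x0 => c0; rewrite xE c0 scale0r.
Qed.

Lemma pder_rescale (f : {mpoly K[N]}) d e (x : 'rV[K]_m.+1) (y : 'rV[K]_n.+1)
    (b c : K) (i : 'I_N) : bihomog d e f ->
  row_mx (const_mx b : 'rV[K]_m.+1) (const_mx c : 'rV[K]_n.+1) 0 i *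
    (f^`M(i)).@[row_mx (b *: x) (c *: y) 0] =
  b ^+ d * c ^+ e * (f^`M(i)).@[row_mx x y 0].
Proof.
move=> /allP Hf; set t := row_mx _ _ 0; set v := row_mx x y 0.
have tvE j : row_mx (b *: x) (c *: y) 0 j = t j * v j.
  by rewrite /t /v !mxE; case: split => ?; rewrite !mxE.
have tE (a : 'X_{1..N}) : \prod_j t j ^+ a j = b ^+ xdeg a * c ^+ ydeg a.
  rewrite big_split_ord /= /xdeg /ydeg -!prodrXr.
  by congr (_ * _); apply: eq_bigr => j _; rewrite /t (row_mxEl, row_mxEr) mxE.
rewrite /mderiv !raddf_sum /= !mulr_sumr big_seq [RHS]big_seq.
apply: eq_bigr => a /Hf /andP[/eqP xa /eqP ya].
rewrite !mevalZ !mevalX.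
have [a0|a0] := eqVneq (a i) 0%N; first by rewrite a0 !(mul0r, mulr0).
rewrite mulrCA [RHS]mulrCA; congr (_ * _).
under eq_bigr do rewrite tvE exprMn.
rewrite big_split /= mulrA; congr (_ * _).
rewrite -xa -ya -tE (bigD1 i) //= [RHS](bigD1 i) //= mulrA.
congr (_ * _).
  by rewrite mnmBE mnm1E eqxx subn1 -exprS prednK // lt0n.
apply: eq_bigr => j ji; rewrite mnmBE mnm1E.
by rewrite eq_sym (negPf ji) subn0.
Qed.

Lemma singular_atP (f : {mpoly K[N]}) d e (P : biproj K m n)
    (x : 'rV[K]_m.+1) (y : 'rV[K]_n.+1) :
  bihomog d e f -> x \in val P.1 -> x != 0 -> y \in val P.2 -> y != 0 ->
  singular_at f P <-> singular_vec f (row_mx x y).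
Proof.
move=> Hf /hcoordP xP /xP[b b0 ->] /hcoordP yP /yP[c c0 ->].
have bc0 : b ^+ d * c ^+ e != 0 by rewrite mulf_neq0 ?expf_neq0.
have t0 i : row_mx (const_mx b : 'rV[K]_m.+1) (const_mx c : 'rV[K]_n.+1) 0 i
    != 0.
  by rewrite mxE; case: split => ?; rewrite mxE.
split=> H i.
- have := pder_rescale (hcoord P.1) (hcoord P.2) b c i Hf.
  by rewrite H mulr0 => /eqP; rewrite mulf_eq0 (negPf (t0 i)) => /eqP.
- have := pder_rescale (hcoord P.1) (hcoord P.2) b c i Hf.
  by rewrite H mulr0 => /esym/eqP; rewrite mulf_eq0 (negPf bc0) => /eqP.
Qed.

Lemma multihomog_rescale s (F : {mpoly K[s * N]}) (A : 'M[K]_(s, N))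
    (b c : 'I_s -> K) :
  multihomog F -> (forall k, b k != 0) -> (forall k, c k != 0) ->
  F.@[mxvec A 0] = 0 <->
  F.@[mxvec (\matrix_(k, i) ((row_mx (const_mx (b k) : 'rV[K]_m.+1)
                 (const_mx (c k) : 'rV[K]_n.+1)) 0 i * A k i)) 0] = 0.
Proof.
move=> [d [e HF]] b0 c0; set B := \matrix_(k, i) _.
have -> : F.@[mxvec B 0] =
    (\prod_k (b k ^+ d k * c k ^+ e k)) * F.@[mxvec A 0].
  rewrite !mevalE mulr_sumr big_seq [RHS]big_seq.
  apply: eq_bigr => a /HF Ha; rewrite mulrCA; congr (_ * _).
  have [g gK Kg] := curry_mxvec_bij s N.
  have big_mxvec (G : 'I_(s * N) -> K) :
      \prod_j G j = \prod_k \prod_i G (mxvec_index k i).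
    rewrite pair_bigA (reindex (uncurry (@mxvec_index s N))) /=.
      by apply: eq_bigr => -[].
    by exists g => [p|j] _; [apply: gK | apply: Kg].
  rewrite !big_mxvec -big_split; apply: eq_bigr => k _ /=.
  under eq_bigr do rewrite mxvecE mxE exprMn.
  rewrite big_split /=; congr (_ * _); last first.
    by apply: eq_bigr => i _; rewrite mxvecE.
  have [<- <-] := Ha k; rewrite big_split_ord /= /mxdeg /mydeg -!prodrXr.
  by congr (_ * _); apply: eq_bigr => j _; rewrite (row_mxEl, row_mxEr) mxE.
have bc0 : \prod_k (b k ^+ d k * c k ^+ e k) != 0.
  by apply/prodf_neq0 => k _; rewrite mulf_neq0 ?expf_neq0.
split=> [->|/eqP]; first by rewrite mulr0.
by rewrite mulf_eq0 (negPf bc0) => /eqP.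
Qed.

End Facts.

(* Main.v *)
(* A form of bidegree (1,2) is a tensor T(x; y, z) symmetric in y and z, singular
   at (x, y) iff T(x; y, -) = 0 and T(-; y, y) = 0.  The virtual dimension being
   nonpositive, and the absence of nonzero forms being an open condition (a maximal
   minor of the Jacobian conditions does not vanish), it is enough to find one
   configuration without nonzero singular form.

   Write C^(n+1) = V0 + U_1 + ... + U_k with dim U_j = 2 and U_j spanned by u0, u1.
   A few points are put in C^(m+1) x V0, and each U_j receives m+1 points
   (e_i, c_i b_i - w_i u0 - w'_i u1) with b_i in V0, two of which are (e_o0, u0) and
   (e_o1, u1).  If T is singular at all of them, eliminating u0 and u1 leaves two
   linear conditions on T restricted to V0 for each j.  For well-chosen parameters
   these conditions annihilate the restriction of T to V0: here k, hence n, has to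
   be large compared with m^3.  For other parameters, T = 0 follows from T = 0 on
   V0.  Both properties are open, so both hold at a general point of the line
   joining the two choices of parameters. *)

(* A plane raises n by 2 and the number of points by m+1, exactly the growth of [sbar], so the
   choice of V0 depends only on the parities. It has dimension m-1 and carries one point if n-m is
   even; it has dimension m and carries (m+3)/2 points if m is odd and n even. In the excluded
   parity the product halved in [sbar] is odd. The tensors on V0 singular at these points have about
   m^3/2 coordinates, to be killed two at a time by about n/2 planes: this is the origin of the
   cubic bound.

   The margin does not allow a condition to be lost in every row of coordinates, so the coordinates
   are paired with at most one left over, across rows if need be. Two specializations are needed
   because the parameters that make the conditions on V0 explicit have most weights and first
   factors zero, and then say too little about the mixed terms between planes. The case m = 3, n
   even stands apart: the points of V0 use up its three coordinate vectors, whereas the pairing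
   needs a spare one. *)
Require Import Defs.
From mathcomp Require Import all_boot all_order all_algebra.
From mathcomp Require Import fingroup perm reals complex mpoly.
From mathcomp Require Import zify ring lra.

Set Implicit Arguments.
Unset Strict Implicit.
Unset Printing Implicit Defensive.

Import GRing.Theory Num.Theory.

Local Open Scope ring_scope.

(** * Openness *)

Section Minors.
Variables (K : fieldType) (m n s : nat).
Local Notation N := (nvars m n).

(** [multihomog] hides the degrees under an existential; here they are explicit, since a sum is
    multihomogeneous only if its terms share them. *)
Definition of_mdegs (d e : 'I_s -> nat) (F : {mpoly K[s * N]}) : Prop :=
  forall a, a \in msupp F ->
    forall k, mxdeg (n := n) a k = d k /\ mydeg (m := m) a k = e k.

Lemma of_mdegsD d e F G : of_mdegs d e F -> of_mdegs d e G ->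
  of_mdegs d e (F + G).
Proof.
by move=> HF HG a /msuppD_le; rewrite mem_cat => /orP[/HF|/HG].
Qed.

Lemma of_mdegsZ d e c F : of_mdegs d e F -> of_mdegs d e (c *: F).
Proof. by move=> HF a /msuppZ_le /HF. Qed.

Lemma of_mdegs0 d e : of_mdegs d e 0.
Proof. by move=> a; rewrite msupp0. Qed.

Lemma of_mdegs_sum (I : finType) d e (F : I -> {mpoly K[s * N]}) :
  (forall i, of_mdegs d e (F i)) -> of_mdegs d e (\sum_i F i).
Proof.
move=> HF; elim/big_ind: _ => [|x y|i _]; [exact: of_mdegs0|exact: of_mdegsD|].
exact: HF.
Qed.

Lemma mxdegD (a b : 'X_{1..s * N}) k :
  mxdeg (n := n) (a + b)%MM k = (mxdeg (n := n) a k + mxdeg (n := n) b k)%N.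
Proof. by rewrite /mxdeg -big_split; apply: eq_bigr => i _; rewrite mnmDE. Qed.

Lemma mydegD (a b : 'X_{1..s * N}) k :
  mydeg (m := m) (a + b)%MM k = (mydeg (m := m) a k + mydeg (m := m) b k)%N.
Proof. by rewrite /mydeg -big_split; apply: eq_bigr => i _; rewrite mnmDE. Qed.

Lemma of_mdegsM d e d' e' F G : of_mdegs d e F -> of_mdegs d' e' G ->
  of_mdegs (fun k => d k + d' k)%N (fun k => e k + e' k)%N (F * G).
Proof.
move=> HF HG a /msuppM_le /allpairsP[[b c] /= [/HF Hb /HG Hc ->]] k.
by rewrite mxdegD mydegD; have [-> ->] := Hb k; have [-> ->] := Hc k.
Qed.

Lemma of_mdegs1 : of_mdegs (fun=> 0%N) (fun=> 0%N) 1.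
Proof.
move=> a; rewrite msupp1 inE => /eqP -> k.
by rewrite /mxdeg /mydeg !big1 // => i _; rewrite mnm0E.
Qed.

Lemma of_mdegs_prod (I : finType) (d e : I -> 'I_s -> nat)
    (F : I -> {mpoly K[s * N]}) :
  (forall i, of_mdegs (d i) (e i) (F i)) ->
  of_mdegs (fun k => \sum_i d i k)%N (fun k => \sum_i e i k)%N (\prod_i F i).
Proof.
move=> HF; rewrite -!/(index_enum I).
elim: (index_enum I) => [|i r IH].
  rewrite big_nil => a /of_mdegs1 H k; rewrite !big_nil; exact: H.
rewrite big_cons => a /(of_mdegsM (HF i) IH) H k; rewrite !big_cons; exact: H.
Qed.

Definition block_mon (k : 'I_s) (b : 'X_{1..N}) : 'X_{1..s * N} :=
  (\sum_(i < N) U_(mxvec_index k i) *+ b i)%MM.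

Lemma mxvec_index_eq (k k' : 'I_s) (i i' : 'I_N) :
  (mxvec_index k i == mxvec_index k' i') = (k == k') && (i == i').
Proof.
apply/eqP/andP => [H|[/eqP-> /eqP->]//].
have [g gK _] := curry_mxvec_bij s N.
have := gK (k, i) isT; rewrite /= H (gK (k', i') isT) => -[-> ->].
by rewrite !eqxx.
Qed.

Lemma block_monE k b k' i' :
  block_mon k b (mxvec_index k' i') = ((k == k') * b i')%N.
Proof.
rewrite /block_mon mnm_sumE (bigD1 i') //= big1 => [|i ne].
  by rewrite mulmnE mnm1E mxvec_index_eq eqxx andbT addn0.
by rewrite mulmnE mnm1E mxvec_index_eq (negPf ne) andbF.
Qed.

Lemma mxdeg_block k b k' :
  mxdeg (n := n) (block_mon k b) k' = ((k == k') * xdeg (m := m) (n := n) b)%N.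
Proof.
by rewrite /mxdeg /xdeg big_distrr; apply: eq_bigr => i _; rewrite block_monE.
Qed.

Lemma mydeg_block k b k' :
  mydeg (m := m) (block_mon k b) k' = ((k == k') * ydeg (m := m) (n := n) b)%N.
Proof.
by rewrite /mydeg /ydeg big_distrr; apply: eq_bigr => i _; rewrite block_monE.
Qed.

Lemma meval_block (P : 'I_s -> biproj K m n) k b :
  ('X_[block_mon k b]).@[mcoords P 0] = ('X_[b]).@[coords (P k) 0].
Proof.
rewrite /block_mon -mprodXE /= rmorph_prod /= mevalX; apply: eq_bigr => i _.
by rewrite -mpolyXn rmorphXn /= mevalXU /mcoords mxvecE mxE.
Qed.

Definition bimon := {a : 'X_{1..N < 4} |
  (xdeg (n := n) a == 1%N) && (ydeg (m := m) a == 2%N)}.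

Definition mon_of (a : 'I_#|{: bimon}|) : 'X_{1..N} :=
  bmnm (val (enum_val a : bimon)).

(** Generic matrix of the singularity conditions: its left kernel at P is the space of coefficient
    vectors of the forms singular at the points of P. *)
Definition jac_poly : 'M[{mpoly K[s * N]}]_(#|{: bimon}|, s * N) :=
  \matrix_a mxvec (\matrix_(k, i)
    ((mon_of a i)%:R *: 'X_[block_mon k (mon_of a - U_(i))])).

Definition jac (P : 'I_s -> biproj K m n) : 'M[K]_(#|{: bimon}|, s * N) :=
  \matrix_a mxvec (\matrix_(k, i) ('X_[mon_of a]^`M(i)).@[coords (P k) 0]).

Lemma jacE P a k i : jac P a (mxvec_index k i) =
  ('X_[mon_of a]^`M(i)).@[coords (P k) 0].
Proof.
by rewrite /jac mxE mxvecE mxE.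
Qed.

Lemma jac_polyE a k i : jac_poly a (mxvec_index k i) =
  (mon_of a i)%:R *: 'X_[block_mon k (mon_of a - U_(i))].
Proof. by rewrite /jac_poly mxE mxvecE mxE. Qed.

Lemma jac_eval P : jac P = map_mx (meval (mcoords P 0)) jac_poly.
Proof.
apply/matrixP => a j; rewrite [RHS]mxE; case/mxvec_indexP: j => k i.
by rewrite jacE jac_polyE mevalZ meval_block mderivX mevalZ.
Qed.

(** All entries of a column are derivatives, by one variable at one point, of monomials of the same
    bidegree; the zero entries are compatible with any degrees. *)
Lemma jac_poly_degs (j : 'I_(s * N)) : exists de : ('I_s -> nat) * ('I_s -> nat),
  forall a, of_mdegs de.1 de.2 (jac_poly a j).
Proof.
case/mxvec_indexP: j => k i.
exists (fun k' => (k == k') * (1 - xdeg (m := m) (n := n) U_(i)),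
        fun k' => (k == k') * (2 - ydeg (m := m) (n := n) U_(i)))%N.
move=> a /=; rewrite jac_polyE.
have [->|ai] := eqVneq (mon_of a i) 0%N; first by rewrite scale0r; apply: of_mdegs0.
apply: of_mdegsZ => b; rewrite msuppX inE => /eqP-> k'.
rewrite mxdeg_block mydeg_block.
have /andP[/eqP xa /eqP ya] := valP (enum_val a : bimon).
have Ua : (U_(i) <= mon_of a)%MM by rewrite lep1mP.
have E : mon_of a = ((mon_of a - U_(i)) + U_(i))%MM by rewrite submK.
have -> : xdeg (n := n) (mon_of a - U_(i))%MM = (1 - xdeg (m := m) (n := n) U_(i))%N.
  rewrite -xa {2}/mon_of in E *.
  have -> : xdeg (n := n) (mon_of a) =
      (xdeg (m := m) (n := n) (mon_of a - U_(i))%MM + xdeg (m := m) (n := n) U_(i))%N.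
    by rewrite {1}E /xdeg -big_split; apply: eq_bigr => ? _; rewrite mnmDE.
  by rewrite addnK.
have -> : ydeg (m := m) (mon_of a - U_(i))%MM = (2 - ydeg (m := m) (n := n) U_(i))%N.
  rewrite -ya.
  have -> : ydeg (m := m) (mon_of a) =
      (ydeg (m := m) (n := n) (mon_of a - U_(i))%MM + ydeg (m := m) (n := n) U_(i))%N.
    by rewrite {1}E /ydeg -big_split; apply: eq_bigr => ? _; rewrite mnmDE.
  by rewrite addnK.
by [].
Qed.

Definition minor (f : {ffun 'I_#|{: bimon}| -> 'I_(s * N)}) : {mpoly K[s * N]} :=
  \det (colsub f jac_poly).

(** Each term of the Leibniz expansion takes one entry from every selected column, and the degrees
    are attached to the columns. *)
Lemma minor_multihomog f : multihomog (minor f).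
Proof.
have [de Hde] := fin_all_exists jac_poly_degs.
exists (fun k => \sum_a (de (f a)).1 k)%N, (fun k => \sum_a (de (f a)).2 k)%N.
apply: of_mdegs_sum => t; rewrite -signr_odd.
have -> : forall (b : bool) (G : {mpoly K[s * N]}), (-1) ^+ b * G = ((-1) ^+ b) *: G.
  by case=> G; rewrite ?expr0 ?expr1 ?scale1r ?mul1r // mulN1r scaleN1r.
apply: of_mdegsZ.
have H := of_mdegs_prod (fun a => Hde (f (t a)) a).
move=> b bF k; have /H /(_ k) [-> ->] : b \in msupp (\prod_a jac_poly a (f (t a))).
  by move: bF; congr (_ \in msupp _); apply: eq_bigr => a _; rewrite mxE.
by split; rewrite [RHS](reindex_inj (@perm_inj _ t)).
Qed.

Lemma row_free_minors P : row_free (jac P) <->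
  exists f, (minor f).@[mcoords P 0] != 0.
Proof.
have mE f : (minor f).@[mcoords P 0] = \det (colsub f (jac P)).
  by rewrite -det_map_mx; congr (\det _); apply/matrixP => a b; rewrite jac_eval !mxE.
split=> [rf|[f]].
- have rf' : row_full (jac P)^T by rewrite /row_full mxrank_tr.
  have := fullrowsub_unit rf'.
  rewrite unitmxE unitfE => H; exists (fullrankfun rf').
  rewrite mE -det_tr; apply: contra_neq H => <-; congr (\det _).
  by apply/matrixP => a b; rewrite !mxE.
- rewrite mE -unitfE -unitmxE => U.
  apply/row_freeP.
  (* Selecting the columns f and then inverting the square block is a right inverse. *)
  exists ((colsub f 1%:M) *m invmx (colsub f (jac P))).
  rewrite mulmxA; have -> : jac P *m colsub f 1%:M = colsub f (jac P).
    apply/matrixP => a b; rewrite !mxE (bigD1 (f b)) //= big1 => [|j ne].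
      by rewrite !mxE eqxx mulr1 addr0.
    by rewrite !mxE (negPf ne) mulr0.
  by rewrite mulmxV.
Qed.

Definition bipoly (w : 'rV[K]_#|{: bimon}|) : {mpoly K[N]} :=
  \sum_a w 0 a *: 'X_[mon_of a].

Lemma mon_of_inj : injective mon_of.
Proof. by move=> a b /val_inj /val_inj /enum_val_inj. Qed.

Lemma mon_ofP (b : 'X_{1..N}) : xdeg (n := n) b = 1%N -> ydeg (m := m) b = 2%N ->
  exists a, b = mon_of a.
Proof.
move=> xb yb; have db : (mdeg b < 4)%N by rewrite mdeg_bideg xb yb.
have Hb : (xdeg (n := n) (BMultinom db) == 1%N) && (ydeg (m := m) (BMultinom db) == 2%N).
  by rewrite /= xb yb.
exists (enum_rank (Sub (BMultinom db) Hb : bimon)).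
by rewrite /mon_of enum_rankK.
Qed.

Lemma mcoeff_bipoly w a : (bipoly w)@_(mon_of a) = w 0 a.
Proof.
rewrite /bipoly raddf_sum /= (bigD1 a) //= big1 => [|b ne].
  by rewrite mcoeffZ mcoeffX eqxx mulr1 addr0.
by rewrite mcoeffZ mcoeffX (inj_eq mon_of_inj) (negPf ne) mulr0.
Qed.

Lemma bipoly_bihomog w : bihomog 1 2 (bipoly w).
Proof.
apply/allP => b /msupp_sum_le /flattenP[l /mapP[a _ ->] /msuppZ_le].
rewrite msuppX inE => /eqP ->; exact: valP (enum_val a : bimon).
Qed.

Lemma bihomog_bipoly (f : {mpoly K[N]}) : bihomog 1 2 f ->
  f = bipoly (\row_a f@_(mon_of a)).
Proof.
move=> /allP Hf; apply/mpolyP => b.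
have [bf|bf] := boolP (b \in msupp f).
  have /andP[/eqP xb /eqP yb] := Hf _ bf; have [a ->] := mon_ofP xb yb.
  by rewrite mcoeff_bipoly mxE.
rewrite (memN_msupp_eq0 bf); apply/esym/eqP; rewrite mcoeff_eq0; apply/negP => bb.
have /allP/(_ _ bb)/andP[/eqP xb /eqP yb] := bipoly_bihomog (\row_a f@_(mon_of a)).
have [a E] := mon_ofP xb yb; move: bb; rewrite mcoeff_msupp E mcoeff_bipoly mxE -E.
by rewrite (memN_msupp_eq0 bf) eqxx.
Qed.

Lemma mul_jac w P k i : (w *m jac P) 0 (mxvec_index k i) =
  ((bipoly w)^`M(i)).@[coords (P k) 0].
Proof.
rewrite mxE /bipoly (raddf_sum (mderiv i)) /= (raddf_sum (meval _)) /=.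
apply: eq_bigr => a _.
by rewrite jacE mderivZ mevalZ.
Qed.

Lemma dim_sing_forms0 (P : 'I_s -> biproj K m n) :
  (\dim (sing_forms P) == 0%N) <-> row_free (jac P).
Proof.
rewrite dimv_eq0; split=> [/eqP sf0|rf].
- rewrite -kermx_eq0; apply/eqP/row_matrixP => r; rewrite row0.
  set w := row r _; have w0 : w *m jac P = 0 by apply/sub_kermxP; apply: row_sub.
  have [g Eg] := form3_polyK (bipoly_bihomog w).
  have : g \in sing_forms P.
    apply/mem_sing_forms; rewrite Eg; split; first exact: bipoly_bihomog.
    by move=> k i; rewrite -mul_jac w0 mxE.
  rewrite sf0 memv0 => /eqP g0; apply/rowP => a.
  by rewrite -mcoeff_bipoly -Eg g0 mcoeff0 mxE.
- apply/eqP/vspaceP => f; rewrite memv0; apply/idP/eqP => [|->]; last exact: mem0v.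
  move/mem_sing_forms => [bf sf].
  have E := bihomog_bipoly bf.
  apply/val_inj; rewrite /= -[mpoly_of_dhomog f]/(form3_poly f) E.
  set w := \row_a _; suff -> : w = 0.
    by rewrite /bipoly big1 // => a _; rewrite mxE scale0r.
  apply: (row_free_inj rf); rewrite mul0mx; apply/rowP => j.
  case/mxvec_indexP: j => k i; rewrite mul_jac -E mxE; exact: sf.
Qed.

Lemma zariski_open_sing0 :
  zariski_open (fun P : 'I_s -> biproj K m n => \dim (sing_forms P) = 0%N).
Proof.
exists (fun F => exists f, F = minor f); split=> [F [f ->]|P].
  exact: minor_multihomog.
split=> [H F [f ->]|H /eqP/dim_sing_forms0/row_free_minors[f]].
  apply/eqP/negPn/negP => Hf; apply: H; apply/eqP/dim_sing_forms0.
  by apply/row_free_minors; exists f.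
by rewrite H ?eqxx //; exists f.
Qed.

End Minors.

Lemma non_defective_superabundant (K : fieldType) m n :
  superabundant m n ->
  (exists P : 'I_(sbar m n) -> biproj K m n, \dim (sing_forms P) = 0%N) ->
  non_defective K m n.
Proof.
move=> sa ex; exists (fun P => \dim (sing_forms P) = 0%N); split=> //.
  exact: zariski_open_sing0.
by move=> P ->; apply/esym/Order.TotalTheory.max_idPl.
Qed.

(** * Forms of bidegree (1,2) as tensors *)

Section Tri.
Variables (K : fieldType) (I J : finType).
Local Notation X := {ffun I -> K^o}.
Local Notation V := {ffun J -> K^o}.
Local Notation tensor := {ffun I * J * J -> K^o}.

Definition tri (T : tensor) (x : X) (y z : V) : K :=
  \sum_(q : I * J * J) T q * (x q.1.1 * y q.1.2 * z q.2).

Definition singT T x y :=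
  (forall z, tri T x y z = 0) /\ (forall x', tri T x' y y = 0).

Definition symT (T : tensor) := forall i a b, T (i, a, b) = T (i, b, a).

Definition rigid (S : Type) (x : S -> X) (y : S -> V) :=
  forall T, symT T -> (forall s, singT T (x s) (y s)) -> T = 0.

(* Coordinate vectors of the left and of the right factor. *)
Definition dl (i : I) : X := [ffun i' => (i' == i)%:R].
Definition dr (a : J) : V := [ffun a' => (a' == a)%:R].

Lemma triE T x y z : tri T x y z =
  \sum_i \sum_a \sum_b T (i, a, b) * (x i * y a * z b).
Proof. by rewrite pair_bigA pair_bigA; apply: eq_bigr => -[[]]. Qed.

Variable T : tensor.

Lemma triDl x x' y z : tri T (x + x') y z = tri T x y z + tri T x' y z.
Proof. by rewrite -big_split; apply: eq_bigr => q _; rewrite ffunE /=; ring. Qed.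

Lemma triZl c x y z : tri T (c *: x) y z = c * tri T x y z.
Proof.
by rewrite mulr_sumr; apply: eq_bigr => q _; rewrite ffunE /GRing.scale /=; ring.
Qed.

Lemma triDm x y y' z : tri T x (y + y') z = tri T x y z + tri T x y' z.
Proof. by rewrite -big_split; apply: eq_bigr => q _; rewrite ffunE /=; ring. Qed.

Lemma triZm c x y z : tri T x (c *: y) z = c * tri T x y z.
Proof.
by rewrite mulr_sumr; apply: eq_bigr => q _; rewrite ffunE /GRing.scale /=; ring.
Qed.

Lemma triDr x y z z' : tri T x y (z + z') = tri T x y z + tri T x y z'.
Proof. by rewrite -big_split; apply: eq_bigr => q _; rewrite ffunE /=; ring. Qed.

Lemma triZr c x y z : tri T x y (c *: z) = c * tri T x y z.
Proof.
by rewrite mulr_sumr; apply: eq_bigr => q _; rewrite ffunE /GRing.scale /=; ring.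
Qed.

Lemma tri0l y z : tri T 0 y z = 0.
Proof. by rewrite -(scale0r (0 : X)) triZl mul0r. Qed.
Lemma tri0m x z : tri T x 0 z = 0.
Proof. by rewrite -(scale0r (0 : V)) triZm mul0r. Qed.
Lemma tri0r x y : tri T x y 0 = 0.
Proof. by rewrite -(scale0r (0 : V)) triZr mul0r. Qed.

Lemma tri_suml (R : Type) (r : seq R) (P : pred R) F y z :
  tri T (\sum_(i <- r | P i) F i) y z = \sum_(i <- r | P i) tri T (F i) y z.
Proof. by apply: (big_morph (fun x => tri T x y z)) => [x x'|]; rewrite ?triDl ?tri0l. Qed.
Lemma tri_summ (R : Type) (r : seq R) (P : pred R) F x z :
  tri T x (\sum_(i <- r | P i) F i) z = \sum_(i <- r | P i) tri T x (F i) z.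
Proof. by apply: (big_morph (fun y => tri T x y z)) => [y y'|]; rewrite ?triDm ?tri0m. Qed.
Lemma tri_sumr (R : Type) (r : seq R) (P : pred R) F x y :
  tri T x y (\sum_(i <- r | P i) F i) = \sum_(i <- r | P i) tri T x y (F i).
Proof. by apply: (big_morph (fun z => tri T x y z)) => [y' z|]; rewrite ?triDr ?tri0r. Qed.

Lemma tri_dl x y z : tri T x y z = \sum_i x i * tri T (dl i) y z.
Proof.
have {1}-> : x = \sum_i x i *: dl i.
  apply/ffunP => i; rewrite sum_ffunE (bigD1 i) //= big1 => [|j ne].
    by rewrite !ffunE eqxx /GRing.scale /= mulr1 addr0.
  by rewrite !ffunE eq_sym (negPf ne) scaler0.
by rewrite tri_suml; apply: eq_bigr => i _; rewrite triZl.
Qed.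

Lemma dr_sum (y : V) : y = \sum_a y a *: dr a.
Proof.
apply/ffunP => i; rewrite sum_ffunE (bigD1 i) //= big1 => [|j ne].
  by rewrite !ffunE eqxx /GRing.scale /= mulr1 addr0.
by rewrite !ffunE eq_sym (negPf ne) scaler0.
Qed.

Lemma tri_dm x y z : tri T x y z = \sum_a y a * tri T x (dr a) z.
Proof. by rewrite {1}[y]dr_sum tri_summ; apply: eq_bigr => i _; rewrite triZm. Qed.

Lemma tri_dr x y z : tri T x y z = \sum_b z b * tri T x y (dr b).
Proof. by rewrite {1}[z]dr_sum tri_sumr; apply: eq_bigr => i _; rewrite triZr. Qed.

Lemma tri_basis i a b : tri T (dl i) (dr a) (dr b) = T (i, a, b).
Proof.
rewrite /tri (bigD1 (i, a, b)) //= big1 => [|[[i' a'] b'] ne].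
  by rewrite !ffunE !eqxx !mulr1 addr0.
rewrite !ffunE /=; move: ne; rewrite !xpair_eqE.
by case: (i' == i); case: (a' == a); case: (b' == b) => //= _; rewrite ?(mul0r, mulr0).
Qed.

Lemma triC x y z : symT T -> tri T x y z = tri T x z y.
Proof.
move=> sT; rewrite !triE; apply: eq_bigr => i _; rewrite exchange_big /=.
by apply: eq_bigr => a _; apply: eq_bigr => b _; rewrite sT; ring.
Qed.

Lemma tri_comb3m a b c x p q s z : tri T x (a *: p + b *: q + c *: s) z =
  a * tri T x p z + b * tri T x q z + c * tri T x s z.
Proof. by rewrite !triDm !triZm. Qed.

Lemma tri_comb3r a b c x p q s z : tri T x z (a *: p + b *: q + c *: s) =
  a * tri T x z p + b * tri T x z q + c * tri T x z s.
Proof. by rewrite !triDr !triZr. Qed.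

Lemma tri_quad3 a b c x p q s : symT T ->
  tri T x (a *: p + b *: q + c *: s) (a *: p + b *: q + c *: s) =
  a * a * tri T x p p + b * b * tri T x q q + c * c * tri T x s s +
  2 * (a * b * tri T x p q + a * c * tri T x p s + b * c * tri T x q s).
Proof.
move=> sT; rewrite tri_comb3m !tri_comb3r (triC x q p sT) (triC x s p sT) (triC x s q sT).
by ring.
Qed.

Lemma tensor_eq0 : (forall i a b, tri T (dl i) (dr a) (dr b) = 0) -> T = 0.
Proof. by move=> H; apply/ffunP => -[[i a] b]; rewrite -tri_basis H ffunE. Qed.

Lemma singTP x y : symT T -> (forall b, tri T x y (dr b) = 0) ->
  (forall i, tri T (dl i) y y = 0) -> singT T x y.
Proof.
move=> sT H1 H2; split=> [z|x'].
  by rewrite tri_dr big1 // => b _; rewrite H1 mulr0.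
by rewrite tri_dl big1 // => b _; rewrite H2 mulr0.
Qed.

End Tri.

Section RigidTransfer.
Variables (K : fieldType) (I J I' J' : finType).

Lemma rigid_bij (f : I' -> I) (g : J' -> J) (S : Type)
    (x : S -> {ffun I -> K^o}) (y : S -> {ffun J -> K^o}) :
  bijective f -> bijective g -> rigid x y ->
  rigid (fun s => [ffun i => x s (f i)]) (fun s => [ffun a => y s (g a)]).
Proof.
move=> [f' fK f'K] [g' gK g'K] rxy T sT HT.
pose T' : {ffun I * J * J -> K^o} := [ffun q => T (f' q.1.1, g' q.1.2, g' q.2)].
have E x1 y1 z1 : tri T' x1 y1 z1 =
    tri T [ffun i => x1 (f i)] [ffun a => y1 (g a)] [ffun a => z1 (g a)].
  rewrite !triE (reindex f) /=; last by exists f' => ? _.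
  apply: eq_bigr => i _; rewrite (reindex g) /=; last by exists g' => ? _.
  apply: eq_bigr => a _; rewrite (reindex g) /=; last by exists g' => ? _.
  by apply: eq_bigr => b _; rewrite !ffunE /= fK !gK.
have T'0 : T' = 0.
  apply: rxy => [i a b|s]; first by rewrite !ffunE.
  have [H1 H2] := HT s; split=> [z|x1]; first by rewrite E H1.
  by rewrite E H2.
apply/ffunP => -[[i a] b].
by have := congr1 (fun t : {ffun _} => t (f i, g a, g b)) T'0; rewrite !ffunE /= fK !gK.
Qed.

End RigidTransfer.

Section Forms.
Variables (K : numFieldType) (m n : nat).
Local Notation N := (nvars m n).
Implicit Types f : {mpoly K[N]}.

Local Notation lx i := (lshift n.+1 i : 'I_N).
Local Notation ry a := (rshift m.+1 a : 'I_N).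

Lemma euler_term (a : 'X_{1..N}) (c : K) i :
  'X_i * (((a i)%:R * c) *: 'X_[a - U_(i)]) = (c *: 'X_[a]) *+ a i :> {mpoly K[N]}.
Proof.
have [->|ai] := eqVneq (a i) 0%N; first by rewrite mul0r scale0r mulr0.
rewrite -scalerAr -mpolyXD addmC submK; last by rewrite lep1mP.
by rewrite -scalerA scaler_nat.
Qed.

Lemma euler_x d e f : bihomog d e f ->
  f *+ d = \sum_(i < m.+1) 'X_(lx i) * f^`M(lx i).
Proof.
move=> /allP Hf; rewrite {1}[f]mpolyE -sumrMnl.
transitivity (\sum_(a <- msupp f) \sum_(i < m.+1) (f@_a *: 'X_[a]) *+ a (lx i)).
  rewrite big_seq [RHS]big_seq; apply: eq_bigr => a /Hf /andP[/eqP <- _].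
  by rewrite /xdeg sumrMnr.
rewrite exchange_big; apply: eq_bigr => i _ /=.
by rewrite /mderiv mulr_sumr; apply: eq_bigr => a _; rewrite euler_term.
Qed.

Lemma euler_y d e f : bihomog d e f ->
  f *+ e = \sum_(a < n.+1) 'X_(ry a) * f^`M(ry a).
Proof.
move=> /allP Hf; rewrite {1}[f]mpolyE -sumrMnl.
transitivity (\sum_(a <- msupp f) \sum_(i < n.+1) (f@_a *: 'X_[a]) *+ a (ry i)).
  rewrite big_seq [RHS]big_seq; apply: eq_bigr => a /Hf /andP[_ /eqP <-].
  by rewrite /ydeg sumrMnr.
rewrite exchange_big; apply: eq_bigr => i _ /=.
by rewrite /mderiv mulr_sumr; apply: eq_bigr => a _; rewrite euler_term.
Qed.

Lemma xdegDU (a : 'X_{1..N}) (j : 'I_N) : xdeg (m := m) (n := n) (a + U_(j))%MM =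
  (xdeg (m := m) (n := n) a + xdeg (m := m) (n := n) U_(j))%N.
Proof. by rewrite /xdeg -big_split; apply: eq_bigr => i _; rewrite mnmDE. Qed.

Lemma ydegDU (a : 'X_{1..N}) (j : 'I_N) : ydeg (m := m) (n := n) (a + U_(j))%MM =
  (ydeg (m := m) (n := n) a + ydeg (m := m) (n := n) U_(j))%N.
Proof. by rewrite /ydeg -big_split; apply: eq_bigr => i _; rewrite mnmDE. Qed.

Lemma bihomog_deriv d e f (j : 'I_N) : bihomog d e f ->
  bihomog (d - xdeg (m := m) (n := n) U_(j)) (e - ydeg (m := m) (n := n) U_(j))
    f^`M(j).
Proof.
move=> /allP Hf; apply/allP => a; rewrite mcoeff_msupp mcoeff_mderiv => H.
have /Hf : (a + U_(j))%MM \in msupp f.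
  by rewrite mcoeff_msupp; apply: contra_neq H => ->; rewrite mul0rn.
by rewrite xdegDU ydegDU => /andP[/eqP<- /eqP<-]; rewrite !addnK !eqxx.
Qed.

Lemma deg_lx (i : 'I_m.+1) :
  (xdeg (m := m) (n := n) U_(lx i) = 1%N) * (ydeg (m := m) (n := n) U_(lx i) = 0%N).
Proof.
split; rewrite /xdeg /ydeg.
  rewrite (bigD1 i) //= mnm1E eqxx big1 // => j ne.
  by rewrite mnm1E (inj_eq (@lshift_inj _ _)) eq_sym (negPf ne).
by rewrite big1 // => j _; rewrite mnm1E eq_lrshift.
Qed.

Lemma deg_ry (i : 'I_n.+1) :
  (xdeg (m := m) (n := n) U_(ry i) = 0%N) * (ydeg (m := m) (n := n) U_(ry i) = 1%N).
Proof.
split; rewrite /xdeg /ydeg; last first.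
  rewrite (bigD1 i) //= mnm1E eqxx big1 // => j ne.
  by rewrite mnm1E (inj_eq (@rshift_inj _ _)) eq_sym (negPf ne).
by rewrite big1 // => j _; rewrite mnm1E eq_rlshift.
Qed.

Lemma bihomog_dx d e f i : bihomog d e f -> bihomog d.-1 e f^`M(lx i).
Proof. by move/(bihomog_deriv (lx i)); rewrite !deg_lx subn1 subn0. Qed.

Lemma bihomog_dy d e f a : bihomog d e f -> bihomog d e.-1 f^`M(ry a).
Proof. by move/(bihomog_deriv (ry a)); rewrite !deg_ry subn1 subn0. Qed.

Lemma bihomog00 f : bihomog 0 0 f -> f = (f@_0)%:MP.
Proof.
move=> /allP Hf; apply/mpolyP => a; rewrite mcoeffC.
case: eqVneq => [<-|ne]; first by rewrite mulr1.
rewrite mulr0; apply: memN_msupp_eq0; apply: contra ne => /Hf.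
by move=> /andP[/eqP xa /eqP ya]; rewrite -mdeg_eq0 mdeg_bideg xa ya.
Qed.

(** On forms of bidegree (1,2) these third derivatives are constants, so evaluation at 0 loses
    nothing. The value of the tensor at (x; y, y) is twice the form. *)
Definition form_tensor f : {ffun 'I_m.+1 * 'I_n.+1 * 'I_n.+1 -> K^o} :=
  [ffun q => (f^`M(ry q.1.2)^`M(lx q.1.1)^`M(ry q.2))@_0].

Lemma form_tensor_sym f : symT (form_tensor f).
Proof.
move=> i a b; rewrite !ffunE /=.
by rewrite (mderiv_comm (ry a) (lx i)) (mderiv_comm (ry b) (lx i))
  (mderiv_comm (ry a) (ry b)).
Qed.

Variable f : {mpoly K[N]}.
Hypothesis f12 : bihomog 1 2 f.

Lemma form_tensorE i a b :
  f^`M(ry a)^`M(lx i)^`M(ry b) = (form_tensor f (i, a, b))%:MP.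
Proof.
rewrite ffunE; apply: bihomog00.
exact: (bihomog_dy b (bihomog_dx i (bihomog_dy a f12))).
Qed.

Lemma dyx_eval i a (x : 'rV[K]_m.+1) (y : 'rV[K]_n.+1) :
  (f^`M(ry a)^`M(lx i)).@[row_mx x y 0] = \sum_b y 0 b * form_tensor f (i, a, b).
Proof.
rewrite -[f^`M(_)^`M(_)]mulr1n (euler_y (bihomog_dx i (bihomog_dy a f12))).
rewrite (raddf_sum (meval _)) /=; apply: eq_bigr => b _.
by rewrite mevalM mevalXU row_mxEr form_tensorE mevalC.
Qed.

(** By Euler's relations the derivative by the b-th y-variable is T(x; y, [dr b]), and twice the
    derivative by the i-th x-variable is T([dl i]; y, y). *)
Lemma singular_vec_tensor (x : 'rV[K]_m.+1) (y : 'rV[K]_n.+1) :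
  singular_vec f (row_mx x y) ->
  singT (form_tensor f) [ffun i => x 0 i] [ffun a => y 0 a].
Proof.
move=> sf;
apply: (singTP (@form_tensor_sym f)) => [b|i].
- rewrite triC; last exact: form_tensor_sym.
  transitivity ((f^`M(ry b)).@[row_mx x y 0]); last exact: sf.
  rewrite -[f^`M(_)]mulr1n (euler_x (bihomog_dy b f12)) (raddf_sum (meval _)) /=.
  rewrite tri_dl; apply: eq_bigr => i _.
  rewrite mevalM mevalXU row_mxEl dyx_eval ffunE; congr (_ * _).
  rewrite tri_dr; apply: eq_bigr => a _.
  by rewrite tri_basis ffunE.
- transitivity ((f^`M(lx i) *+ 2).@[row_mx x y 0]); last first.
    by rewrite mevalMn sf mul0rn.
  rewrite (euler_y (bihomog_dx i f12)) (raddf_sum (meval _)) /=.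
  rewrite tri_dm; apply: eq_bigr => a _.
  rewrite mevalM mevalXU row_mxEr mderiv_comm dyx_eval ffunE; congr (_ * _).
  rewrite tri_dr; apply: eq_bigr => b _.
  by rewrite tri_basis ffunE.
Qed.

Lemma form_tensor_eq0 : form_tensor f = 0 -> f = 0.
Proof.
move=> T0; have h i a : f^`M(ry a)^`M(lx i) = 0.
  rewrite -[LHS]mulr1n (euler_y (bihomog_dx i (bihomog_dy a f12))) big1 // => b _.
  by rewrite form_tensorE T0 ffunE mpolyC0 mulr0.
have h2 a : f^`M(ry a) = 0.
  rewrite -[LHS]mulr1n (euler_x (bihomog_dy a f12)) big1 // => i _.
  by rewrite h mulr0.
have : f *+ 2 = 0 by rewrite (euler_y f12) big1 // => a _; rewrite h2 mulr0.
move/mpolyP => f20; apply/mpolyP => a; have := f20 a.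
by rewrite mcoeffMn mcoeff0 => /eqP; rewrite mulrn_eq0 => /eqP.
Qed.

End Forms.

Section Configuration.
Variables (K : numFieldType) (m n : nat).

Definition line_of k (x : 'rV[K]_k.+1) (x0 : x != 0) : proj K k.
Proof. by exists <[x]>%VS; rewrite dim_vline x0. Defined.

(* Replacing a zero vector by a nonzero one only strengthens the conditions. *)
Lemma rigid_sing_forms0 s (x : 'I_s -> 'rV[K]_m.+1) (y : 'I_s -> 'rV[K]_n.+1) :
  rigid (fun k => [ffun i => x k 0 i] : {ffun _ -> K^o})
        (fun k => [ffun a => y k 0 a] : {ffun _ -> K^o}) ->
  exists P : 'I_s -> biproj K m n, \dim (sing_forms P) = 0%N.
Proof.
move=> rxy.
have c0 k : (const_mx 1 : 'rV[K]_k.+1) != 0.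
  by apply/eqP => /rowP /(_ 0); rewrite !mxE => /eqP; rewrite oner_eq0.
pose nz k (v : 'rV[K]_k.+1) := if v == 0 then const_mx 1 else v.
have nz0 k v : @nz k v != 0 by rewrite /nz; case: ifP => [_|/negbT //]; exact: c0.
pose P k : biproj K m n := (line_of (nz0 m (x k)), line_of (nz0 n (y k))).
exists P; apply/eqP; rewrite dimv_eq0; apply/eqP/vspaceP => f; rewrite memv0.
apply/idP/eqP => [|->]; last exact: mem0v.
move/mem_sing_forms => [bf sf].
apply/val_inj/(form_tensor_eq0 bf)/rxy => [|k]; first exact: form_tensor_sym.
have /singular_vec_tensor : singular_vec (form3_poly f) (row_mx (nz _ (x k)) (nz _ (y k))).
  by apply/(singular_atP (P := P k) bf _ _ _ _); rewrite ?nz0 ?memv_line //; apply: sf.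
move/(_ bf); rewrite /nz.
have z0 k' : [ffun i => (0 : 'rV[K]_k'.+1) 0 i] = 0 :> {ffun _ -> K^o}.
  by apply/ffunP => i; rewrite !ffunE mxE.
case: (eqVneq (y k) 0) => [->|_].
  by move=> _; rewrite z0; split=> z; rewrite (tri0m, tri0r).
case: (eqVneq (x k) 0) => [->|_] // [_ H].
by rewrite z0; split=> // z; rewrite tri0l.
Qed.

Lemma rigid_config (I J S : finType) (x : S -> {ffun I -> K^o})
    (y : S -> {ffun J -> K^o}) :
  #|I| = m.+1 -> #|J| = n.+1 -> rigid x y ->
  exists P : 'I_#|S| -> biproj K m n, \dim (sing_forms P) = 0%N.
Proof.
move=> cI cJ rxy.
have bi (k : nat) (I' : finType) (c : #|I'| = k) :
    bijective (fun i : 'I_k => enum_val (cast_ord (esym c) i) : I').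
  exists (fun i => cast_ord c (enum_rank i)) => i.
    by rewrite enum_valK cast_ordKV.
  by rewrite cast_ordK enum_rankK.
have := rigid_bij (bi _ _ cI) (bi _ _ cJ) rxy.
set x' := fun s => _; set y' := fun s => _ => rxy'.
apply: (rigid_sing_forms0 (x := fun k => \row_i x' (enum_val k) i)
                          (y := fun k => \row_i y' (enum_val k) i)).
move=> T sT HT; apply: (rxy' T sT) => s.
have := HT (enum_rank s); congr singT; apply/ffunP => i;
  by rewrite ffunE mxE enum_rankK.
Qed.

End Configuration.

(** * Linear systems depending polynomially on a parameter *)

Section PolynomialFamilies.
Variable K : numFieldType.

Definition polyfun (f : K -> K) := exists p : {poly K}, forall t, f t = p.[t].

Lemma polyfun_cst c : polyfun (fun=> c).
Proof. by exists c%:P => t; rewrite hornerC. Qed.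

Lemma polyfun_id : polyfun id.
Proof. by exists 'X => t; rewrite hornerX. Qed.

Lemma polyfunD f g : polyfun f -> polyfun g -> polyfun (fun t => f t + g t).
Proof. by move=> [p Hp] [q Hq]; exists (p + q) => t; rewrite hornerD Hp Hq. Qed.

Lemma polyfunN f : polyfun f -> polyfun (fun t => - f t).
Proof. by move=> [p Hp]; exists (- p) => t; rewrite hornerN Hp. Qed.

Lemma polyfunM f g : polyfun f -> polyfun g -> polyfun (fun t => f t * g t).
Proof. by move=> [p Hp] [q Hq]; exists (p * q) => t; rewrite hornerM Hp Hq. Qed.

Section Families.
Variable Q : finType.
Local Notation W := {ffun Q -> K^o}.

Definition polylin (L : K -> W -> K) :=
  exists C : Q -> {poly K}, forall t w, L t w = \sum_q w q * (C q).[t].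

Lemma polylinD L L' : polylin L -> polylin L' -> polylin (fun t w => L t w + L' t w).
Proof.
move=> [C HC] [C' HC']; exists (fun q => C q + C' q) => t w.
by rewrite HC HC' -big_split; apply: eq_bigr => q _; rewrite hornerD mulrDr.
Qed.

Lemma polylinM f L : polyfun f -> polylin L -> polylin (fun t w => f t * L t w).
Proof.
move=> [p Hp] [C HC]; exists (fun q => p * C q) => t w.
by rewrite HC Hp mulr_sumr; apply: eq_bigr => q _; rewrite hornerM mulrCA.
Qed.

Lemma polylinN L : polylin L -> polylin (fun t w => - L t w).
Proof.
move=> [C HC]; exists (fun q => - C q) => t w.
by rewrite HC -sumrN; apply: eq_bigr => q _; rewrite hornerN mulrN.
Qed.

Lemma polylin_sum (I : finType) (L : I -> K -> W -> K) :
  (forall i, polylin (L i)) -> polylin (fun t w => \sum_i L i t w).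
Proof.
move=> /fin_all_exists[C HC]; exists (fun q => \sum_i C i q) => t w.
under eq_bigr do rewrite HC; rewrite exchange_big; apply: eq_bigr => q _ /=.
by rewrite horner_sum mulr_sumr.
Qed.

Lemma polylin_coord q : polylin (fun=> fun w => w q).
Proof.
exists (fun q' => (q' == q)%:R%:P) => t w; rewrite (bigD1 q) //= big1 => [|j ne].
  by rewrite hornerC eqxx mulr1 addr0.
by rewrite hornerC (negPf ne) mulr0.
Qed.

Definition algfam (Z : K -> W -> Prop) :=
  exists (S : finType) (L : S -> K -> W -> K), (forall s, polylin (L s)) /\
    forall t w, Z t w <-> forall s, L s t w = 0.

Lemma algfam_eq0 L : polylin L -> algfam (fun t w => L t w = 0).
Proof.
by move=> HL; exists unit, (fun=> L); split=> // t w; split=> // /(_ tt).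
Qed.

Lemma algfam_and Z Z' : algfam Z -> algfam Z' -> algfam (fun t w => Z t w /\ Z' t w).
Proof.
move=> [S [L [HL HZ]]] [S' [L' [HL' HZ']]].
exists (S + S')%type, (fun s => match s with inl s => L s | inr s => L' s end).
split=> [[]//|t w]; split=> [[/HZ H /HZ' H'] []//|H].
by split; [apply/HZ => s; exact: (H (inl s))|apply/HZ' => s; exact: (H (inr s))].
Qed.

Lemma algfam_all (I : finType) (Z : I -> K -> W -> Prop) :
  (forall i, algfam (Z i)) -> algfam (fun t w => forall i, Z i t w).
Proof.
move=> /fin_all_exists[S /fin_all_exists[L HL]].
exists {i : I & S i}, (fun s => L (tag s) (tagged s)); split.
  by move=> [i s]; have [] := HL i.
move=> t w; split=> [H [i s]|H i]; have [_ HZ] := HL i.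
  by have /HZ := H i; apply.
by apply/HZ => s; exact: (H (Tagged S s)).
Qed.

(* A left inverse of the matrix of conditions at [t0] has polynomial, hence
   generically nonzero, determinant against the matrix at [t]. *)
Lemma open_kernel Z t0 : algfam Z -> (forall w, Z t0 w -> w = 0) ->
  exists d : {poly K}, d.[t0] != 0 /\
    forall t, d.[t] != 0 -> forall w, Z t w -> w = 0.
Proof.
move=> [S [L [/fin_all_exists[C HC] HZ]]] H0.
pose M := \matrix_(q < #|Q|, s < #|S|) C (enum_val s) (enum_val q).
pose Mt t := map_mx (horner_eval t) M.
have ME t (v : 'rV[K]_#|Q|) s : (v *m Mt t) 0 s =
    L (enum_val s) t [ffun q => v 0 (enum_rank q)].
  rewrite mxE HC (reindex (@enum_rank Q)) /=; last first.
    by apply: onW_bij; exact: enum_rank_bij.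
  by apply: eq_bigr => q _; rewrite !mxE ffunE enum_rankK.
have rf : row_free (Mt t0).
  rewrite -kermx_eq0; apply/eqP/row_matrixP => r; rewrite row0.
  set v := row r _; have v0 : v *m Mt t0 = 0 by apply/sub_kermxP; apply: row_sub.
  have : [ffun q => v 0 (enum_rank q)] = 0 :> W.
    by apply: H0; apply/HZ => s; rewrite -(enum_rankK s) -ME v0 mxE.
  move/ffunP => H; apply/rowP => i; have := H (enum_val i).
  by rewrite !ffunE enum_valK => ->; rewrite mxE.
have /row_freeP[B MB] := rf.
exists (\det (M *m map_mx polyC B)).
have dE t : (\det (M *m map_mx polyC B)).[t] = \det (Mt t *m B).
  rewrite -[LHS]/(horner_eval t _) -det_map_mx map_mxM -map_mx_comp.
  by congr (\det (_ *m _)); apply/matrixP => i j; rewrite mxE /= /horner_eval hornerC.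
split=> [|t]; first by rewrite dE MB det1 oner_neq0.
rewrite dE -unitfE -unitmxE => U w /HZ Hw.
pose v : 'rV[K]_#|Q| := \row_i w (enum_val i).
have wE : [ffun q => v 0 (enum_rank q)] = w.
  by apply/ffunP => q; rewrite ffunE mxE enum_rankK.
have v0 : v *m Mt t = 0 by apply/rowP => s; rewrite ME wE Hw mxE.
have v00 : v = 0.
  by rewrite -[v](mulmxK U) mulmxA v0 !mul0mx.
by rewrite -wE v00; apply/ffunP => q; rewrite !ffunE mxE.
Qed.

End Families.

Lemma polylin_tri (I J : finType) (x : K -> {ffun I -> K^o})
    (y z : K -> {ffun J -> K^o}) :
  (forall i, polyfun (fun t => x t i)) -> (forall a, polyfun (fun t => y t a)) ->
  (forall a, polyfun (fun t => z t a)) ->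
  polylin (fun t T => tri T (x t) (y t) (z t)).
Proof.
move=> /fin_all_exists[p Hp] /fin_all_exists[q Hq] /fin_all_exists[r Hr].
exists (fun u => p u.1.1 * q u.1.2 * r u.2) => t T.
by apply: eq_bigr => u _; rewrite Hp Hq Hr !hornerM.
Qed.

Lemma algfam_sym (I J : finType) :
  algfam (fun (_ : K) (T : {ffun I * J * J -> K^o}) => symT T).
Proof.
have H : algfam (fun (_ : K) (T : {ffun I * J * J -> K^o}) =>
    forall u : I * J * J, T (u.1.1, u.1.2, u.2) - T (u.1.1, u.2, u.1.2) = 0).
  apply: algfam_all => u; apply: algfam_eq0; apply: polylinD.
    exact: polylin_coord.
  by apply: polylinN; exact: polylin_coord.
move: H => [S [L [HL HZ]]]; exists S, L; split=> // t T; rewrite -HZ.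
split=> [sT [[i a] b]|H i a b] /=; first by rewrite sT subrr.
by apply/eqP; rewrite -subr_eq0; apply/eqP; exact: (H (i, a, b)).
Qed.

(** [singT] quantifies over all vectors; tested on coordinate vectors it becomes a finite system. *)
Lemma algfam_sing (I J : finType) (x : K -> {ffun I -> K^o})
    (y : K -> {ffun J -> K^o}) :
  (forall i, polyfun (fun t => x t i)) -> (forall a, polyfun (fun t => y t a)) ->
  algfam (fun t (T : {ffun I * J * J -> K^o}) => singT T (x t) (y t)).
Proof.
move=> Hx Hy.
have cst (A : finType) (a b : A) : polyfun (fun=> ([ffun a' => (a' == b)%:R] : {ffun A -> K^o}) a).
  exact: polyfun_cst.
have H : algfam (fun t (T : {ffun I * J * J -> K^o}) =>
    (forall b, tri T (x t) (y t) (dr K b) = 0) /\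
    (forall i, tri T (dl K i) (y t) (y t) = 0)).
  apply: algfam_and; apply: algfam_all => b; apply: algfam_eq0; apply: polylin_tri => // a;
    exact: polyfun_cst.
move: H => [S [L [HL HZ]]]; exists S, L; split=> // t T; rewrite -HZ.
split=> [[H1 H2]|[H1 H2]]; first by [].
split=> [z|x'].
  by rewrite tri_dr big1 // => b _; rewrite H1 mulr0.
by rewrite tri_dl big1 // => b _; rewrite H2 mulr0.
Qed.

(** A positive integer is wanted because the interpolated weights of [star_config] are shown to be
    nonzero by positivity. *)
Lemma natural_nonroot (d : {poly K}) : d != 0 -> exists N : nat, d.[N.+1%:R] != 0.
Proof.
move=> d0; pose rs : seq K := [seq i.+1%:R | i <- iota 0 (size d)].
have [/(max_poly_roots d0)|/allPn[x]] := boolP (all (root d) rs).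
  rewrite /rs size_map size_iota ltnn => H; suff : false by [].
  by apply: H; rewrite map_inj_uniq ?iota_uniq // => i j /eqP; rewrite eqr_nat eqSS => /eqP.
by case/mapP => i _ ->; rewrite rootE => H; exists i.
Qed.

End PolynomialFamilies.

(** * Points attached to a plane *)

Section Star.
Variables (K : numFieldType) (I : finType) (r k : nat).
Local Notation J := ('I_r + 'I_k * bool)%type.
Local Notation X := {ffun I -> K^o}.
Local Notation V0 := {ffun 'I_r -> K^o}.
Local Notation V := {ffun J -> K^o}.
Local Notation tensor := {ffun I * J * J -> K^o}.
Implicit Types T : tensor.

Definition emb (p : V0) : V := [ffun a => if a is inl a' then p a' else 0].
Definition uv (j : 'I_k) (s : bool) : V := dr K (inr (j, s)).
Definition restr T : {ffun I * 'I_r * 'I_r -> K^o} :=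
  [ffun q => T (q.1.1, inl q.1.2, inl q.2)].

Lemma embD p q : emb (p + q) = emb p + emb q.
Proof. by apply/ffunP => -[a|a]; rewrite !ffunE ?addr0. Qed.

Lemma embZ c p : emb (c *: p) = c *: emb p.
Proof. by apply/ffunP => -[a|a]; rewrite !ffunE ?scaler0. Qed.

Lemma emb0 : emb 0 = 0.
Proof. by apply/ffunP => -[a|a]; rewrite !ffunE. Qed.

Lemma emb_sum (R : Type) (s : seq R) (P : pred R) F :
  emb (\sum_(i <- s | P i) F i) = \sum_(i <- s | P i) emb (F i).
Proof. by apply: (big_morph emb) => [p q|]; rewrite ?embD ?emb0. Qed.

Lemma emb_dr a : emb (dr K a) = dr K (inl a).
Proof. by apply/ffunP => -[b|b]; rewrite !ffunE. Qed.

Lemma tri_restr T x p q : tri (restr T) x p q = tri T x (emb p) (emb q).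
Proof.
rewrite [p in RHS]dr_sum [q in RHS]dr_sum !emb_sum tri_summ tri_dm.
apply: eq_bigr => a _; rewrite embZ triZm; congr (_ * _).
rewrite tri_sumr tri_dr; apply: eq_bigr => b _; rewrite embZ triZr; congr (_ * _).
rewrite [LHS]tri_dl [RHS]tri_dl; apply: eq_bigr => i _; congr (_ * _).
by rewrite !emb_dr !tri_basis ffunE.
Qed.

Lemma symT_restr T : symT T -> symT (restr T).
Proof. by move=> sT i a b; rewrite !ffunE. Qed.

Lemma singT_restr T x p : singT T x (emb p) -> singT (restr T) x p.
Proof. by move=> [H1 H2]; split=> z; rewrite tri_restr. Qed.

(** With the signs chosen, c b equals the point plus w u0 + w' u1. For c = 0, the weights (-1, 0)
    and (0, -1) give u0 and u1 themselves. *)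
Definition pt j (c w w' : K) (b : V0) : V :=
  c *: emb b + (- w) *: uv j false + (- w') *: uv j true.

Section Alpha.
Variables (T : tensor) (j : 'I_k) (e : I -> X) (w w' : I -> K) (b : I -> V0).
Variables (o0 o1 : I).
Hypotheses (sT : symT T)
  (b0 : b o0 = 0) (b1 : b o1 = 0)
  (w0 : w o0 = -1) (w0' : w' o0 = 0) (w1 : w o1 = 0) (w1' : w' o1 = -1)
  (wn : forall i, i != o0 -> i != o1 -> w i != 0)
  (wn' : forall i, i != o0 -> i != o1 -> w' i != 0)
  (sP : singT T (e o0 + e o1) (emb (\sum_i b i)))
  (sy : forall i, singT T (e i) (pt j (w i * w' i) (w i) (w' i) (b i))).

Lemma alpha_u0 : singT T (e o0) (uv j false).
Proof.
by move: (sy o0); rewrite /pt w0 w0' mulr0 oppr0 opprK !scale0r addr0 scale1r add0r.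
Qed.

Lemma alpha_u1 : singT T (e o1) (uv j true).
Proof.
by move: (sy o1); rewrite /pt w1 w1' mul0r oppr0 opprK !scale0r !add0r scale1r.
Qed.

(* Being singular at the point of index [i] makes [w i * T(e o0; b i, b i)] equal to
   [2 T(e o0; b i, u1)], and the [b i] add up to the point of [V0] given by [sP]. *)
Lemma alpha0 : \sum_i w i * tri T (e o0) (emb (b i)) (emb (b i)) = 0.
Proof.
have [h0 h00] := alpha_u0; have [h1 h11] := alpha_u1.
have E i : w i * tri T (e o0) (emb (b i)) (emb (b i)) =
    2 * tri T (e o0) (emb (b i)) (uv j true).
  have [->|n0] := eqVneq i o0; first by rewrite b0 emb0 !tri0m !mulr0.
  have [->|n1] := eqVneq i o1; first by rewrite b1 emb0 !tri0m !mulr0.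
  have [_ /(_ (e o0))] := sy i.
  rewrite /pt tri_quad3 // (triC (e o0) (emb (b i)) (uv j false) sT) !h0 h11.
  have := wn n0 n1; have := wn' n0 n1; set a := tri _ _ _ _; set d := tri _ _ _ _.
  move=> wi' wi H; apply: (mulfI (mulf_neq0 wi (mulf_neq0 wi' wi'))).
  by apply/eqP; rewrite -subr_eq0 -H; apply/eqP; ring.
under eq_bigr do rewrite E.
rewrite -mulr_sumr -tri_summ -emb_sum.
have [/(_ (uv j true))] := sP; rewrite triDl => H _.
by move: H; rewrite (triC (e o1) _ (uv j true) sT) h1 addr0 => ->; rewrite mulr0.
Qed.

(** Same elimination with u0 and u1 exchanged. The coefficient [w i * w' i] of b_i makes both
    eliminations work: the unknown is a multiple of the quadratic value by [w i] in one, by [w' i]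
    in the other, and depends linearly on b_i. *)
Lemma alpha1 : \sum_i w' i * tri T (e o1) (emb (b i)) (emb (b i)) = 0.
Proof.
have [h0 h00] := alpha_u0; have [h1 h11] := alpha_u1.
have E i : w' i * tri T (e o1) (emb (b i)) (emb (b i)) =
    2 * tri T (e o1) (emb (b i)) (uv j false).
  have [->|n0] := eqVneq i o0; first by rewrite b0 emb0 !tri0m !mulr0.
  have [->|n1] := eqVneq i o1; first by rewrite b1 emb0 !tri0m !mulr0.
  have [_ /(_ (e o1))] := sy i.
  rewrite /pt tri_quad3 // (triC (e o1) (emb (b i)) (uv j true) sT).
  rewrite (triC (e o1) (uv j false) (uv j true) sT) !h1 h00.
  have := wn n0 n1; have := wn' n0 n1; set a := tri _ _ _ _; set d := tri _ _ _ _.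
  move=> wi' wi H; apply: (mulfI (mulf_neq0 wi' (mulf_neq0 wi wi))).
  by apply/eqP; rewrite -subr_eq0 -H; apply/eqP; ring.
under eq_bigr do rewrite E.
rewrite -mulr_sumr -tri_summ -emb_sum.
have [/(_ (uv j false))] := sP; rewrite triDl => H _.
by move: H; rewrite (triC (e o0) _ (uv j false) sT) h0 add0r => ->; rewrite mulr0.
Qed.

End Alpha.
End Star.

(** * Tensors vanishing on V0 *)

Section Residual.
Variables (K : numFieldType) (I : finType) (r k : nat).
Local Notation J := ('I_r + 'I_k * bool)%type.
Local Notation X := {ffun I -> K^o}.
Local Notation V0 := {ffun 'I_r -> K^o}.
Variable T : {ffun I * J * J -> K^o}.
Hypotheses (sT : symT T) (rT : restr T = 0).

Lemma tri_emb0 x (p q : V0) : tri T x (emb k p) (emb k q) = 0.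
Proof. by rewrite -tri_restr rT; apply: big1 => s _; rewrite ffunE mul0r. Qed.

Section Local.
Variables (j : 'I_k) (e : I -> X) (c w w' : I -> K) (b : I -> V0).
Variables (o0 o1 : I).
Local Notation y i := (pt j (c i) (w i) (w' i) (b i)).
Local Notation u0 := (uv K r j false).
Local Notation u1 := (uv K r j true).
Hypotheses (c0 : c o0 = 0) (c1 : c o1 = 0)
  (w0 : w o0 = -1) (w0' : w' o0 = 0) (w1 : w o1 = 0) (w1' : w' o1 = -1)
  (det_neq0 : forall i i', i != i' -> w i * w' i' - w i' * w' i != 0)
  (sy : forall i, singT T (e i) (y i)).

(* A suitable combination of [y i], [y i'], [y l] lies in [V0], and the form
   attached to [e l] has [y l] in its kernel and [y i], [y i'] isotropic. *)
Lemma local_yy l i i' : tri T (e l) (y i) (y i') = 0.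
Proof.
have [h1 _] := sy l.
have [->|li] := eqVneq i l; first exact: h1.
have [->|li'] := eqVneq i' l; first by rewrite triC.
have [->|ii'] := eqVneq i i'; first by have [_ ->] := sy i'.
pose a := w i' * w' l - w l * w' i'; pose a' := w l * w' i - w i * w' l.
pose d := w i * w' i' - w i' * w' i.
pose p := a * c i *: b i + a' * c i' *: b i' + d * c l *: b l.
have Ep : emb k p = a *: y i + a' *: y i' + d *: y l.
  rewrite /p !embD !embZ /pt; apply/ffunP => q.
  by rewrite !ffunE /GRing.scale /= /a /a' /d; ring.
have := tri_emb0 (e l) p p; rewrite Ep tri_quad3 //.
have [_ ->] := sy i; have [_ ->] := sy i'.
rewrite (triC (e l) (y i) (y l) sT) (triC (e l) (y i') (y l) sT) !h1 => H.
have nz : 2 * (a * a') != 0.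
  by rewrite !mulf_neq0 ?pnatr_eq0 // /a /a' det_neq0 // eq_sym.
by apply: (mulfI nz); rewrite mulr0 -H; ring.
Qed.

Lemma y_o0 : y o0 = u0.
Proof. by rewrite /pt c0 w0 w0' oppr0 opprK !scale0r addr0 scale1r add0r. Qed.

Lemma y_o1 : y o1 = u1.
Proof. by rewrite /pt c1 w1 w1' oppr0 opprK !scale0r !add0r scale1r. Qed.

Lemma local_uu l s s' : tri T (e l) (uv K r j s) (uv K r j s') = 0.
Proof. by case: s; case: s'; rewrite -?y_o0 -?y_o1 local_yy. Qed.

(** Up to a nonzero factor, b_i is a combination of [y i], u0 and u1, and these last two are the
    points of index [o0] and [o1]: [local_yy] applies to all. *)
Lemma local_bu l i s : c i != 0 -> tri T (e l) (emb k (b i)) (uv K r j s) = 0.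
Proof.
move=> ci; apply: (mulfI ci); rewrite mulr0 -triZm.
have -> : c i *: emb k (b i) = 1 *: y i + w' i *: u1 + w i *: u0.
  by rewrite scale1r /pt !scaleNr !subrK.
rewrite tri_comb3m !local_uu !mulr0 !addr0 mul1r.
by case: s; rewrite -?y_o0 -?y_o1 local_yy.
Qed.

(** The form T([e l]; v, -) vanishes at [y l], which is in the kernel of the form attached to [e l],
    and at [y l'], because x' has v in its kernel and [e l'] has [y l']. Modulo V0 these two points
    span the plane. *)
Lemma local_preset l l' (x' : X) (v : V0) a a' s : l != l' -> a != 0 ->
  x' = a *: e l + a' *: e l' -> singT T x' (emb k v) ->
  tri T (e l) (emb k v) (uv K r j s) = 0.
Proof.
move=> ll' a0 -> [sx _].
have H z : tri T (e l) (emb k v) (y z) = 0 ->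
    w z * tri T (e l) (emb k v) u0 + w' z * tri T (e l) (emb k v) u1 = 0.
  by rewrite /pt tri_comb3r tri_emb0 mulr0 add0r !mulNr -opprD => /eqP; rewrite oppr_eq0 => /eqP.
have /H H1 : tri T (e l) (emb k v) (y l) = 0.
  by rewrite (triC (e l) _ (y l) sT); have [->] := sy l.
have /H H2 : tri T (e l) (emb k v) (y l') = 0.
  have := sx (y l'); rewrite triDl !triZl.
  rewrite (triC (e l') _ (y l') sT); have [-> _] := sy l'; rewrite mulr0 addr0 => /eqP.
  by rewrite mulf_eq0 (negPf a0) => /eqP.
move: H1 H2; set f0 := tri _ _ _ u0; set f1 := tri _ _ _ u1 => H1 H2.
have D := det_neq0 ll'; case: s; apply: (mulfI D); rewrite mulr0.
  transitivity (w l * (w l' * f0 + w' l' * f1) - w l' * (w l * f0 + w' l * f1)).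
    by rewrite /f1; ring.
  by rewrite H1 H2 !mulr0 subr0.
transitivity (w' l' * (w l * f0 + w' l * f1) - w' l * (w l' * f0 + w' l' * f1)).
  by rewrite /f0; ring.
by rewrite H1 H2 !mulr0 subr0.
Qed.

End Local.

Variable G : finType.
Variables (px : G -> X) (pv : G -> V0).
Variables (e : 'I_k -> I -> X) (c w w' : 'I_k -> I -> K) (b : 'I_k -> I -> V0).
Variables (o0 o1 : I).
Hypotheses (c0 : forall j, c j o0 = 0) (c1 : forall j, c j o1 = 0)
  (w0 : forall j, w j o0 = -1) (w0' : forall j, w' j o0 = 0)
  (w1 : forall j, w j o1 = 0) (w1' : forall j, w' j o1 = -1)
  (det_neq0 : forall j i i', i != i' -> w j i * w' j i' - w j i' * w' j i != 0)
  (sp : forall g, singT T (px g) (emb k (pv g)))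
  (sy : forall j i, singT T (e j i) (pt j (c j i) (w j i) (w' j i) (b j i))).
Hypothesis e_basis : forall j (g : I -> K),
  (forall l, \sum_i g i * e j l i = 0) -> forall i, g i = 0.
(** The vectors v for which [local_bu] or [local_preset] gives T([e j l]; v, u) = 0, with u in the
    plane j, span V0. *)
Hypothesis b_span : forall j l (f : 'I_r -> K),
  (forall i, c j i != 0 -> \sum_a f a * b j i a = 0) ->
  (forall g l' a a', l != l' -> a != 0 -> px g = a *: e j l + a' *: e j l' ->
     \sum_a f a * pv g a = 0) ->
  forall a, f a = 0.
(** D stands for the values T(x; u, u') with u in the plane j and u' in the plane j'; the premises
    are what the points of the two planes say about them. *)
Hypothesis cross : forall j j', j != j' -> forall D : I -> bool -> bool -> K,
  (forall i s, \sum_x e j i x * (w j i * D x false s + w' j i * D x true s) = 0) ->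
  (forall i s, \sum_x e j' i x * (w j' i * D x s false + w' j' i * D x s true) = 0) ->
  forall x s s', D x s s' = 0.

Lemma e_basis_tri j y z : (forall l, tri T (e j l) y z = 0) -> forall x, tri T x y z = 0.
Proof.
move=> H x; rewrite tri_dl big1 // => i _.
rewrite (e_basis (j := j) (g := fun i => tri T (dl K i) y z)) ?mulr0 // => l.
by rewrite -[RHS](H l) [RHS]tri_dl; apply: eq_bigr => i' _; rewrite mulrC.
Qed.

Lemma residual_uu j x s s' : tri T x (uv K r j s) (uv K r j s') = 0.
Proof.
apply: (@e_basis_tri j) => l.
exact: (local_uu (c0 j) (c1 j) (w0 j) (w0' j) (w1 j) (w1' j) (det_neq0 j) (sy j)).
Qed.

Lemma residual_bu j x p s : tri T x (emb k p) (uv K r j s) = 0.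
Proof.
apply: (@e_basis_tri j) => l.
pose f a := tri T (e j l) (emb k (dr K a)) (uv K r j s).
have E q : tri T (e j l) (emb k q) (uv K r j s) = \sum_a f a * q a.
  rewrite [q in LHS]dr_sum emb_sum tri_summ; apply: eq_bigr => a _.
  by rewrite embZ triZm mulrC.
rewrite E big1 // => a _; rewrite (b_span (j := j) (l := l)) ?mul0r //.
- move=> i ci; rewrite -E.
  exact: (local_bu (c0 j) (c1 j) (w0 j) (w0' j) (w1 j) (w1' j) (det_neq0 j) (sy j)).
- move=> g l' d d' ll' d0 Eg; rewrite -E.
  exact: (local_preset (det_neq0 j) (sy j) s ll' d0 Eg (sp g)).
Qed.

(** In T([e j l]; y, u') = 0 with u' in the plane j', the component of y in V0 contributes nothing
    by [residual_bu]. What is left is a premise of [cross]. *)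
Lemma residual_cross j j' x s s' : j != j' -> tri T x (uv K r j s) (uv K r j' s') = 0.
Proof.
move=> jj'; rewrite tri_dl big1 // => i _.
rewrite (cross jj' (D := fun x s s' => tri T (dl K x) (uv K r j s) (uv K r j' s'))) ?mulr0 //.
- move=> l t; have [/(_ (uv K r j' t)) H _] := sy j l.
  rewrite /pt tri_comb3m residual_bu mulr0 add0r !mulNr -opprD in H.
  move/eqP: H; rewrite oppr_eq0 => /eqP H; rewrite -[RHS]H.
  rewrite [tri T _ _ _]tri_dl [tri T _ (uv K r j true) _]tri_dl !mulr_sumr -big_split.
  by apply: eq_bigr => x' _ /=; ring.
- move=> l t; have [/(_ (uv K r j t)) H _] := sy j' l.
  rewrite /pt tri_comb3m residual_bu mulr0 add0r !mulNr -opprD in H.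
  move/eqP: H; rewrite oppr_eq0 => /eqP H; rewrite -[RHS]H.
  rewrite (triC (e j' l) (uv K r j' false) _ sT) (triC (e j' l) (uv K r j' true) _ sT).
  rewrite [tri T _ _ (uv K r j' false)]tri_dl [tri T _ _ (uv K r j' true)]tri_dl
    !mulr_sumr -big_split.
  by apply: eq_bigr => x' _ /=; ring.
Qed.

Lemma residual_eq0 : T = 0.
Proof.
apply: tensor_eq0 => i [a|[j s]] [a'|[j' s']].
- by rewrite -!emb_dr tri_emb0.
- by rewrite -emb_dr residual_bu.
- by rewrite triC // -emb_dr residual_bu.
- by have [->|jj'] := eqVneq j j'; [rewrite residual_uu|rewrite residual_cross].
Qed.

End Residual.

(** * Gluing the two specializations *)

Section Combine.
Variables (K : numFieldType) (I : finType) (r k : nat) (G : finType).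
Local Notation J := ('I_r + 'I_k * bool)%type.
Local Notation X := {ffun I -> K^o}.
Local Notation V0 := {ffun 'I_r -> K^o}.
Variables (px : G -> X) (pv : G -> V0).
Variables (e : K -> 'I_k -> I -> X) (c w w' : K -> 'I_k -> I -> K)
  (b : K -> 'I_k -> I -> V0).
Hypotheses (e_poly : forall j i x, polyfun (fun t => e t j i x))
  (c_poly : forall j i, polyfun (fun t => c t j i))
  (w_poly : forall j i, polyfun (fun t => w t j i))
  (w'_poly : forall j i, polyfun (fun t => w' t j i))
  (b_poly : forall j i a, polyfun (fun t => b t j i a)).

Definition star_sing t (T : {ffun I * J * J -> K^o}) :=
  (forall g, singT T (px g) (emb k (pv g))) /\
  (forall j i, singT T (e t j i) (pt j (c t j i) (w t j i) (w' t j i) (b t j i))).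

(** Conditions that the planes impose on the restriction to V0. Their derivation may divide by
    weights, so it is only required at positive integers; the conditions themselves still make sense
    at t = 0, where weights vanish. *)
Variable Z : K -> {ffun I * 'I_r * 'I_r -> K^o} -> Prop.
Hypotheses (Z_alg : algfam Z)
  (Z_restr : forall (N : nat) T, symT T -> star_sing N.+1%:R T -> Z N.+1%:R (restr T))
  (Z_at0 : forall A, symT A -> (forall g, singT A (px g) (pv g)) -> Z 0 A -> A = 0)
  (res_at1 : forall T, symT T -> restr T = 0 -> star_sing 1 T -> T = 0).

(* The condition [Z] is generic by its behaviour at [t = 0], where the points
   of the configuration degenerate, and the residual condition by that at [t = 1]. *)
Lemma combine : exists (x : G + 'I_k * I -> X) y, rigid x y (J := J).
Proof.
have Z1_alg : algfam (fun t A => (symT A /\ (forall g, singT A (px g) (pv g))) /\ Z t A).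
  apply: algfam_and => //; apply: algfam_and; first exact: algfam_sym.
  by apply: algfam_all => g; apply: algfam_sing => ?; exact: polyfun_cst.
have [d1 [d1n H1]] := open_kernel Z1_alg (fun A H => Z_at0 H.1.1 H.1.2 H.2).
have pt_poly j i a : polyfun (fun t => pt j (c t j i) (w t j i) (w' t j i) (b t j i) a).
  have [pc Hc] := c_poly j i; have [pw Hw] := w_poly j i; have [pw' Hw'] := w'_poly j i.
  case: a => a.
    have [pb Hb] := b_poly j i a; exists (pc * pb) => t.
    by rewrite /pt !ffunE /GRing.scale /= Hc Hb !mulr0 !addr0 hornerM.
  exists (- (pw * ((inr a == inr (j, false) :> J)%:R)%:P) -
         pw' * ((inr a == inr (j, true) :> J)%:R)%:P) => t.
  by rewrite /pt !ffunE /GRing.scale /= Hw Hw' mulr0 add0r !hornerE !mulNr.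
have Z2_alg : algfam (fun t T => (symT T /\ (forall q, restr T q = 0)) /\ star_sing t T).
  apply: algfam_and; apply: algfam_and.
  - exact: algfam_sym.
  - apply: algfam_all => q; apply: algfam_eq0.
    have [C HC] := @polylin_coord K (I * J * J)%type (q.1.1, inl q.1.2, inl q.2).
    by exists C => t T; rewrite ffunE -HC.
  - by apply: algfam_all => g; apply: algfam_sing => ?; exact: polyfun_cst.
  - by apply: algfam_all => j; apply: algfam_all => i; apply: algfam_sing.
have H2' (T : {ffun I * J * J -> K^o}) :
    (symT T /\ (forall q, restr T q = 0)) /\ star_sing 1 T -> T = 0.
  by move=> [[sT rT] sg]; apply: res_at1 => //; apply/ffunP => q; rewrite rT ffunE.
have [d2 [d2n H2]] := open_kernel Z2_alg H2'.
have d0 : d1 * d2 != 0.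
  by rewrite mulf_neq0 //; [apply: contraNneq d1n|apply: contraNneq d2n] => ->; rewrite horner0.
have [N] := natural_nonroot d0; rewrite hornerM mulf_eq0 negb_or => /andP[n1 n2].
exists (fun s => match s with inl g => px g | inr ji => e N.+1%:R ji.1 ji.2 end).
exists (fun s => match s with inl g => emb k (pv g) | inr (j, i) =>
  pt j (c N.+1%:R j i) (w N.+1%:R j i) (w' N.+1%:R j i) (b N.+1%:R j i) end).
move=> T sT HT; have sg : star_sing N.+1%:R T.
  by split=> [g|j i]; [exact: (HT (inl g))|exact: (HT (inr (j, i)))].
have r0 : restr T = 0.
  apply: (H1 _ n1); split; last exact: Z_restr.
  by split=> [|g]; [exact: symT_restr|apply: singT_restr; exact: sg.1].
by apply: (H2 _ n2); split=> //; split=> // q; rewrite r0 ffunE.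
Qed.

End Combine.

Lemma uphalf_even a : ~~ odd a -> uphalf a.+1 = (uphalf a).+1.
Proof. by move=> ea; rewrite /= uphalf_half (negPf ea). Qed.

Lemma uphalfD_even a b : ~~ odd a -> uphalf (a + b) = (uphalf b + uphalf a)%N.
Proof. by move=> ea; rewrite !uphalf_half oddD halfD (negPf ea) /= !add0n; lia. Qed.

Lemma uphalfS_odd a b : odd a -> uphalf (a + b).+1 = (uphalf b + uphalf a)%N.
Proof. by move=> oa; rewrite /= halfD !uphalf_half oa /=; lia. Qed.

(** * Conditions on the restriction to [V0] *)

Section Selection.
Variables (K : numFieldType) (I : finType) (r g : nat) (xi : 'I_g.+1 -> I) (im : I).
Local Notation X := {ffun I -> K^o}.
Local Notation V0 := {ffun 'I_r -> K^o}.
Local Notation tensor := {ffun I * 'I_r * 'I_r -> K^o}.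
Local Notation P := ('I_r * 'I_r)%type.
Hypotheses (gr : (g.+1 < r)%N) (xi_inj : injective xi)
  (im_xi : forall l, xi l != im).
Implicit Types (A : tensor) (F : {set I * P}).

Definition wd (l : 'I_g.+1) : 'I_r := widen_ord (ltnW gr) l.
Local Notation x0 := (xi ord0).

(** Values of a quadratic form at these vectors determine it: one vector gives a diagonal entry, a
    sum of two gives twice an off-diagonal entry plus two diagonal ones. *)
Definition pp (q : P) : V0 :=
  if q.1 == q.2 then dr K q.1 else dr K q.1 + dr K q.2.

(** Unordered pairs, without the diagonal ones of index at most g: there T(x; -, -) vanishes for
    every x, by singularity at the points of V0. *)
Definition valid_pair (q : P) := (q.1 <= q.2)%N && ~~ ((q.1 == q.2) && (q.1 <= g)%N).

(* Coordinates on the tensors singular at the points [(xi l, l)]. *)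
Definition free_set : {set I * P} :=
  [set u | valid_pair u.2 && [forall l : 'I_g.+1, (xi l == u.1) ==>
     (u.2.1 != l :> nat) && (u.2.2 != l :> nat)]].

Definition base_sing A := symT A /\ forall l, singT A (dl K (xi l)) (dr K (wd l)).

Definition ev A (u : I * P) := tri A (dl K u.1) (pp u.2) (pp u.2).

Lemma base_row0 A i : base_sing A -> (forall q, (i, q) \in free_set -> ev A (i, q) = 0) ->
  forall a b, A (i, a, b) = 0.
Proof.
move=> [sA bA] H.
have xiP l : xi l = i -> forall z, tri A (dl K i) (dr K (wd l)) z = 0.
  by move=> <-; have [] := bA l.
have D a : A (i, a, a) = 0.
  have [ag|ag] := leqP a g.
    rewrite -tri_basis; have -> : a = wd (inord a) by apply/val_inj; rewrite /= inordK.
    by have [_ ->] := bA (inord a).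
  have : (i, (a, a)) \in free_set.
    rewrite inE /valid_pair /= leqnn eqxx /= -ltnNge ag /=.
    apply/forallP => l; apply/implyP => _; rewrite andbb.
    by apply: contraTneq ag => ->; rewrite -leqNgt -ltnS.
  by move/H; rewrite /ev /pp /= eqxx tri_basis.
suff O (a b : 'I_r) : (a < b)%N -> A (i, a, b) = 0.
  move=> a b; have [ab|ba|/val_inj->] := ltngtP a b; [exact: O| |exact: D].
  by rewrite sA; apply: O.
move=> ab; have nab : a != b by apply: contraTneq ab => ->; rewrite ltnn.
have [/H|] := boolP ((i, (a, b)) \in free_set).
  rewrite /ev /pp /= (negPf nab) !triDm !triDr !tri_basis !D sA add0r addr0.
  by rewrite -mulr2n => /eqP; rewrite mulrn_eq0 => /eqP; rewrite sA.
rewrite inE /valid_pair /= (ltnW ab) (negPf nab) /=.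
case/forallPn => l; rewrite negb_imply => /andP[/eqP xl].
rewrite negb_and !negbK -tri_basis => /orP[/eqP E|/eqP E].
  have -> : a = wd l by apply/val_inj.
  by rewrite xiP.
rewrite triC //; have -> : b = wd l by apply/val_inj.
by rewrite xiP.
Qed.

Lemma base_eq0 A : base_sing A -> (forall u, u \in free_set -> ev A u = 0) -> A = 0.
Proof.
move=> bA H; apply/ffunP => -[[i a] b]; rewrite [RHS]ffunE.
by apply: (base_row0 bA) => q; apply: H.
Qed.

Definition supp_in F A := base_sing A /\ forall u, u \in free_set :\: F -> ev A u = 0.

Lemma supp_inD F u v A : supp_in F A -> ev A u = 0 -> ev A v = 0 ->
  supp_in (F :\: [set u; v]) A.
Proof.
move=> [bA H] Hu Hv; split=> // z.
rewrite !in_setD in_set2 negb_and negbK => /andP[/orP[]].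
  by move=> /orP[/eqP->|/eqP->].
by move=> zF zf; apply: H; rewrite in_setD zF.
Qed.

(* The two conditions attached to a plane [U_j] when [w] and [w'] are supported on
   a single index each besides [o0] and [o1]; here [t.1.1] is [e o0], and [e o1] is
   its complement to the first factor of the point [(xi ord0, ord0)]. *)
Definition killed (t : X * P * P) A :=
  tri A t.1.1 (pp t.1.2) (pp t.1.2) = 0 /\
  tri A (dl K x0 + (-1) *: t.1.1) (pp t.2) (pp t.2) = 0.

Definition good k F := exists s : seq (X * P * P),
  [/\ size s = k, forall t, t \in s -> valid_pair t.1.2 && valid_pair t.2
    & forall A, supp_in F A -> (forall t, t \in s -> killed t A) -> A = 0].

Lemma good0 : good 0 set0.
Proof.
exists [::]; split=> // A [bA H] _; apply: base_eq0 => // u.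
by rewrite -{1}[free_set]setD0; exact: H.
Qed.

Lemma good_step k F F' t : valid_pair t.1.2 -> valid_pair t.2 ->
  (forall A, supp_in F A -> killed t A -> supp_in F' A) -> good k F' -> good k.+1 F.
Proof.
move=> v1 v2 H [s [ss sv sk]]; exists (t :: s); split=> [|t'|A sA kA].
- by rewrite /= ss.
- by rewrite inE => /orP[/eqP->|/sv//]; rewrite v1.
- apply: sk => [|t' ts]; last by apply: kA; rewrite inE ts orbT.
  by apply: H => //; apply: kA; rewrite inE eqxx.
Qed.

Lemma free_valid u : u \in free_set -> valid_pair u.2.
Proof. by rewrite inE => /andP[]. Qed.

(** Once row [x0] is cleared, the second condition of [killed] is, up to sign, about the same vector
    [t.1.1] as the first, so that one plane can kill two coordinates of one row. *)
Definition rowless F := forall q, (x0, q) \notin F.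

Lemma rowless_tri F A p : rowless F -> supp_in F A -> tri A (dl K x0) p p = 0.
Proof.
move=> nF [bA H]; rewrite tri_dm big1 // => a _; rewrite tri_dr big1 ?mulr0 // => b _.
rewrite tri_basis (base_row0 bA) ?mulr0 // => q fq; apply: H.
by rewrite in_setD fq nF.
Qed.

Lemma good_same k F i q q' : F \subset free_set -> rowless F ->
  (i, q) \in F -> (i, q') \in F ->
  good k (F :\: [set (i, q); (i, q')]) -> good k.+1 F.
Proof.
move=> /subsetP sF nF iF iF'; apply: (@good_step _ _ _ (dl K i, q, q')).
- exact: free_valid (sF _ iF).
- exact: free_valid (sF _ iF').
move=> A sA [/= k1 k2]; apply: supp_inD => //.
move: k2; rewrite triDl triZl mulN1r (rowless_tri _ nF sA) add0r => /eqP.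
by rewrite oppr_eq0 => /eqP.
Qed.

(** The first factor [dl i + dl l] mixes the two rows; each condition keeps one wanted value since
    the other row is already zero at that pair. *)
Lemma good_cross k F i l q q' : F \subset free_set -> rowless F ->
  (i, q) \in F -> (l, q') \in F ->
  (i, q') \in free_set :\: F -> (l, q) \in free_set :\: F ->
  good k (F :\: [set (i, q); (l, q')]) -> good k.+1 F.
Proof.
move=> /subsetP sF nF iF lF iF' lF'.
apply: (@good_step _ _ _ (dl K i + dl K l, q, q')).
- exact: free_valid (sF _ iF).
- exact: free_valid (sF _ lF).
move=> A sA [/= k1 k2]; have [_ H] := sA.
move: k1 k2; rewrite !triDl triZl !triDl mulN1r (rowless_tri _ nF sA).
have := H _ iF'; have := H _ lF'; rewrite /ev /= => -> ->.
rewrite addr0 !add0r => k1 /eqP; rewrite oppr_eq0 => /eqP k2.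
exact: supp_inD.
Qed.

(** This serves to clear row [x0]: the first condition kills (i, q), and the second, being about the
    difference of the two rows, then kills (x0, q). *)
Lemma good_double k F i q : F \subset free_set -> (x0, q) \in F -> (i, q) \in F ->
  good k (F :\: [set (x0, q); (i, q)]) -> good k.+1 F.
Proof.
move=> /subsetP sF xF iF; apply: (@good_step _ _ _ (dl K i, q, q)) => /=.
- exact: free_valid (sF _ iF).
- exact: free_valid (sF _ iF).
move=> A sA [/= k1 k2]; apply: supp_inD => //.
by move: k2; rewrite triDl triZl k1 mulr0 addr0.
Qed.

Lemma rowlessD F R : rowless F -> rowless (F :\: R).
Proof. by move=> nF q; rewrite inE negb_and nF orbT. Qed.

Lemma good_row k F (R : {set I * P}) i : F \subset free_set -> rowless F -> R \subset F ->
  (forall u, u \in R -> u.1 = i) -> good k (F :\: R) -> good (k + uphalf #|R|) F.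
Proof.
move: {2}#|R| (leqnn #|R|) => N.
elim: N R F => [|N IH] R F RN sF nF RF Ri gF.
  by move: RN gF; rewrite leqn0 cards_eq0 => /eqP->; rewrite setD0 cards0 addn0.
have [R0|[u uR]] := set_0Vmem R.
  by rewrite R0 cards0 addn0; move: gF; rewrite R0 setD0.
have [v vR [cR RN']] : exists2 v, v \in R &
    uphalf #|R| = (uphalf #|R :\: [set u; v]|).+1 /\ (#|R :\: [set u; v]| <= N)%N.
  have cu := cardsD1 u R; rewrite uR add1n in cu.
  have [R1|[v vR]] := set_0Vmem (R :\ u).
    (* A single remaining coordinate is paired with itself, which wastes one condition. *)
    exists u => //; have -> : R :\: [set u; u] = set0.
      by rewrite -R1; apply/setP => z; rewrite !inE orbb.
    by rewrite cu R1 !cards0.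
  have cv := cardsD1 v (R :\ u); rewrite vR add1n in cv.
  have E : R :\: [set u; v] = R :\ u :\ v.
    by apply/setP => z; rewrite !inE negb_or; case: (z == u); rewrite ?andbF ?andbT.
  exists v; first by case/setD1P: vR.
  by rewrite E; rewrite cu cv in RN *; split=> //; apply: leq_trans (leqnSn _) RN.
have uE := Ri u uR; have vE := Ri v vR.
case: u uR uE cR RN' => [i' q] /= uR uE cR RN'; subst i'.
case: v vR vE cR RN' => [i' q'] /= vR vE cR RN'; subst i'.
rewrite cR addnS; apply: (good_same sF nF (subsetP RF _ uR) (subsetP RF _ vR)).
have HF : (F :\: [set (i, q); (i, q')]) :\: (R :\: [set (i, q); (i, q')]) = F :\: R.
  apply/setP => z; rewrite !inE; have [->|_] := eqVneq z (i, q); first by rewrite uR.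
  by have [->|_] := eqVneq z (i, q'); rewrite ?vR.
apply: IH => //.
- by apply: subset_trans sF; apply: subsetDl.
- exact: rowlessD.
- by apply: setSD.
- by move=> z /setDP[/Ri].
- by rewrite HF.
Qed.

Lemma good_doubles k F (S : {set P}) i : F \subset free_set -> i != x0 ->
  (forall q, q \in S -> ((x0, q) \in F) && ((i, q) \in F)) ->
  good k (F :\: setX [set x0; i] S) -> good (k + #|S|) F.
Proof.
move=> + ix; move: {2}#|S| (erefl #|S|) => N.
elim: N S F => [|N IH] S F SN sF SF gF.
  move/eqP: SN gF; rewrite cards_eq0 => /eqP->.
  by rewrite cards0 addn0; congr (good _ _); apply/setP => z; rewrite !inE andbF.
have [S0|[q qS]] := set_0Vmem S; first by rewrite S0 cards0 in SN.
have cq := cardsD1 q S; rewrite qS add1n SN in cq; case: cq => cq.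
rewrite SN addnS cq; have /andP[xF iF] := SF _ qS; apply: (good_double sF xF iF).
apply: IH => //.
- by apply: subset_trans sF; apply: subsetDl.
- move=> q' /setD1P[qq' /SF /andP[h1 h2]]; rewrite !inE h1 h2.
  by rewrite !xpair_eqE !(negPf qq') !andbF.
- move: gF; congr (good _ _); apply/setP => -[z q']; rewrite !inE !xpair_eqE.
  by have [->|_] := eqVneq q' q; rewrite ?qS ?andbF ?andbT //; case: (z == x0); case: (z == i).
Qed.

Definition row_of i F := [set u in F | u.1 == i].

Lemma row_of_sub i F : row_of i F \subset F.
Proof. by apply/subsetP => u; rewrite inE => /andP[]. Qed.

Lemma last_proof : (r.-1 < r)%N.
Proof. by move: gr; case: r. Qed.

Lemma last_neq0 : r.-1 != 0%N.
Proof. by move: gr; case: r => [|[|n]]. Qed.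

(** The coordinates used to pair across rows: [qa] is free in every row because the last vector of
    V0 carries no point, and [qb] is free in every row but [x0]. *)
Definition qa : P := (Ordinal last_proof, Ordinal last_proof).
Definition qb : P := (wd ord0, Ordinal last_proof).

Lemma qa_free i : (i, qa) \in free_set.
Proof.
have H (l : nat) : (l <= g)%N -> r.-1 != l by move: gr; case: r => //= n + lg; lia.
rewrite inE /valid_pair /= leqnn eqxx /= -ltnNge; apply/andP; split.
  by move: gr; case: r.
by apply/forallP => l; apply/implyP => _; rewrite andbb H // -ltnS.
Qed.

Lemma qb_free i : i != x0 -> (i, qb) \in free_set.
Proof.
have H (l : nat) : (l <= g)%N -> r.-1 != l by move: gr; case: r => //= n + lg; lia.
move=> ix; rewrite inE /valid_pair /= -val_eqE /= [0%N == _]eq_sym (negPf (H 0%N _)) //=.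
apply/forallP => l; apply/implyP => /eqP E; apply/andP; split; last first.
  by apply: H; rewrite -ltnS.
apply/negP => /eqP l0; case/negP: ix; rewrite -E; apply/eqP; congr xi.
by apply/val_inj; rewrite /= -l0.
Qed.

(* The last coordinate of an odd row is paired with a leftover one from another row;
   the mixed conditions they produce are killed already. *)
Lemma good_carry F i l k : F \subset free_set -> rowless F -> l != i -> l != x0 ->
  i != x0 -> (i, qa) \in F -> (i, qb) \notin F -> (l, qb) \in F ->
  odd #|row_of l F| -> good k (F :\: ((i, qa) |: row_of l F)) ->
  good (k + uphalf #|row_of l F|) F.
Proof.
move=> sF nF li lx ix iF iF' lF oR gF.
set R := row_of l F in oR gF *; have RF : R \subset F := row_of_sub l F.
have lR : (l, qb) \in R by rewrite inE lF eqxx.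
have qab : qa != qb.
  by rewrite xpair_eqE negb_and -val_eqE /= last_neq0.
have cR := cardsD1 (l, qb) R; rewrite lR add1n in cR.
have -> : (k + uphalf #|R| = k.+1 + uphalf #|R :\ (l, qb)|)%N.
  by move: oR; rewrite cR /= => oR; rewrite -/(uphalf _.+1) uphalf_even // addnS.
apply: (@good_row _ _ _ l) => //.
- by apply: subset_trans RF; apply: subsetDl.
- by move=> u /setD1P[_]; rewrite inE => /andP[_ /eqP].
apply: (@good_cross _ _ i l qa qb).
- by apply: subset_trans sF; apply: subsetDl.
- exact: rowlessD.
- by rewrite !inE iF /= [i == l]eq_sym (negPf li) andbF.
- by rewrite !inE eqxx /= lF.
- by rewrite in_setD qb_free // andbT !inE (negPf iF') andbF.
- rewrite in_setD qa_free andbT !in_setD in_set1 [_ \in R]inE xpair_eqE eqxx /= (negPf qab) /=.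
  by case: ((l, qa) \in F); rewrite ?eqxx.
move: gF; congr (good _ _); apply/setP => -[z q]; rewrite !inE !xpair_eqE.
have [->|_] := eqVneq z l; last by rewrite !andbF /= orbF.
have [->|_] := eqVneq q qb; rewrite /= ?(negPf li) ?andbF ?andbT //=.
  by rewrite lF /= ?orbT.
Qed.

(** Rows are cleared along L, then [im]. C is a row whose coordinate [qa] was left over because the
    row was odd; the next odd row takes it along, so rounding up happens at most once, at the
    end. *)
Lemma good_rows L F (C : option I) : F \subset free_set -> rowless F ->
  uniq L -> x0 \notin L -> im \notin L ->
  (forall l q, l \in L -> (l, q) \in free_set -> (l, q) \in F) ->
  (im, qb) \in F ->
  (forall u, u \in F -> [|| u.1 \in L, u.1 == im | (C == Some u.1) && (u.2 == qa)]) ->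
  (forall i, C = Some i -> [&& i \notin L, i != im, i != x0 & (i, qa) \in F]) ->
  good (uphalf #|F|) F.
Proof.
have imx : im != x0 by rewrite eq_sym.
have qab : qa == qb = false.
  by apply/negbTE; rewrite xpair_eqE negb_and -val_eqE /= last_neq0.
elim: L F C => [|l L IH] F C sF nF.
  move=> _ _ _ _ mF HF; case: C HF => [i|] HF HC; last first.
    rewrite -[uphalf _]add0n; apply: (@good_row _ _ _ im) => //.
      by move=> u /HF /= /orP[/eqP|].
    by rewrite setDv; exact: good0.
  have /and4P[_ im' ix iF] := HC _ erefl.
  have iqb : (i, qb) \notin F.
    by apply/negP => /HF /=; rewrite (negPf im') /= eqxx /= eq_sym qab.
  set R := row_of im F.
  have iR : (i, qa) \notin R by rewrite inE (negPf im') andbF.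
  have FE : F = (i, qa) |: R.
    apply/setP => -[z q]; apply/idP/idP => [zF|].
      have := HF _ zF; rewrite /= !inE zF /= => /orP[->|/andP[/eqP[->] /eqP->]].
        by rewrite orbT.
      by rewrite eqxx.
    by case/setU1P => [->|/(subsetP (row_of_sub im F))].
  have cF : #|F| = #|R|.+1 by rewrite {1}FE cardsU1 iR.
  have [oR|eR] := boolP (odd #|R|).
    have -> : uphalf #|F| = (0 + uphalf #|R|)%N.
      by rewrite cF -[in LHS](addn0 #|R|) uphalfS_odd.
    apply: (@good_carry F i im) => //; first by rewrite eq_sym.
    by rewrite -FE setDv; exact: good0.
  have -> : uphalf #|F| = (1 + uphalf #|R|)%N.
    by rewrite cF uphalf_even.
  apply: (@good_row _ _ _ im) => //; first exact: row_of_sub.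
    by move=> u; rewrite inE => /andP[_ /eqP].
  have FR : F :\: R = [set (i, qa)].
    rewrite FE; apply/setP => z; rewrite !inE.
    by have [->|_] := eqVneq z (i, qa); rewrite ?(negPf im') ?andbF //= andNb.
  have sFR : [set (i, qa)] \subset free_set by rewrite sub1set qa_free.
  rewrite FR; apply: (@good_same 0 _ i qa qa); rewrite ?set11 //.
    by rewrite -FR; exact: rowlessD.
  have -> : [set (i, qa)] :\: [set (i, qa); (i, qa)] = set0.
    by apply/setP => z; rewrite !inE orbb andNb.
  exact: good0.
rewrite cons_uniq => /andP[lL uL]; rewrite !inE !negb_or => /andP[lx xL] /andP[lim iL].
move=> fL mF HF HC; set R := row_of l F; have RF : R \subset F := row_of_sub l F.
rewrite eq_sym in lx; rewrite eq_sym in lim.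
have Rl u : u \in R -> u.1 = l by rewrite inE => /andP[_ /eqP].
have lqa : (l, qa) \in F by apply: fL; [exact: mem_head|exact: qa_free].
have lqb : (l, qb) \in F by apply: fL; [exact: mem_head|exact: qb_free].
have cF : #|F| = (#|R| + #|F :\: R|)%N by rewrite -(cardsID R F) (setIidPr RF).
have sFR S : F :\: S \subset free_set by apply: subset_trans sF; apply: subsetDl.
have fLS (S : {set I * P}) (z : I) q : S \subset R -> z \in L -> (z, q) \in free_set ->
    (z, q) \in F :\: S.
  move=> SR zL zf; have zL' : z \in l :: L by rewrite inE zL orbT.
  rewrite in_setD (fL _ _ zL' zf) andbT.
  by apply/negP => /(subsetP SR)/Rl /= E; rewrite E (negPf lL) in zL.
have mFS (S : {set I * P}) : S \subset R -> (im, qb) \in F :\: S.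
  move=> SR; rewrite in_setD mF andbT; apply/negP => /(subsetP SR)/Rl /= E.
  by rewrite E eqxx in lim.
have [oR|eR] := boolP (odd #|R|); last first.
  have -> : uphalf #|F| = (uphalf #|F :\: R| + uphalf #|R|)%N.
    by rewrite cF uphalfD_even.
  apply: (@good_row _ _ _ l) => //; apply: (IH _ C) => //.
  - exact: rowlessD.
  - by move=> z q; exact: fLS.
  - exact: mFS.
  - move=> [z q] /setDP[zF]; rewrite inE zF /= => zl.
    by have := HF _ zF; rewrite /= inE (negPf zl).
  - move=> i iC; have /and4P[] := HC _ iC; rewrite inE negb_or => /andP[il iL'] -> -> iF.
    by rewrite iL' /= in_setD iF andbT; apply/negP => /Rl /= E; rewrite E eqxx in il.
case: C HF HC => [i|] HF HC.
  have /and4P[] := HC _ erefl; rewrite inE negb_or => /andP[il iL'] im' ix iF.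
  have iqb : (i, qb) \notin F.
    by apply/negP => /HF; rewrite /= inE (negPf il) (negPf iL') (negPf im') /= eq_sym qab andbF.
  have iR : (i, qa) \notin R by apply/negP => /Rl /= E; rewrite E eqxx in il.
  have cF' : #|F| = (#|R| + #|F :\: ((i, qa) |: R)|).+1.
    have sub : (i, qa) |: R \subset F by rewrite subUset sub1set iF.
    by rewrite -(cardsID ((i, qa) |: R) F) (setIidPr sub) cardsU1 iR.
  have -> : uphalf #|F| = (uphalf #|F :\: ((i, qa) |: R)| + uphalf #|R|)%N.
    by rewrite cF' uphalfS_odd.
  apply: (@good_carry F i l) => //; first by rewrite eq_sym.
  apply: (IH _ None) => //.
  - exact: rowlessD.
  - move=> z q zL zf; have zL' : z \in l :: L by rewrite inE zL orbT.
    rewrite in_setD in_setU1 (fL _ _ zL' zf) andbT negb_or.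
    apply/andP; split; first by apply: contraNneq iL' => -[<- _].
    by apply/negP => /Rl /= E; rewrite E (negPf lL) in zL.
  - rewrite in_setD in_setU1 mF andbT negb_or xpair_eqE eq_sym (negPf im') /=.
    by apply/negP => /Rl /= E; rewrite E eqxx in lim.
  - move=> [z q] /setDP[zF]; rewrite in_setU1 negb_or inE zF /= => /andP[zi zl].
    have := HF _ zF; rewrite /= inE (negPf zl) /= orbF => /or3P[->//|->|/andP[/eqP[E] /eqP E']].
      by rewrite orbT.
    by move: zi; rewrite E E' eqxx.
(* An odd row with nothing pending: all of it but (l, qa) is cleared, and (l, qa) becomes
   pending. *)
have cR := cardsD1 (l, qa) R.
have lR : (l, qa) \in R by rewrite inE lqa eqxx.
rewrite lR add1n in cR.
have -> : uphalf #|F| = (uphalf #|F :\: (R :\ (l, qa))| + uphalf #|R :\ (l, qa)|)%N.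
  have sub : R :\ (l, qa) \subset F by apply: subset_trans RF; apply: subsetDl.
  rewrite -(cardsID (R :\ (l, qa)) F) (setIidPr sub) uphalfD_even //.
  by move: oR; rewrite cR.
have sub : R :\ (l, qa) \subset R := subsetDl _ _.
apply: (@good_row _ _ _ l) => //.
- exact: subset_trans RF.
- by move=> u /(subsetP sub)/Rl.
apply: (IH _ (Some l)) => //.
- exact: rowlessD.
- by move=> z q; exact: fLS.
- exact: mFS.
- move=> [z q] /setDP[zF]; rewrite in_setD1 inE zF /= negb_and negbK.
  have := HF _ zF; rewrite /= inE orbF => + /orP[/eqP[-> ->]|zl]; first by rewrite !eqxx !orbT.
  by rewrite (negPf zl) /= => /orP[->//|->]; rewrite orbT.
- move=> _ [<-]; rewrite lL lim lx /= in_setD in_setD1 eqxx /=; exact: lqa.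
Qed.

(** Row [x0] is cleared first, against row [im]: as [xi] misses [im], every pair free in row [x0] is
    free in row [im]. The pair [qb] is not free in row [x0], so (im, qb) survives, as [good_rows]
    requires. *)
Lemma selection : good (uphalf #|free_set|) free_set.
Proof.
have imx : im != x0 by rewrite eq_sym.
pose S0 : {set P} := [set q | (x0, q) \in free_set].
have imF q : q \in S0 -> (im, q) \in free_set.
  rewrite inE !inE /= => /andP[-> _] /=; apply/forallP => l; apply/implyP => E.
  by rewrite (negPf (im_xi l)) in E.
have HS q : q \in S0 -> ((x0, q) \in free_set) && ((im, q) \in free_set).
  by move=> qS; rewrite imF // andbT; move: qS; rewrite inE.
set F1 := free_set :\: setX [set x0; im] S0.
have sub : setX [set x0; im] S0 \subset free_set.
  apply/subsetP => -[z q]; rewrite inE /= in_set2 => /andP[/orP[/eqP->|/eqP->] /HS /andP[]] //.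
have cE : #|free_set| = (2 * #|S0| + #|F1|)%N.
  by rewrite -(cardsID (setX [set x0; im] S0) free_set) (setIidPr sub) cardsX cards2 eq_sym imx.
have -> : uphalf #|free_set| = (uphalf #|F1| + #|S0|)%N.
  by rewrite cE uphalfD_even ?oddM // mul2n uphalf_double.
apply: (good_doubles (i := im)) => //.
apply: (@good_rows [seq i <- enum I | (i != x0) && (i != im)] _ None) => //.
- exact: subsetDl.
- move=> q; rewrite in_setD negb_and negbK in_setX set21 /=.
  by rewrite [q \in S0]inE orbN.
- by rewrite filter_uniq ?enum_uniq.
- by rewrite mem_filter eqxx.
- by rewrite mem_filter eqxx andbF.
- move=> l q; rewrite mem_filter => /andP[/andP[lx li] _] lf.
  by rewrite in_setD lf andbT in_setX in_set2 (negPf lx) (negPf li).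
- rewrite in_setD qb_free // andbT in_setX negb_and; apply/orP; right.
  rewrite inE inE negb_and; apply/orP; right; apply/forallPn; exists ord0.
  by rewrite eqxx.
- move=> [z q] /setDP[zf]; rewrite in_setX in_set2 /= mem_filter mem_enum andbT orbF.
  case: eqVneq => [E|_] /=; last by case: eqVneq.
  by have -> : q \in S0 by rewrite inE -E.
Qed.

Lemma card_le_pairs : #|[set q : P | (q.1 <= q.2)%N]| = 'C(r.+1, 2).
Proof.
rewrite -sum1dep_card -(pair_big_dep xpredT (fun a b : 'I_r => (a <= b)%N) (fun _ _ => 1%N)) /=.
rewrite (exchange_big_dep xpredT) //= -bin2_sum big_nat_recl // add0n big_mkord.
apply: eq_bigr => b _.
under eq_bigl do rewrite -ltnS.
by rewrite -(big_ord_widen _ (fun=> 1%N) (ltn_ord b)) sum1_card card_ord.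
Qed.

(** Two disjoint families are removed from the unordered pairs of all rows: in every row the
    diagonal pairs of index at most g, and in row [xi l] the pairs of l with another index, which
    [lift] enumerates. *)
Lemma card_free_set :
  (#|free_set| + g.+1 * r.-1 + #|I| * g.+1 <= #|I| * 'C(r.+1, 2))%N.
Proof.
pose D : {set I * P} := [set (u.1, (wd u.2, wd u.2)) | u : I * 'I_g.+1].
have cD : #|D| = (#|I| * g.+1)%N.
  rewrite card_imset ?card_prod ?card_ord // => -[i l] [i' l'] /= [-> E] *.
  by congr (_, _); apply/val_inj.
pose srt (a b : 'I_r) := if (a <= b)%N then (a, b) else (b, a).
pose R : {set I * P} :=
  [set (xi u.1, srt (wd u.1) (lift (wd u.1) u.2)) | u : 'I_g.+1 * 'I_r.-1].
have cR : #|R| = (g.+1 * r.-1)%N.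
  rewrite card_imset ?card_prod ?card_ord // => -[l j] [l' j'] /= [/xi_inj <-].
  rewrite /srt; case: leqP => _; case: leqP => _ [] *; congr (_, _);
    apply: (@lift_inj _ (wd l)); apply/val_inj => /=; congruence.
have -> : (#|I| * 'C(r.+1, 2))%N = #|setX [set: I] [set q : P | (q.1 <= q.2)%N]|.
  by rewrite cardsX cardsT card_le_pairs.
have fR : [disjoint free_set & R].
  apply/pred0P => u; apply/negP => /andP[/= uf /imsetP[[l j] _ E]].
  move: uf; rewrite E inE /= => /andP[_ /forallP/(_ l)]; rewrite eqxx /=.
  by rewrite /srt; case: leqP => _ /=; rewrite eqxx ?andbF.
have fD : [disjoint free_set :|: R & D].
  apply/pred0P => u; apply/negP => /andP[/= uf /imsetP[[i' l] _ E]].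
  move: uf; rewrite E; case/setUP; first by rewrite inE /valid_pair /= eqxx leqnn /= -ltnS ltn_ord.
  case/imsetP => -[l' j] _ /= [_]; rewrite /srt.
  have := neq_lift (wd l') j; rewrite -val_eqE /= => /eqP H.
  by case: leqP => _ [] *; case: H => /=; congruence.
rewrite -cD -cR.
have cU (A B : {set I * P}) : [disjoint A & B] -> #|A :|: B| = (#|A| + #|B|)%N.
  by move=> AB; apply/eqP; rewrite leq_card_setU.
rewrite -(cU _ _ fR) -(cU _ _ fD); apply: subset_leq_card; apply/subsetP => -[i q].
rewrite in_setX in_setT [q \in _]inE => /setUP[/setUP[]|].
- by rewrite inE /valid_pair => /andP[/andP[]].
- case/imsetP => -[l j] _ [_ ->]; rewrite /srt.
  by case: (leqP (wd l) (lift (wd l) j)) => [//|/ltnW].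
- by case/imsetP => -[i' l] _ [_ ->]; rewrite /= leqnn.
Qed.

End Selection.

(** * Mixed terms between two planes *)

Section CrossConditions.
Variable K : numFieldType.

(* The value on [((a, a'), (b, b'))] of the bilinear form with matrix [D]. *)
Definition bil (D : bool -> bool -> K) (a a' b b' : K) : K :=
  a * (b * D false false + b' * D false true) +
  a' * (b * D true false + b' * D true true).

Lemma bil_eq0 (D : bool -> bool -> K) (a a' b b' : K) : a * b' - b * a' != 0 ->
  bil D a a' a a' = 0 -> bil D a a' b b' = 0 -> bil D b b' a a' = 0 ->
  bil D b b' b b' = 0 -> forall s s', D s s' = 0.
Proof.
move=> d0 Haa Hab Hba Hbb; have dd0 := mulf_neq0 d0 d0.
have E s s' : (a * b' - b * a') * (a * b' - b * a') * D s s' =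
  (if s then - b else b') * ((if s' then - b else b') * bil D a a' a a' +
                             (if s' then a else - a') * bil D a a' b b') +
  (if s then a else - a') * ((if s' then - b else b') * bil D b b' a a' +
                             (if s' then a else - a') * bil D b b' b b').
  by case: s; case: s'; rewrite /bil; ring.
by move=> s s'; apply: (mulfI dd0); rewrite E Haa Hab Hba Hbb !mulr0 !addr0 !mulr0 addr0.
Qed.

Lemma slopes_eq0 (a b a' b' F F' : K) : a * b' - b * a' != 0 ->
  a * F + b * F' = 0 -> a' * F + b' * F' = 0 -> F = 0 /\ F' = 0.
Proof.
move=> d0 H1 H2; split; apply: (mulfI d0); rewrite mulr0.
  transitivity (b' * (a * F + b * F') - b * (a' * F + b' * F')); first by ring.
  by rewrite H1 H2 !mulr0 subr0.
transitivity (a * (a' * F + b' * F') - a' * (a * F + b * F')); first by ring.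
by rewrite H1 H2 !mulr0 subr0.
Qed.

(** The letters p, q, r, s are values at the pairs of vectors (0,0), (0,1), (1,0), (1,1), and the
    digit is the coordinate in the triple. The relations close up into the loop q0, q1, q2, r0, r1,
    r2, q0, which yields q0 = (t t')^3 q0. *)
Lemma cyclic3_scalars (t t' al be p0 p2 q0 q1 q2 r0 r1 r2 s0 s2 : K) :
  al != 0 -> be != 0 -> (t * t') ^+ 3 - 1 != 0 ->
  p0 = 0 -> s2 = 0 ->
  al * (al * p0 + be * q0) + be * (al * r0 + be * s0) = 0 ->
  al * (al * p2 + be * q2) + be * (al * r2 + be * s2) = 0 ->
  al * p2 + be * r2 + t * (al * p0 + be * r0) = 0 ->
  al * p2 + be * q2 + t' * (al * p0 + be * q0) = 0 ->
  q0 + t * q1 = 0 -> r0 + t' * r1 = 0 -> r1 + t * r2 = 0 -> q1 + t' * q2 = 0 ->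
  [/\ q0 = 0, q1 = 0 & q2 = 0] /\ [/\ r0 = 0, r1 = 0, r2 = 0, p2 = 0 & s0 = 0].
Proof.
move=> al0 be0 t3 -> -> E0 E2 El Er Eq0 Er0 Er1 Eq1.
have ab := mulf_neq0 al0 be0.
have q2E : q2 = t * r0.
  apply: (mulfI ab); apply/eqP; rewrite -subr_eq0; apply/eqP.
  transitivity (al * (al * p2 + be * q2) + be * (al * r2 + be * 0) -
                al * (al * p2 + be * r2 + t * (al * 0 + be * r0))); first by ring.
  by rewrite E2 El mulr0 subr0.
have r2E : r2 = t' * q0.
  apply: (mulfI ab); apply/eqP; rewrite -subr_eq0; apply/eqP.
  transitivity (al * (al * p2 + be * q2) + be * (al * r2 + be * 0) -
                al * (al * p2 + be * q2 + t' * (al * 0 + be * q0))); first by ring.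
  by rewrite E2 Er mulr0 subr0.
have q0E : q0 = - (t * q1) by apply/eqP; rewrite -addr_eq0 Eq0.
have r0E : r0 = - (t' * r1) by apply/eqP; rewrite -addr_eq0 Er0.
have r1E : r1 = - (t * r2) by apply/eqP; rewrite -addr_eq0 Er1.
have q1E : q1 = - (t' * q2) by apply/eqP; rewrite -addr_eq0 Eq1.
have q00 : q0 = 0.
  apply: (mulfI t3); rewrite mulr0; apply/eqP; rewrite mulrBl mul1r subr_eq0 eq_sym.
  by apply/eqP; rewrite {1}q0E q1E q2E r0E r1E r2E; ring.
have r20 : r2 = 0 by rewrite r2E q00 mulr0.
have r10 : r1 = 0 by rewrite r1E r20 mulr0 oppr0.
have r00 : r0 = 0 by rewrite r0E r10 mulr0 oppr0.
have q20 : q2 = 0 by rewrite q2E r00 mulr0.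
have q10 : q1 = 0 by rewrite q1E q20 mulr0 oppr0.
split; split=> //.
  by apply: (mulfI al0); move: El; rewrite r20 r00 !mulr0 !addr0 mulr0 addr0.
apply: (mulfI (mulf_neq0 be0 be0)); move: E0.
by rewrite q00 r00 !mulr0 !addr0 mulr0 !add0r mulrA.
Qed.

(** Contracting the conditions with the three vectors (w i, w' i) gives scalar relations; t != t'
    settles the values with equal vectors at coordinates i and i+1. In dimension 2 Cramer's rule
    expresses the third vector by the first two. *)
Lemma cyclic3_eq0 (t t' : K) (w w' : 'I_3 -> K) (D : 'I_3 -> bool -> bool -> K) :
  t != t' -> (t * t') ^+ 3 != 1 ->
  (forall i i', i != i' -> w i * w' i' - w i' * w' i != 0) ->
  (forall i s, w i * D i false s + w' i * D i true s +
     t * (w i * D (ordS i) false s + w' i * D (ordS i) true s) = 0) ->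
  (forall i s, w i * D i s false + w' i * D i s true +
     t' * (w i * D (ordS i) s false + w' i * D (ordS i) s true) = 0) ->
  forall i s s', D i s s' = 0.
Proof.
move=> tt' t3 det HL HR.
pose M i i' y := bil (D y) (w i) (w' i) (w i') (w' i').
have ML i i' : M i i' i + t * M i i' (ordS i) = 0.
  transitivity (w i' * (w i * D i false false + w' i * D i true false +
     t * (w i * D (ordS i) false false + w' i * D (ordS i) true false)) +
    w' i' * (w i * D i false true + w' i * D i true true +
     t * (w i * D (ordS i) false true + w' i * D (ordS i) true true))).
    by rewrite /M /bil; ring.
  by rewrite !HL !mulr0 addr0.
have MR i i' : M i i' i' + t' * M i i' (ordS i') = 0.
  transitivity (w i * (w i' * D i' false false + w' i' * D i' false true +
     t' * (w i' * D (ordS i') false false + w' i' * D (ordS i') false true)) +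
    w' i * (w i' * D i' true false + w' i' * D i' true true +
     t' * (w i' * D (ordS i') true false + w' i' * D (ordS i') true true))).
    by rewrite /M /bil; ring.
  by rewrite !HR !mulr0 addr0.
have tt0 : 1 * t' - t * 1 != 0 by rewrite mul1r mulr1 subr_eq0 eq_sym.
have MD i : M i i i = 0 /\ M i i (ordS i) = 0.
  by apply: (slopes_eq0 tt0); rewrite mul1r; [exact: ML|exact: MR].
pose i0 : 'I_3 := ord0; pose i1 := ordS i0; pose i2 := ordS i1.
have Si2 : ordS i2 = i0 by apply/val_inj.
pose d := w i0 * w' i1 - w i1 * w' i0.
pose al := w i2 * w' i1 - w i1 * w' i2.
pose be := w i0 * w' i2 - w i2 * w' i0.
have M2l i y : d * M i2 i y = al * M i0 i y + be * M i1 i y.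
  by rewrite /M /bil /d /al /be; ring.
have M2r i y : d * M i i2 y = al * M i i0 y + be * M i i1 y.
  by rewrite /M /bil /d /al /be; ring.
have M22 y : M i2 i2 y = 0 -> al * (al * M i0 i0 y + be * M i0 i1 y) +
    be * (al * M i1 i0 y + be * M i1 i1 y) = 0.
  move=> M0; transitivity (d * d * M i2 i2 y); last by rewrite M0 mulr0.
  by rewrite /M /bil /d /al /be; ring.
have [p0 p1] := MD i0; have [s1 s2] := MD i1; have [H222 H220] := MD i2.
rewrite Si2 in H220; rewrite -/i1 in p1; rewrite -/i2 in s2.
have El : al * M i0 i0 i2 + be * M i1 i0 i2 + t * (al * M i0 i0 i0 + be * M i1 i0 i0) = 0.
  have := ML i2 i0; rewrite Si2 => H.
  transitivity (d * (M i2 i0 i2 + t * M i2 i0 i0)); last by rewrite H mulr0.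
  by rewrite -!M2l; move: (M i2 i0 i2) (M i2 i0 i0) => ? ?; ring.
have Er : al * M i0 i0 i2 + be * M i0 i1 i2 + t' * (al * M i0 i0 i0 + be * M i0 i1 i0) = 0.
  have := MR i0 i2; rewrite Si2 => H.
  transitivity (d * (M i0 i2 i2 + t' * M i0 i2 i0)); last by rewrite H mulr0.
  by rewrite -!M2r; move: (M i0 i2 i2) (M i0 i2 i0) => ? ?; ring.
have t31 : (t * t') ^+ 3 - 1 != 0 by rewrite subr_eq0.
have d01 : d != 0 by apply: det.
have al0 : al != 0 by apply: det.
have be0 : be != 0 by apply: det.
have [[q0 q1 q2] [r0 r1 r2 p2 s0]] := cyclic3_scalars al0 be0 t31 p0 s2
  (M22 _ H220) (M22 _ H222) El Er (ML i0 i1) (MR i1 i0) (ML i1 i0) (MR i0 i1).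
have I3 (i : 'I_3) : [\/ i = i0, i = i1 | i = i2].
  case: i => [[|[|[|//]]] Hi]; [apply: Or31|apply: Or32|apply: Or33]; exact: val_inj.
by move=> i; apply: (bil_eq0 d01); have [->|->|->] := I3 i.
Qed.

End CrossConditions.

(** * The configuration for m > 3 or n odd *)

Section BlockData.
Variables (K : numFieldType) (h c : nat).
(* The coordinates of C^(m+1) are grouped into pairs and, when m is even, one
   triple. *)
Local Notation I := ('I_h.+1 * bool + 'I_c * 'I_3)%type.
Local Notation X := {ffun I -> K^o}.

Definition o0 : I := inl (ord0, false).
Definition o1 : I := inl (ord0, true).

Definition idx (i : I) : nat :=
  match i with
  | inl (p, b) => (p.*2 + b)%N
  | inr (q, z) => (h.+1.*2 + (q * 3 + z))%N
  end.

Lemma idx_inj : injective idx.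
Proof.
move=> [[p b]|[q z]] [[p' b']|[q' z']] /=.
- move=> E; have Eb : b = b' by have := congr1 odd E; rewrite !oddD !odd_double !oddb.
  subst b'; congr (inl (_, _)); apply/val_inj => /=.
  by move/addIn: E => /double_inj.
- by move: (ltn_ord p); case: b => /= H E; exfalso; lia.
- by move: (ltn_ord p'); case: b' => /= H E; exfalso; lia.
- move: (ltn_ord z) (ltn_ord z') => H H' E.
  have [E1 E2] : q = q' :> nat /\ z = z' :> nat by split; lia.
  by congr (inr (_, _)); apply/val_inj.
Qed.

Lemma card_blocks : #|{: I}| = (h.+1.*2 + c * 3)%N.
Proof. by rewrite card_sum !card_prod !card_ord card_bool muln2. Qed.

Lemma idx_lt i : (idx i < #|{: I}|)%N.
Proof.
rewrite card_blocks; case: i => [[p b]|[q z]] /=.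
  by move: (ltn_ord p); case: b => /= H; lia.
by move: (ltn_ord q) (ltn_ord z) => H H'; nia.
Qed.

Lemma idx_surj a : (a < #|{: I}|)%N -> exists i, idx i = a.
Proof.
move=> al; have inj : injective (fun i => Ordinal (idx_lt i)).
  by move=> i j /(congr1 val) /= /idx_inj.
have [g _ gK] : bijective (fun i => Ordinal (idx_lt i)).
  by apply: inj_card_bij => //; rewrite card_ord.
by exists (g (Ordinal al)); have /(congr1 val) := gK (Ordinal al).
Qed.

Lemma idx_o i : (1 < idx i)%N = (i != o0) && (i != o1).
Proof.
have [->|n0] := eqVneq i o0; first by [].
have [->|n1] := eqVneq i o1; first by [].
case E : (idx i) => [|[|n]] //=.
  by case/eqP: n0; apply: idx_inj.
by case/eqP: n1; apply: idx_inj.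
Qed.

(** Besides the values forced at [o0] and [o1], the pairs (1, idx i) have distinct nonzero slopes,
    which is what [w1_det] needs. *)
Definition w1 (i : I) : K := if i == o0 then -1 else if i == o1 then 0 else 1.
Definition w1' (i : I) : K :=
  if i == o0 then 0 else if i == o1 then -1 else (idx i)%:R.

Lemma w1_det i i' : i != i' -> w1 i * w1' i' - w1 i' * w1' i != 0.
Proof.
have s0 (z : I) : z != o0 -> z != o1 -> (idx z)%:R != 0 :> K.
  by move=> z0 z1; rewrite pnatr_eq0 -lt0n; apply: (@ltn_trans 1) => //; rewrite idx_o z0.
rewrite /w1 /w1'.
have [->|n0] := eqVneq i o0.
  move=> n0'; rewrite [i' == o0]eq_sym (negPf n0') mulr0 subr0.
  by have [_|n1'] := eqVneq i' o1;
    [rewrite mulrNN mulr1 oner_neq0 | rewrite mulN1r oppr_eq0 s0 // eq_sym].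
have [->|n1] := eqVneq i o1.
  have [_ _|n0' n1'] := eqVneq i' o0; first by rewrite mul0r sub0r mulrNN mulr1 oppr_eq0 oner_neq0.
  by rewrite [i' == o1]eq_sym (negPf n1') mul0r sub0r mulrN mul1r opprK oner_neq0.
have [_ _|n0'] := eqVneq i' o0; first by rewrite mulr0 mulN1r opprK add0r s0.
have [_ _|n1'] := eqVneq i' o1; first by rewrite mul0r subr0 mul1r oppr_eq0 oner_neq0.
by move=> ii'; rewrite !mul1r subr_eq0 eqr_nat (inj_eq idx_inj) eq_sym.
Qed.

(* Even, so that [tj j] never equals [tj j' + 1]; see [e1_cross]. *)
Definition tj (j : nat) : K := (j.*2.+2)%:R.

(** The two vectors of a pair have slopes [tj j] and [tj j - 1], and their sum does not depend on j:
    this is how a point of V0 with a fixed first factor serves all planes. A triple is cyclic. *)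
Definition e1 (j : nat) (i : I) : X :=
  match i with
  | inl (p, false) => tj j *: dl K (inl (p, false)) + 1 *: dl K (inl (p, true))
  | inl (p, true) =>
      (1 - tj j) *: dl K (inl (p, false)) + (-1) *: dl K (inl (p, true))
  | inr (q, z) => 1 *: dl K (inr (q, z)) + tj j *: dl K (inr (q, ordS z))
  end.

Lemma comb2_sum (a b : K) (y z : I) (F : I -> K) :
  \sum_x (a *: dl K y + b *: dl K z : X) x * F x = a * F y + b * F z.
Proof.
have D u : \sum_x (dl K u : X) x * F x = F u.
  rewrite (bigD1 u) //= big1 => [|v ne]; first by rewrite ffunE eqxx mul1r addr0.
  by rewrite ffunE (negPf ne) mul0r.
rewrite -!D !mulr_sumr -big_split; apply: eq_bigr => x _.
by rewrite !ffunE /GRing.scale /= mulrDl !mulrA.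
Qed.

Lemma e1_o j : e1 j o0 + e1 j o1 = dl K o0.
Proof.
rewrite /e1 /= scale1r scaleN1r addrACA subrr addr0 -scalerDl.
by rewrite [tj _ + _]addrC subrK scale1r.
Qed.

Lemma tj3 j : 1 + tj j ^+ 3 != 0.
Proof. by rewrite -natrX -[1]/(1%:R) -natrD pnatr_eq0. Qed.

Lemma tj_cross3 j j' : (tj j * tj j') ^+ 3 != 1.
Proof. by rewrite -natrM -natrX -[1]/(1%:R) eqr_nat; apply/eqP; nia. Qed.

Lemma e1_basis j (F : I -> K) : (forall l, \sum_i F i * e1 j l i = 0) -> forall i, F i = 0.
Proof.
move=> H.
have H' l : \sum_x e1 j l x * F x = 0.
  by rewrite -[RHS](H l); apply: eq_bigr => x _; rewrite mulrC.
case=> [[p b]|[q z]].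
  have := H' (inl (p, false)); have := H' (inl (p, true)); rewrite !comb2_sum => E1 E0.
  have D : tj j * -1 - 1 * (1 - tj j) != 0.
    by rewrite mulrN1 mul1r opprB addrA addNr sub0r oppr_eq0 oner_neq0.
  by have [E E'] := slopes_eq0 D E0 E1; case: b.
have R z' : F (inr (q, z')) = - (tj j * F (inr (q, ordS z'))).
  by have := H' (inr (q, z')); rewrite comb2_sum mul1r => /eqP; rewrite addr_eq0 => /eqP.
apply: (mulfI (tj3 j)); rewrite mulr0 mulrDl mul1r {1}R {1}R {1}R.
have -> : ordS (ordS (ordS z)) = z by apply/val_inj; case: z => [[|[|[|]]]].
by ring.
Qed.

(** The conditions split along the blocks. In a pair, contraction with two points leaves two
    equations in the values at the two coordinates, independent because the slopes for j and j' are
    all distinct; a triple is [cyclic3_eq0]. *)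
Lemma e1_cross j j' (D : I -> bool -> bool -> K) : j != j' ->
  (forall i s, \sum_x e1 j i x * (w1 i * D x false s + w1' i * D x true s) = 0) ->
  (forall i s, \sum_x e1 j' i x * (w1 i * D x s false + w1' i * D x s true) = 0) ->
  forall x s s', D x s s' = 0.
Proof.
move=> jj' HL HR.
have tjj' : tj j != tj j' by rewrite eqr_nat; apply: contraNneq jj' => E; apply/eqP; lia.
case=> [[p b]|[q z]].
  pose M i i' x := bil (D x) (w1 i) (w1' i) (w1 i') (w1' i').
  have ML i i' : \sum_x e1 j i x * M i i' x = 0.
    transitivity (w1 i' * (\sum_x e1 j i x * (w1 i * D x false false + w1' i * D x true false)) +
      w1' i' * (\sum_x e1 j i x * (w1 i * D x false true + w1' i * D x true true))).
      by rewrite !mulr_sumr -big_split; apply: eq_bigr => x _; rewrite /M /bil /=; ring.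
    by rewrite !HL !mulr0 addr0.
  have MR i i' : \sum_x e1 j' i' x * M i i' x = 0.
    transitivity (w1 i * (\sum_x e1 j' i' x * (w1 i' * D x false false + w1' i' * D x false true)) +
      w1' i * (\sum_x e1 j' i' x * (w1 i' * D x true false + w1' i' * D x true true))).
      by rewrite !mulr_sumr -big_split; apply: eq_bigr => x _; rewrite /M /bil /=; ring.
    by rewrite !HR !mulr0 addr0.
  have MM s s' : M (inl (p, s)) (inl (p, s')) (inl (p, b)) = 0.
    have := ML (inl (p, s)) (inl (p, s')); have := MR (inl (p, s)) (inl (p, s')).
    have nn (a a' : nat) : a != a' -> (a%:R - a'%:R : K) != 0 by rewrite subr_eq0 eqr_nat.
    case: s; case: s'; rewrite !comb2_sum => E0 E1;
      have [|F F'] := slopes_eq0 _ E0 E1; try by case: (b).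
    - have -> : (1 - tj j') * -1 - -1 * (1 - tj j) = tj j' - tj j :> K by ring.
      by rewrite subr_eq0 eq_sym.
    - have -> : tj j' * -1 - 1 * (1 - tj j) = tj j - (j'.*2.+3)%:R :> K.
        by rewrite /tj -[j'.*2.+3]addn1 natrD; ring.
      by apply: nn; lia.
    - have -> : (1 - tj j') * 1 - -1 * tj j = (j.*2.+3)%:R - tj j' :> K.
        by rewrite /tj -[j.*2.+3]addn1 natrD; ring.
      by apply: nn; lia.
    - by rewrite mulr1 mul1r subr_eq0 eq_sym.
  have d0 : w1 (inl (p, false)) * w1' (inl (p, true)) -
            w1 (inl (p, true)) * w1' (inl (p, false)) != 0.
    by apply: w1_det; apply/eqP => -[].
  by apply: (bil_eq0 d0); exact: MM.
have H := @cyclic3_eq0 _ (tj j) (tj j') (fun z => w1 (inr (q, z)))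
  (fun z => w1' (inr (q, z))) (fun z => D (inr (q, z))) tjj' (tj_cross3 j j').
move=> s s'; apply: (H _ _ _ z s s').
- by move=> i i' ii'; apply: w1_det; apply: contraNneq ii' => -[->].
- by move=> i a; have := HL (inr (q, i)) a; rewrite comb2_sum mul1r.
- by move=> i a; have := HR (inr (q, i)) a; rewrite comb2_sum mul1r.
Qed.

Section Spanning.
Variables (preset : bool) (r : nat).
Local Notation V0 := {ffun 'I_r -> K^o}.
Hypothesis r_size : (r.+2 = #|{: I}| + preset)%N.
Hypothesis r_gt1 : (1 < r)%N.

Definition v0 : 'I_r := Ordinal (ltnW r_gt1).

(* For [preset = true] the vectors span the hyperplane where the coordinates of
   index [> 0] sum to zero, which contains no coordinate vector but that of [v0]. *)
Definition bb (i : I) : V0 :=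
  [ffun a : 'I_r => (a == (idx i).-2 :> nat)%:R - (preset && (a == r.-1 :> nat))%:R].

(** The vector of index 2 adjusts the sum to [dr K v0], and supplies v0 modulo the others. *)
Definition b1 (i : I) : V0 :=
  if (idx i <= 1)%N then 0
  else if idx i == 2 then dr K v0 - \sum_(i' | (2 < idx i')%N) bb i' else bb i.

Lemma card_I_gt3 : (3 < #|{: I}|)%N.
Proof. by have := r_size; rewrite card_blocks; case: (preset) => /=; lia. Qed.

Lemma b1_sum : \sum_i b1 i = dr K v0.
Proof.
have [i2 Ei2] := idx_surj (ltnW card_I_gt3).
rewrite (bigD1 i2) //= {1}/b1 Ei2 /=.
rewrite [X in _ + X](bigID (fun i => (2 < idx i)%N)) /= [X in _ + (_ + X)]big1 => [|i /andP[ii]]; last first.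
  rewrite -leqNgt leq_eqVlt => /orP[/eqP E|]; last by rewrite ltnS /b1 => ->.
  by case/eqP: ii; apply: idx_inj; rewrite Ei2.
rewrite addr0; set S := \sum_(i | (i != i2) && _) _.
suff -> : S = \sum_(i | (2 < idx i)%N) bb i by rewrite subrK.
apply: eq_big => [i|i /andP[_]]; first by case: eqVneq => [->|_]; rewrite ?Ei2.
by rewrite /b1; case: (idx i) => [|[|[|]]].
Qed.

Lemma b1_span (f : 'I_r -> K) :
  (forall i, i != o0 -> i != o1 -> \sum_a f a * b1 i a = 0) ->
  (preset -> exists2 a : 'I_r, (0 < a)%N & f a = 0) -> forall a, f a = 0.
Proof.
move=> H Hp.
have rl : (r.-1 < r)%N by case: (r) r_gt1.
have S (a0 : 'I_r) : \sum_a f a * (a == a0 :> nat)%:R = f a0.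
  rewrite (bigD1 a0) //= eqxx mulr1 big1 ?addr0 // => a /negPf.
  by rewrite -val_eqE /= => ->; rewrite mulr0.
have bbE i : (2 < idx i)%N -> exists2 a : 'I_r, a = (idx i).-2 :> nat &
    \sum_a f a * bb i a = f a - preset%:R * f (Ordinal rl).
  move=> i2; have ai : ((idx i).-2 < r)%N.
    by move: (idx_lt i) r_size; case: (preset) => /=; lia.
  exists (Ordinal ai) => //; rewrite -!S mulr_sumr -sumrB; apply: eq_bigr => a _.
  by rewrite ffunE mulrBr /=; case: (preset); rewrite /= ?mul1r ?mul0r ?mulr0.
have bb0 i : (2 < idx i)%N -> \sum_a f a * bb i a = 0.
  move=> i2; have /andP[n0 n1] : (i != o0) && (i != o1) by rewrite -idx_o ltnW.
  by have := H i n0 n1; rewrite /b1; case: (idx i) i2 => [|[|[|]]].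
have [i2 Ei2] := idx_surj (ltnW card_I_gt3).
have f0 : f v0 = 0.
  have /andP[n0 n1] : (i2 != o0) && (i2 != o1) by rewrite -idx_o Ei2.
  have := H i2 n0 n1; rewrite /b1 Ei2 /= => H2.
  rewrite -[LHS]addr0 -[RHS]H2; apply/eqP; rewrite addr0 -subr_eq0; apply/eqP.
  transitivity (\sum_(i | (2 < idx i)%N) \sum_a f a * bb i a); last by rewrite big1.
  rewrite exchange_big /= -(S v0) -sumrB; apply: eq_bigr => a _.
  rewrite !ffunE -mulr_sumr -mulrBr; congr (_ * _).
  by rewrite sum_ffunE opprD opprK addrA -val_eqE subrr add0r.
have fa (a : 'I_r) : (0 < a)%N -> (a.+2 < #|{: I}|)%N -> f a = preset%:R * f (Ordinal rl).
  move=> a0 al; have [i Ei] := idx_surj al.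
  have gi : (2 < idx i)%N by rewrite Ei.
  have [a' Ea' E] := bbE i gi; move: E; rewrite (bb0 _ gi) => /esym/eqP.
  rewrite subr_eq0 => /eqP <-; congr f; apply/val_inj; rewrite /= Ea' Ei //.
have fl : preset%:R * f (Ordinal rl) = 0.
  case: (boolP preset) => [pr|_]; last by rewrite mul0r.
  rewrite mul1r; have [a a0 fa0] := Hp pr.
  have [al|al] := ltnP a.+2 #|{: I}|.
    by move: (fa a a0 al); rewrite fa0 pr mul1r.
  rewrite -[RHS]fa0; congr f; apply/val_inj => /=.
  by move: al (ltn_ord a) r_size; rewrite pr /=; lia.
move=> a; have [a0|a0] := posnP a.
  by rewrite -[RHS]f0; congr f; apply/val_inj.
have [al|al] := ltnP a.+2 #|{: I}|; first by rewrite fa.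
case: (boolP preset) => [pr|np].
  rewrite -[RHS]fl pr mul1r; congr f; apply/val_inj => /=.
  by move: al (ltn_ord a) r_size; rewrite pr /=; lia.
by move: al (ltn_ord a) r_size; rewrite (negPf np) /=; lia.
Qed.

End Spanning.

End BlockData.

Section StarConfig.
Variables (K : numFieldType) (h c k : nat) (preset : bool) (r : nat).
Local Notation I := ('I_h.+1 * bool + 'I_c * 'I_3)%type.
Local Notation X := {ffun I -> K^o}.
Local Notation V0 := {ffun 'I_r -> K^o}.
Local Notation g := (if preset then h.+1 else 0%N).
Local Notation o0 := (o0 h c).
Local Notation o1 := (o1 h c).

Lemma g_le : (g <= h.+1)%N.
Proof. by case: (preset). Qed.

(** With [preset] every pair of coordinates gets a point whose vector lies outside the span of the
    [b1]. For pair 0 the point (o0, v0) does not do, v0 being in that span, so [o1] is added with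
    index h+1. *)
Definition xi (l : 'I_g.+1) : I :=
  if l == 0 :> nat then o0 else if l == h.+1 :> nat then o1 else inl (inord l, false).

Lemma xi_inj : injective xi.
Proof.
move=> l l' E; apply/val_inj; move: E; rewrite /xi /=.
have hl (z : 'I_g.+1) : z != 0 :> nat -> z != h.+1 :> nat -> (z < h.+1)%N.
  by have := leq_trans (ltn_ord z) (g_le : (g.+1 <= h.+2)%N); lia.
have [->|l0] := eqVneq (l : nat) 0%N; have [->|l0'] := eqVneq (l' : nat) 0%N => //.
- have [->|l1'] := eqVneq (l' : nat) h.+1 => // -[] /(congr1 val) /=.
  by rewrite inordK ?hl // => /esym E; rewrite E in l0'.
- have [->|l1] := eqVneq (l : nat) h.+1 => // -[] /(congr1 val) /=.
  by rewrite inordK ?hl // => E; rewrite E in l0.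
have [->|l1] := eqVneq (l : nat) h.+1; have [->|l1'] := eqVneq (l' : nat) h.+1 => //.
by move=> -[] /(congr1 val) /=; rewrite !inordK ?hl.
Qed.

Hypotheses (r_size : (r.+2 = #|{: I}| + preset)%N) (gr : (g.+1 < r)%N)
  (c_preset : preset -> c = 0%N) (h_preset : preset -> (0 < h)%N).

Lemma xi_missed : exists im, forall l, xi l != im.
Proof.
have /orP[pr|np] := orbN preset.
  have hp := h_preset pr; exists (inl (inord 1, true)) => l; rewrite /xi.
  have i1 : (inord 1 : 'I_h.+1) != ord0 by rewrite -val_eqE /= inordK.
  case: ifP => _; first by apply/eqP => -[].
  case: ifP => _; last by apply/eqP => -[].
  by apply: contraNneq i1 => -[<-].
exists o1 => l; rewrite /xi.
have g1 : (g.+1 <= 1)%N by rewrite (negPf np).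
by have -> : (l == 0 :> nat) = true by have := leq_trans (ltn_ord l) g1; lia.
Qed.

Let r_gt1 : (1 < r)%N := leq_ltn_trans (ltn0Sn _ : (1 <= g.+1)%N) gr.

Lemma v0_wd : v0 r_gt1 = wd gr ord0.
Proof. exact: val_inj. Qed.

(* Vectors summing to the given point of the plane and containing, up to
   scalars, two prescribed evaluation points. *)
Definition realizes (y : (I -> V0) * (I * I) * (K * K)) (q q' : 'I_r * 'I_r) :=
  [/\ y.1.1 o0 = 0 /\ y.1.1 o1 = 0, \sum_i y.1.1 i = dr K (wd gr ord0),
      [&& y.1.2.1 != o0, y.1.2.1 != o1, y.1.2.2 != o0 & y.1.2.2 != o1],
      y.2.1 != 0 /\ y.1.1 y.1.2.1 = y.2.1 *: pp K q &
      y.2.2 != 0 /\ y.1.1 y.1.2.2 = y.2.2 *: pp K q'].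

Lemma sum_delta (i : I) (v : V0) : \sum_j (j == i)%:R *: v = v.
Proof.
rewrite (bigD1 i) //= eqxx scale1r big1 ?addr0 // => j /negPf->.
by rewrite scale0r.
Qed.

Lemma exists_realizes q q' : valid_pair g q -> valid_pair g q' ->
  exists y, realizes y q q'.
Proof.
move=> vq vq'.
have card4 : (3 < #|{: I}|)%N by apply: (card_I_gt3 r_size r_gt1).
have [j2 E2] := @idx_surj h c 2 (ltnW card4).
have [j3 E3] := @idx_surj h c 3 card4.
have /andP[n20 n21] : (j2 != o0) && (j2 != o1) by rewrite -idx_o E2.
have /andP[n30 n31] : (j3 != o0) && (j3 != o1) by rewrite -idx_o E3.
have n32 : j3 != j2 by apply/eqP => E; move: E3; rewrite E E2.
(* With five indices, a third nonzero vector at [j4] absorbs the prescribed sum. *)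
have [card5|card5] := ltnP 4 #|{: I}|.
  have [j4 E4] := @idx_surj h c 4 card5.
  have /andP[n40 n41] : (j4 != o0) && (j4 != o1) by rewrite -idx_o E4.
  have n42 : j4 != j2 by apply/eqP => E; move: E4; rewrite E E2.
  have n43 : j4 != j3 by apply/eqP => E; move: E4; rewrite E E3.
  exists (fun i => (i == j2)%:R *: pp K q + (i == j3)%:R *: pp K q' +
           (i == j4)%:R *: (dr K (wd gr ord0) - pp K q - pp K q'), (j2, j3), (1, 1)).
  split=> /=.
  - rewrite ![o0 == _]eq_sym ![o1 == _]eq_sym (negPf n20) (negPf n21) (negPf n30).
    by rewrite (negPf n31) (negPf n40) (negPf n41) !scale0r !addr0.
  - rewrite !big_split /= !sum_delta addrCA -addrA; apply/ffunP => a; rewrite !ffunE; ring.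
  - by rewrite n20 n21 n30.
  - split; first exact: oner_neq0.
    by rewrite eqxx ![j2 == _]eq_sym (negPf n32) (negPf n42) !scale0r !addr0.
  - split; first exact: oner_neq0.
    by rewrite eqxx [j3 == j4]eq_sym (negPf n32) (negPf n43) !scale0r addr0 add0r.
(* Four indices leave only two nonzero vectors. Then V0 is a plane with just two evaluation vectors,
   [pa] and [pb], and their difference is the prescribed sum. *)
have [np r2] : preset = false /\ r = 2.
  have /orP[pr|np] := orbN preset.
    move: card5 card4 r_size gr; rewrite card_blocks (c_preset pr) pr /= => *.
    by exfalso; lia.
  by split; [exact: negbTE|move: card5 card4 r_size; rewrite (negbTE np) /=; lia].
pose va : 'I_r := Ordinal (r_gt1 : (1 < r)%N).
pose pa := dr K va; pose pb := dr K (wd gr ord0) + pa.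
have cases p : valid_pair g p -> pp K p = if p.1 == p.2 then pa else pb.
  case: p => a b; rewrite /valid_pair /pp /=.
  have le2 : (r <= 2)%N by rewrite r2.
  have lt2 (z : 'I_r) : (z < 2)%N := leq_trans (ltn_ord z) le2.
  have ea (z : 'I_r) : (0 < z)%N -> z = va.
    by move=> z0; apply/val_inj/eqP; rewrite /= eqn_leq z0 -ltnS lt2.
  have e0 (z : 'I_r) : (z <= 0)%N -> z = wd gr ord0.
    by rewrite leqn0 => /eqP z0; apply/val_inj.
  case: eqVneq => [<- /=|ab].
    by rewrite leqnn np -ltnNge => a0; congr (dr K _); exact: ea.
  rewrite andbT => leab; have ltab : (a < b)%N by rewrite ltn_neqAle leab andbT.
  have -> : b = va by apply: ea; apply: leq_ltn_trans ltab.
  have -> // : a = wd gr ord0.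
  by apply: e0; rewrite -ltnS; apply: leq_trans ltab _; rewrite -ltnS; exact: lt2.
pose B (i : I) := (i == j2)%:R *: (- pa) + (i == j3)%:R *: pb.
pose ji (p : 'I_r * 'I_r) := if p.1 == p.2 then j2 else j3.
pose ci (p : 'I_r * 'I_r) : K := if p.1 == p.2 then -1 else 1.
have Bji p : valid_pair g p -> ci p != 0 /\ B (ji p) = ci p *: pp K p.
  move=> vp; rewrite (cases p vp) /ci /ji /B; case: ifP => _; split.
  - by rewrite oppr_eq0 oner_neq0.
  - by rewrite eqxx [j2 == j3]eq_sym (negPf n32) scale0r addr0 scale1r scaleN1r.
  - exact: oner_neq0.
  - by rewrite eqxx (negPf n32) scale0r add0r !scale1r.
exists (B, (ji q, ji q'), (ci q, ci q')); split=> /=; try exact: Bji.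
- rewrite /B ![o0 == _]eq_sym ![o1 == _]eq_sym (negPf n20) (negPf n21) (negPf n30).
  by rewrite (negPf n31) !scale0r !addr0.
- by rewrite /B big_split /= !sum_delta addrC addrK.
- by rewrite /ji; do 2!case: ifP => _; rewrite ?n20 ?n21 ?n30 ?n31.
Qed.

Hypothesis enough : (uphalf #|free_set r xi| <= k)%N.

Lemma exists_config : exists (s : 'I_k -> X * ('I_r * 'I_r) * ('I_r * 'I_r))
    (y : 'I_k -> (I -> V0) * (I * I) * (K * K)),
  (forall j, realizes (y j) (s j).1.2 (s j).2) /\
  forall A, base_sing xi gr A -> (forall j, killed xi (s j) A) -> A = 0.
Proof.
have [im Him] := xi_missed.
have [s [ss sv sk]] := selection K gr Him.
(* The list is padded to length k with a valid pair, so that every plane receives a realizable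
   one. *)
pose d : X * ('I_r * 'I_r) * ('I_r * 'I_r) := (0, qa gr, qa gr).
have vd : valid_pair g (qa gr) := free_valid (qa_free xi gr o0).
have V (j : 'I_k) : valid_pair g (nth d s j).1.2 && valid_pair g (nth d s j).2.
  have [js|js] := ltnP j (size s); first exact: (sv _ (mem_nth d js)).
  by rewrite nth_default //= !vd.
have : forall j : 'I_k, exists y, realizes y (nth d s j).1.2 (nth d s j).2.
  by move=> j; have /andP[] := V j; exact: exists_realizes.
move/fin_all_exists => [y Hy]; exists (fun j => nth d s j), y; split=> // A bA kA.
apply: sk; first by split=> // u; rewrite setDv inE.
move=> t /(nthP d)[j js <-].
have jk : (j < k)%N by apply: leq_trans js _; rewrite ss.
exact: (kA (Ordinal jk)).
Qed.

(** Both ends of the line have the same weights at [o0] and [o1], the same sum of the first factors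
    at [o0] and [o1], and the same sum of the vectors b. These identities, on which [alpha0] and
    [alpha1] rest, therefore hold for all t. *)
Lemma star_config : exists (x : 'I_g.+1 + 'I_k * I -> X)
  (y : _ -> {ffun 'I_r + 'I_k * bool -> K^o}), rigid x y.
Proof.
have [s [y [Hy Hs]]] := exists_config.
pose e0 (j : 'I_k) i : X := if i == o0 then (s j).1.1 else
  if i == o1 then dl K o0 + (-1) *: (s j).1.1 else 0.
pose w0 (j : 'I_k) i : K := if i == o0 then -1 else if i == o1 then 0 else
  (i == (y j).1.2.1)%:R.
pose w0' (j : 'I_k) i : K := if i == o0 then 0 else if i == o1 then -1 else
  (i == (y j).1.2.2)%:R.
pose e (t : K) (j : 'I_k) i : X := (1 - t) *: e0 j i + t *: e1 K j i.
pose w (t : K) j i : K := (1 - t) * w0 j i + t * w1 K i.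
pose w' (t : K) j i : K := (1 - t) * w0' j i + t * w1' K i.
pose b (t : K) (j : 'I_k) i : V0 := (1 - t) *: (y j).1.1 i + t *: b1 K preset r_gt1 i.
pose cc t j i := w t j i * w' t j i.
have lerp_poly (a a' : K) : polyfun (fun t => (1 - t) * a + t * a').
  apply: polyfunD; apply: polyfunM; try exact: polyfun_cst; last exact: polyfun_id.
  by apply: polyfunD; [exact: polyfun_cst|apply: polyfunN; exact: polyfun_id].
have e_poly j i x : polyfun (fun t => e t j i x).
  by have [p Hp] := lerp_poly (e0 j i x) (e1 K j i x); exists p => t; rewrite -Hp !ffunE.
have b_poly j i a : polyfun (fun t => b t j i a).
  have [p Hp] := lerp_poly ((y j).1.1 i a) (b1 K preset r_gt1 i a).
  by exists p => t; rewrite -Hp !ffunE.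
have w_poly j i : polyfun (fun t => w t j i) by apply: lerp_poly.
have w'_poly j i : polyfun (fun t => w' t j i) by apply: lerp_poly.
have c_poly j i : polyfun (fun t => cc t j i) by apply: polyfunM.
have o10 : o1 == o0 = false by [].
have lerp1 (t a : K) : (1 - t) * a + t * a = a by rewrite -mulrDl subrK mul1r.
have lerpv (Y : finType) (t : K) (a : {ffun Y -> K^o}) : (1 - t) *: a + t *: a = a.
  by rewrite -scalerDl subrK scale1r.
have w_o0 t j : w t j o0 = -1 by rewrite /w /w0 /w1 eqxx lerp1.
have w_o1 t j : w t j o1 = 0 by rewrite /w /w0 /w1 o10 eqxx lerp1.
have w'_o0 t j : w' t j o0 = 0 by rewrite /w' /w0' /w1' eqxx lerp1.
have w'_o1 t j : w' t j o1 = -1 by rewrite /w' /w0' /w1' o10 eqxx lerp1.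
have e_sum t j : e t j o0 + e t j o1 = dl K o0.
  rewrite /e addrACA -!scalerDr e1_o /e0 eqxx o10 eqxx.
  by rewrite addrCA scaleN1r subrr addr0 lerpv.
have b_sum t j : \sum_i b t j i = dr K (wd gr ord0).
  rewrite /b big_split /= -!scaler_sumr b1_sum // v0_wd.
  by have [_ -> _ _ _] := Hy j; rewrite lerpv.
have b_o t j : b t j o0 = 0 /\ b t j o1 = 0.
  by have [[h0 h1] _ _ _ _] := Hy j; rewrite /b h0 h1 /b1 /= !scaler0 !addr0.
pose Z t (A : {ffun I * 'I_r * 'I_r -> K^o}) := forall j : 'I_k,
  \sum_i w t j i * tri A (e t j o0) (b t j i) (b t j i) = 0 /\
  \sum_i w' t j i * tri A (e t j o1) (b t j i) (b t j i) = 0.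
have Z_alg : algfam Z.
  apply: algfam_all => j; apply: algfam_and; apply: algfam_eq0; apply: polylin_sum => i;
    apply: polylinM => //; exact: polylin_tri.
apply: (combine (px := fun l => dl K (xi l)) (pv := fun l => dr K (wd gr l))
  e_poly c_poly w_poly w'_poly b_poly Z_alg).
- move=> N T sT [sp sy] j.
  (* For t = N+1 the value is t z or 1 + t (z - 1), a positive integer. *)
  have nz (z : nat) (d : bool) : (0 < z)%N -> (1 - N.+1%:R) * d%:R + N.+1%:R * z%:R != 0 :> K.
    case: d => z0 /=; last by rewrite mulr0 add0r -natrM pnatr_eq0 muln_eq0 -lt0n z0.
    rewrite mulr1; case: z z0 => // z _; rewrite -[z.+1]addn1 natrD mulrDr mulr1 addrCA.
    by rewrite subrK -natrM -[1]/(1%:R) -natrD pnatr_eq0 addn1.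
  have wn i : i != o0 -> i != o1 -> w N.+1%:R j i != 0.
    by move=> i0 i1; rewrite /w /w0 /w1 (negPf i0) (negPf i1); apply: (nz 1%N).
  have wn' i : i != o0 -> i != o1 -> w' N.+1%:R j i != 0.
    move=> i0 i1; rewrite /w' /w0' /w1' (negPf i0) (negPf i1); apply: nz.
    by apply: (@ltn_trans 1) => //; rewrite idx_o i0.
  have sP : singT T (e N.+1%:R j o0 + e N.+1%:R j o1) (emb k (\sum_i b N.+1%:R j i)).
    by rewrite e_sum b_sum; exact: (sp ord0).
  have [b0 b1'] := b_o N.+1%:R j.
  have := alpha0 sT b0 b1' (w_o0 _ j) (w'_o0 _ j) (w_o1 _ j) (w'_o1 _ j) wn wn' sP (sy j).
  have := alpha1 sT b0 b1' (w_o0 _ j) (w'_o0 _ j) (w_o1 _ j) (w'_o1 _ j) wn wn' sP (sy j).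
  move=> a1 a0; split; [rewrite -[RHS]a0|rewrite -[RHS]a1];
    by apply: eq_bigr => i _; rewrite tri_restr.
- move=> A sA sp ZA; apply: Hs => // j.
  have [[h0 h1] _ /and4P[n20 n21 n30 n31] [a2 E2] [a3 E3]] := Hy j.
  have [Z0 Z1] := ZA j.
  have e00 : e 0 j o0 = (s j).1.1 by rewrite /e subr0 scale1r scale0r addr0 /e0 eqxx.
  have e01 : e 0 j o1 = dl K o0 + (-1) *: (s j).1.1.
    by rewrite /e subr0 scale1r scale0r addr0 /e0 o10 eqxx.
  have b00 i : b 0 j i = (y j).1.1 i by rewrite /b subr0 scale1r scale0r addr0.
  have w00 i : w 0 j i = w0 j i by rewrite /w subr0 mul1r mul0r addr0.
  have w00' i : w' 0 j i = w0' j i by rewrite /w' subr0 mul1r mul0r addr0.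
  have sq (a d : K) : a != 0 -> a * (a * d) = 0 -> d = 0.
    by move=> an /eqP; rewrite !mulf_eq0 (negPf an) => /eqP.
  split.
    (* At t = 0 a single index contributes to the sum: the weights vanish elsewhere except at [o0],
       where the vector b is zero. *)
    apply: (sq _ _ a2); rewrite -triZm -triZr -E2 -[RHS]Z0.
    rewrite (bigD1 (y j).1.2.1) //= big1 ?addr0 => [|i ne].
      by rewrite w00 b00 e00 /w0 (negPf n20) (negPf n21) eqxx mul1r.
    rewrite w00 b00 /w0; case: eqVneq => [->|_]; first by rewrite h0 tri0m mulr0.
    by case: eqVneq => [->|_]; rewrite ?(negPf ne) mul0r.
  apply: (sq _ _ a3); rewrite -triZm -triZr -E3 -[RHS]Z1.
  rewrite (bigD1 (y j).1.2.2) //= big1 ?addr0 => [|i ne].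
    by rewrite w00' b00 e01 /w0' (negPf n30) (negPf n31) eqxx mul1r.
  rewrite w00' b00 /w0'; case: eqVneq => [->|_]; first by rewrite mul0r.
  by case: eqVneq => [->|_]; rewrite ?h1 ?tri0m ?mulr0 // (negPf ne) mul0r.
move=> T sT rT [sp sy].
have e1E j i : e 1 j i = e1 K j i by rewrite /e subrr scale0r add0r scale1r.
have b1E j i : b 1 j i = b1 K preset r_gt1 i by rewrite /b subrr scale0r add0r scale1r.
have w1E j i : w 1 j i = w1 K i by rewrite /w subrr mul0r add0r mul1r.
have w1E' j i : w' 1 j i = w1' K i by rewrite /w' subrr mul0r add0r mul1r.
apply: (residual_eq0 sT rT (o0 := o0) (o1 := o1) _ _ (w_o0 1) (w'_o0 1) (w_o1 1) (w'_o1 1)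
  _ sp sy).
- by move=> j; rewrite /cc w'_o0 mulr0.
- by move=> j; rewrite /cc w_o1 mul0r.
- by move=> j i i' ii'; rewrite !w1E !w1E'; exact: w1_det.
- by move=> j F H; apply: (@e1_basis K h c j) => l; rewrite -[RHS](H l) -e1E.
- move=> j l f Hb Hp; apply: (b1_span r_size (r_gt1 := r_gt1)) => [i i0 i1|pr].
    rewrite -[RHS](Hb i); last first.
      rewrite /cc w1E w1E' /w1 /w1' (negPf i0) (negPf i1) mul1r pnatr_eq0 -lt0n.
      by apply: (@ltn_trans 1) => //; rewrite idx_o i0.
    by apply: eq_bigr => a _; rewrite b1E.
  have gE : (g = h.+1)%N by rewrite pr.
  (* Each l needs a point of V0 whose first factor combines [e 1 j l], with nonzero coefficient, and
     its partner in the pair: the point at (p, false) for p > 0, the point at [o1] for the pair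
     0. *)
  have pick (z : nat) (l' : I) (a a' : K) : (0 < z <= h.+1)%N -> l != l' -> a != 0 ->
      (if z == h.+1 then dl K o1 else dl K (inl (inord z, false) : I)) =
        a *: e 1 j l + a' *: e 1 j l' ->
      exists2 u : 'I_r, (0 < u)%N & f u = 0.
    move=> /andP[z0 zh] ll' a0 E; have zg : (z < g.+1)%N by rewrite gE.
    exists (wd gr (Ordinal zg)) => //.
    have Ex : dl K (xi (Ordinal zg)) = a *: e 1 j l + a' *: e 1 j l'.
      by rewrite -E /xi /= (gtn_eqF z0); case: ifP.
    have := Hp _ _ _ _ ll' a0 Ex; rewrite (bigD1 (wd gr (Ordinal zg))) //=.
    rewrite big1 ?addr0 => [|u /negPf ne]; first by rewrite ffunE eqxx mulr1.
    by rewrite ffunE ne mulr0.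
  have tn0 : tj K j != 0 by rewrite pnatr_eq0.
  have tn1 : 1 - tj K j != 0 by rewrite subr_eq0 -[1]/(1%:R) eqr_nat.
  clear Hp Hb; case: l pick => [[p z]|[q ?]]; last by have := ltn_ord q; rewrite {2}(c_preset pr).
  move=> pick; have [p0|p0] := eqVneq p ord0.
    have E1 : dl K o1 = (1 - tj K j) *: e1 K j o0 + (- tj K j) *: e1 K j o1.
      by apply/ffunP => x; rewrite /e1 !ffunE /GRing.scale /=; ring.
    have hh : (0 < h.+1 <= h.+1)%N by rewrite ltnSn.
    subst p; case: z pick => pick.
      apply: (pick h.+1 o0 (- tj K j) (1 - tj K j)) => //; first by rewrite oppr_eq0.
      by rewrite eqxx !e1E E1 addrC.
    apply: (pick h.+1 o1 (1 - tj K j) (- tj K j)) => //.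
    by rewrite eqxx !e1E E1.
  have E1 : dl K (inl (p, false) : I) =
      1 *: e1 K j (inl (p, false)) + 1 *: e1 K j (inl (p, true)).
    by apply/ffunP => x; rewrite /e1 !ffunE /GRing.scale /=; ring.
  have ph : (0 < p <= h.+1)%N by rewrite lt0n (ltnW (ltn_ord p)) andbT.
  have pE : ((p : nat) == h.+1) = false by rewrite ltn_eqF.
  case: z pick => pick.
    apply: (pick p (inl (p, false)) 1 1) => //; rewrite ?oner_neq0 //.
      by apply/eqP => -[].
    by rewrite pE inord_val !e1E E1 addrC.
  apply: (pick p (inl (p, true)) 1 1) => //; rewrite ?oner_neq0 //.
    by apply/eqP => -[].
  by rewrite pE inord_val !e1E E1.
- move=> j j' jj' D HL HR; apply: (@e1_cross K h c j j' D jj').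
    by move=> i z; rewrite -[RHS](HL i z) -(w1E j) -(w1E' j) -e1E.
  by move=> i z; rewrite -[RHS](HR i z) -(w1E j') -(w1E' j') -e1E.
Qed.

End StarConfig.

(** * The configuration for m = 3 and n even *)

Section Four.
Variables (K : numFieldType) (k : nat).
Hypothesis k_gt2 : (2 < k)%N.
Local Notation I := (bool * bool)%type.
Local Notation X := {ffun I -> K^o}.
Local Notation V0 := {ffun 'I_3 -> K^o}.

Definition q0 : I := (false, false).
Definition q1 : I := (false, true).
Definition q2 : I := (true, false).
Definition q3 : I := (true, true).
Definition a0 : 'I_3 := Ordinal (isT : (0 < 3)%N).
Definition a1 : 'I_3 := Ordinal (isT : (1 < 3)%N).
Definition a2 : 'I_3 := Ordinal (isT : (2 < 3)%N).

Definition node (l : 'I_3) : I :=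
  match l : nat with 0 => q0 | 1 => q1 | _ => q2 end.

Definition by_index (T : Type) (x0 x1 x2 x3 : T) (i : I) : T :=
  match i with
  | (false, false) => x0 | (false, true) => x1
  | (true, false) => x2 | (true, true) => x3
  end.

(* Neighbours on the path q3 - q0 - q1 - q2 add up to the first factors of the three
   double points of [V0]. *)
Definition e4 (f : X) : I -> X :=
  by_index f (dl K q2 + (-1) *: f) (dl K q1 + (-1) *: dl K q2 + f)
    (dl K q0 + (-1) *: f).

Definition b4 : I -> V0 :=
  by_index 0 0 (dr K a0 + dr K a2) (dr K a1 + dr K a2).

Definition c4 : I -> K := by_index 0 0 1 1.
Definition w4 (mu : K) : I -> K := by_index (-1) 0 1 mu.
Definition w4' (mu ga : K) : I -> K := by_index 0 (-1) mu ga.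

Definition lin (F : I -> K) (x : X) : K := \sum_i F i * x i.

Lemma linD F x y : lin F (x + y) = lin F x + lin F y.
Proof. by rewrite -big_split; apply: eq_bigr => i _; rewrite ffunE mulrDr. Qed.

Lemma linZ F a x : lin F (a *: x) = a * lin F x.
Proof. by rewrite mulr_sumr; apply: eq_bigr => i _; rewrite ffunE mulrCA. Qed.

Lemma lin_dl F i : lin F (dl K i) = F i.
Proof.
rewrite /lin (bigD1 i) //= big1 => [|v ne]; first by rewrite ffunE eqxx mulr1 addr0.
by rewrite ffunE (negPf ne) mulr0.
Qed.

Lemma w4_det (mu ga : K) i i' : mu != 0 -> ga != 0 -> ga != mu * mu -> i != i' ->
  w4 mu i * w4' mu ga i' - w4 mu i' * w4' mu ga i != 0.
Proof.
move=> m0 g0 gm; have gm' : ga - mu * mu != 0 by rewrite subr_eq0.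
have gm2 : mu * mu - ga != 0 by rewrite subr_eq0 eq_sym.
by case: i => [[] []]; case: i' => [[] []] //= _;
  rewrite ?(mulr0, mul0r, mulrN1, mulN1r, mulr1, mul1r, subr0, sub0r, opprK, oppr_eq0, oner_neq0).
Qed.

Section AlphaFour.
Local Notation J := ('I_3 + 'I_k * bool)%type.
Variables (T : {ffun I * J * J -> K^o}) (j : 'I_k) (f : X) (mu ga : K).
Local Notation e := (e4 f).
Local Notation u0 := (uv K 3 j false).
Local Notation u1 := (uv K 3 j true).
Local Notation v a := (emb k (dr K a)).
Hypotheses (sT : symT T)
  (sp : forall l, singT T (dl K (node l)) (v l))
  (sy : forall i, singT T (e i) (pt j (c4 i) (w4 mu i) (w4' mu ga i) (b4 i))).

Lemma four_u0 : singT T (e q0) u0.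
Proof. by move: (sy q0); rewrite /pt /= oppr0 opprK !scale0r addr0 scale1r add0r. Qed.

Lemma four_u1 : singT T (e q1) u1.
Proof. by move: (sy q1); rewrite /pt /= oppr0 opprK !scale0r !add0r scale1r. Qed.

Lemma four_alpha0 :
  ga * tri T (e q0) (v a0) (v a2) =
  mu * (tri T (e q0) (v a0) (v a1) + tri T (e q0) (v a0) (v a2)).
Proof.
have [h0 h00] := four_u0; have [h1 h11] := four_u1.
have E2 : tri T (e q0) (v a2) u1 = 0.
  have -> : e q0 = dl K q2 + (-1) *: e q1 by rewrite /e4 /= scalerDr !scaleN1r opprK addNKr.
  rewrite triDl triZl (triC (e q1) (v a2) u1 sT) h1 mulr0 addr0.
  by have [-> _] := sp a2.
have E3 : tri T (e q0) (v a0) (v a1) + tri T (e q0) (v a0) (v a2) =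
    ga * tri T (e q0) (v a0) u1.
  have E : e q0 = dl K q0 + (-1) *: e q3.
    by rewrite /e4 /= scalerDr !scaleN1r opprK addNKr.
  have [y3 _] := sy q3; have [x0 _] := sp a0.
  have : tri T (e q0) (v a0) (pt j (c4 q3) (w4 mu q3) (w4' mu ga q3) (b4 q3)) = 0.
    rewrite {1}E triDl triZl (triC (e q3) (v a0) (pt _ _ _ _ _) sT) y3 mulr0 addr0.
    exact: x0.
  rewrite /pt tri_comb3r (triC (e q0) (v a0) u0 sT) h0 /= mulr0 addr0 mul1r mulNr.
  by rewrite embD triDr => /eqP; rewrite subr_eq0 => /eqP.
have [_ /(_ (e q0))] := sy q2; rewrite /pt tri_quad3 //.
rewrite (triC (e q0) (emb k (b4 q2)) u0 sT) !h0 h11 /= embD !triDm !triDr E2.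
have [_ ->] := sp a0; have [_ ->] := sp a2; rewrite (triC (e q0) (v a2) (v a0) sT).
set A02 := tri _ _ (v a0) (v a2) in E3 *; set A01 := tri _ _ _ (v a1) in E3 *.
set d := tri _ _ _ u1 in E3 * => H.
have H2 : A02 = mu * d.
  apply: (mulfI (_ : (2%:R : K) != 0)); first by rewrite pnatr_eq0.
  by apply/eqP; rewrite -subr_eq0; apply/eqP; rewrite -[RHS]H; ring.
by rewrite E3 H2; ring.
Qed.

Lemma four_alpha1 :
  tri T (e q1) (v a1) (v a2) =
  mu * (tri T (e q1) (v a1) (v a0) + tri T (e q1) (v a1) (v a2)).
Proof.
have [h0 h00] := four_u0; have [h1 h11] := four_u1.
have E2 : tri T (e q1) (v a2) u0 = 0.
  have -> : e q1 = dl K q2 + (-1) *: e q0 by [].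
  rewrite triDl triZl (triC (e q0) (v a2) u0 sT) h0 mulr0 addr0.
  by have [-> _] := sp a2.
have E3 : tri T (e q1) (v a1) (v a0) + tri T (e q1) (v a1) (v a2) =
    tri T (e q1) (v a1) u0.
  have E : e q1 = dl K q1 + (-1) *: e q2.
    by apply/ffunP => i; rewrite !ffunE /GRing.scale /=; ring.
  have [y3 _] := sy q2; have [x0 _] := sp a1.
  have : tri T (e q1) (v a1) (pt j (c4 q2) (w4 mu q2) (w4' mu ga q2) (b4 q2)) = 0.
    rewrite {1}E triDl triZl (triC (e q2) (v a1) (pt _ _ _ _ _) sT) y3 mulr0 addr0.
    exact: x0.
  rewrite /pt tri_comb3r (triC (e q1) (v a1) u1 sT) h1 /= mulr0 addr0 mul1r mulN1r.
  by rewrite embD triDr => /eqP; rewrite subr_eq0 => /eqP.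
have [_ /(_ (e q1))] := sy q3; rewrite /pt tri_quad3 //.
rewrite (triC (e q1) (emb k (b4 q3)) u1 sT) (triC (e q1) u0 u1 sT) !h1 h00 /= embD !triDm !triDr E2.
have [_ ->] := sp a1; have [_ ->] := sp a2; rewrite (triC (e q1) (v a2) (v a1) sT).
set A02 := tri _ _ (v a1) (v a2) in E3 *; set A01 := tri _ _ _ (v a0) in E3 *.
set d := tri _ _ _ u0 in E3 * => H.
have H2 : A02 = mu * d.
  apply: (mulfI (_ : (2%:R : K) != 0)); first by rewrite pnatr_eq0.
  by apply/eqP; rewrite -subr_eq0; apply/eqP; rewrite -[RHS]H; ring.
by rewrite E3 -H2.
Qed.

End AlphaFour.

Definition f1 (j : nat) : X := dl K q3 + j%:R *: (dl K q0 + dl K q1).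

Lemma e4_lin F f : (forall l, lin F (e4 f l) = 0) ->
  [/\ F q0 = 0, F q1 = 0, F q2 = 0 & lin F f = 0].
Proof.
move=> H; have f0 : lin F f = 0 := H q0.
have E2 : F q2 = 0 by have := H q1; rewrite /= linD linZ f0 mulr0 addr0 lin_dl.
have E1 : F q1 = 0.
  by have := H q2; rewrite /= !linD linZ !lin_dl f0 E2 mulr0 !addr0.
by split=> //; have := H q3; rewrite /= linD linZ f0 mulr0 addr0 lin_dl.
Qed.

Lemma e4_basis j F : (forall l, lin F (e4 (f1 j) l) = 0) -> forall i, F i = 0.
Proof.
move/e4_lin => [F0 F1 F2]; rewrite /f1 linD linZ linD !lin_dl F0 F1 addr0 mulr0 addr0 => F3.
by case=> [[] []].
Qed.

(** The index j enters [e4 (f1 j) i] only through a multiple of the sum Z of the values at [q0] and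
    [q1]. Contracting the equations of index i for j and j' with each other's points cancels the
    rest and leaves (j - j') Z = 0 at the points of index i; the four indices force Z = 0. Then only
    the E i remain, and their sum is Z. *)
Lemma e4_cross (j j' : nat) (D : I -> bool -> bool -> K) : j != j' ->
  (forall i s, lin (fun x => w4 1 i * D x false s + w4' 1 j.+2%:R i * D x true s)
     (e4 (f1 j) i) = 0) ->
  (forall i s, lin (fun x => w4 1 i * D x s false + w4' 1 j'.+2%:R i * D x s true)
     (e4 (f1 j') i) = 0) ->
  forall x s s', D x s s' = 0.
Proof.
move=> jj' HL HR.
pose Z s s' := D q0 s s' + D q1 s s'.
pose E i s s' := by_index (D q3 s s') (D q2 s s' - D q3 s s')
  (D q1 s s' - D q2 s s' + D q3 s s') (D q0 s s' - D q3 s s') i.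
pose sg : I -> K := by_index 1 (-1) 1 (-1).
have EL t F i : lin F (e4 (f1 t) i) =
    by_index (F q3) (F q2 - F q3) (F q1 - F q2 + F q3) (F q0 - F q3) i +
    sg i * t%:R * (F q0 + F q1).
  by case: i => [[] []]; rewrite /= /f1 ?(linD, linZ, lin_dl) /sg /=; ring.
pose c : K := j.+2%:R; pose c' : K := j'.+2%:R.
have cc' : c - c' != 0 by rewrite subr_eq0 eqr_nat.
have tt' : j%:R - j'%:R != 0 :> K by rewrite subr_eq0 eqr_nat.
have HL' i s : w4 1 i * E i false s + w4' 1 c i * E i true s +
    sg i * j%:R * (w4 1 i * Z false s + w4' 1 c i * Z true s) = 0.
  rewrite -[RHS](HL i s) EL /E /Z; case: (i) => [[] []] /=; ring.
have HR' i s : w4 1 i * E i s false + w4' 1 c' i * E i s true +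
    sg i * j'%:R * (w4 1 i * Z s false + w4' 1 c' i * Z s true) = 0.
  rewrite -[RHS](HR i s) EL /E /Z; case: (i) => [[] []] /=; ring.
have lin0 (a x : K) : a != 0 -> a * x = 0 -> x = 0.
  by move=> an /eqP; rewrite mulf_eq0 (negPf an) => /eqP.
have Zff : Z false false = 0.
  apply: (lin0 _ _ tt').
  transitivity ((-1) * (-1 * E q0 false false + 0 * E q0 true false +
     1 * j%:R * (-1 * Z false false + 0 * Z true false)) +
     (-1 * E q0 false false + 0 * E q0 false true +
     1 * j'%:R * (-1 * Z false false + 0 * Z false true))); first by ring.
  by rewrite (HL' q0 false) (HR' q0 false) mulr0 addr0.
have Ztt : Z true true = 0.
  apply: (lin0 _ _ tt').
  transitivity ((0 * E q1 false true + -1 * E q1 true true +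
     -1 * j%:R * (0 * Z false true + -1 * Z true true)) -
     (0 * E q1 true false + -1 * E q1 true true +
     -1 * j'%:R * (0 * Z true false + -1 * Z true true))); first by ring.
  by rewrite (HL' q1 true) (HR' q1 true) subr0.
have Zs : Z false true + Z true false = 0.
  apply: (lin0 _ _ tt').
  transitivity ((1 * E q2 false false + 1 * E q2 true false +
      1 * j%:R * (1 * Z false false + 1 * Z true false)) +
     (1 * E q2 false true + 1 * E q2 true true +
      1 * j%:R * (1 * Z false true + 1 * Z true true)) -
     (1 * E q2 false false + 1 * E q2 false true +
      1 * j'%:R * (1 * Z false false + 1 * Z false true)) -
     (1 * E q2 true false + 1 * E q2 true true +
      1 * j'%:R * (1 * Z true false + 1 * Z true true))); first by rewrite Zff Ztt; ring.
  by rewrite (HL' q2 false) (HL' q2 true) (HR' q2 false) (HR' q2 true) addr0 !subr0.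
have Zc : c' * Z false true + c * Z true false = 0.
  apply: (lin0 _ _ tt').
  transitivity (- (1 * E q3 false false + c * E q3 true false +
      -1 * j%:R * (1 * Z false false + c * Z true false)) -
     c' * (1 * E q3 false true + c * E q3 true true +
      -1 * j%:R * (1 * Z false true + c * Z true true)) +
     (1 * E q3 false false + c' * E q3 false true +
      -1 * j'%:R * (1 * Z false false + c' * Z false true)) +
     c * (1 * E q3 true false + c' * E q3 true true +
      -1 * j'%:R * (1 * Z true false + c' * Z true true))); first by rewrite Zff Ztt; ring.
  by rewrite (HL' q3 false) (HL' q3 true) (HR' q3 false) (HR' q3 true)
    !(mulr0, oppr0, subr0, addr0, add0r).
have Ztf : Z true false = 0.
  apply: (lin0 _ _ cc').
  transitivity (c' * Z false true + c * Z true false - c' * (Z false true + Z true false)).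
    by ring.
  by rewrite Zs Zc mulr0 subr0.
have Zft : Z false true = 0 by move: Zs; rewrite Ztf addr0.
have Z0 s s' : Z s s' = 0 by case: s; case: s'.
have L i s : w4 1 i * E i false s + w4' 1 c i * E i true s = 0.
  by have := HL' i s; rewrite !Z0 !mulr0 !addr0 mulr0 addr0.
have R i s : w4 1 i * E i s false + w4' 1 c' i * E i s true = 0.
  by have := HR' i s; rewrite !Z0 !mulr0 !addr0 mulr0 addr0.
have E0f s : E q0 false s = 0.
  by have := L q0 s; rewrite /= mul0r addr0 mulN1r => /eqP; rewrite oppr_eq0 => /eqP.
have E0tf : E q0 true false = 0.
  by have := R q0 true; rewrite /= mul0r addr0 mulN1r => /eqP; rewrite oppr_eq0 => /eqP.
have E1t s : E q1 true s = 0.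
  by have := L q1 s; rewrite /= mul0r add0r mulN1r => /eqP; rewrite oppr_eq0 => /eqP.
have E1ft : E q1 false true = 0.
  by have := R q1 false; rewrite /= mul0r add0r mulN1r => /eqP; rewrite oppr_eq0 => /eqP.
have SE s s' : E q0 s s' + E q1 s s' + E q2 s s' + E q3 s s' = 0.
  by rewrite -[RHS](Z0 s s') /E /Z /=; ring.
have := SE true false; rewrite E0tf E1t !add0r => S1.
have := SE false true; rewrite E0f E1ft !add0r => S2.
have L2 s : 1 * E q2 false s + 1 * E q2 true s = 0 := L q2 s.
have R2 s : 1 * E q2 s false + 1 * E q2 s true = 0 := R q2 s.
have L3 s : 1 * E q3 false s + c * E q3 true s = 0 := L q3 s.
have R3 s : 1 * E q3 s false + c' * E q3 s true = 0 := R q3 s.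
have E3tt : E q3 true true = 0.
  apply: (lin0 _ _ cc').
  transitivity ((1 * E q3 false true + c * E q3 true true) -
    (1 * E q3 true false + c' * E q3 true true) +
    (E q2 true false + E q3 true false) - (E q2 false true + E q3 false true) +
    (1 * E q2 false true + 1 * E q2 true true) -
    (1 * E q2 true false + 1 * E q2 true true)); first by ring.
  by rewrite L3 R3 S1 S2 L2 R2 !(addr0, subr0).
have E3 s s' : E q3 s s' = 0.
  have ft : E q3 false true = 0 by have := L3 true; rewrite E3tt mulr0 addr0 mul1r.
  have tf : E q3 true false = 0 by have := R3 true; rewrite E3tt mulr0 addr0 mul1r.
  by case: s; case: s' => //; have := L3 false; rewrite tf mulr0 addr0 mul1r.
have E2 s s' : E q2 s s' = 0.
  have ft : E q2 false true = 0 by move: S2; rewrite E3 addr0.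
  have tf : E q2 true false = 0 by move: S1; rewrite E3 addr0.
  case: s; case: s' => //; first by have := L2 true; rewrite ft !mul1r add0r.
  by have := L2 false; rewrite tf !mul1r addr0.
have E0 s s' : E q0 s s' = 0.
  by case: s; case: s' => //; have := SE true true; rewrite E1t E2 E3 !addr0.
have E1 s s' : E q1 s s' = 0.
  by have := SE s s'; rewrite E0 E2 E3 add0r !addr0.
move=> x s s'.
have := E0 s s'; have := E1 s s'; have := E2 s s'; have := E3 s s'; rewrite /E /=.
move=> A3 A2 A1 A0.
have {}A1 : D q2 s s' = 0 by move: A1; rewrite A0 subr0.
have {}A2 : D q1 s s' = 0 by move: A2; rewrite A0 A1 subr0 addr0.
have {}A3 : D q0 s s' = 0 by move: A3; rewrite A0 subr0.
by case: x => [[] []].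
Qed.

Lemma four_config : exists (x : 'I_3 + 'I_k * I -> X)
  (y : _ -> {ffun 'I_3 + 'I_k * bool -> K^o}), rigid x y.
Proof.
(* At t = 0 three planes kill the six free coordinates on V0: with mu = 0 (planes 0 and 1) the
   conditions concern the entries (0,2) and (1,2), with mu = ga = 1 they are left with the entry
   (0,1). *)
pose f0 (j : 'I_k) : X := if j == 0%N :> nat then dl K q0 + dl K q1 else dl K q3.
pose f (t : K) (j : 'I_k) : X := (1 - t) *: f0 j + t *: f1 j.
pose mu (t : K) (j : 'I_k) : K := (1 - t) * (1 < j)%:R + t.
pose ga (t : K) (j : 'I_k) : K := (1 - t) + t * j.+2%:R.
have cf := @polyfun_cst K; have tf := @polyfun_id K.
have sf : polyfun (fun t : K => 1 - t).
  by apply: polyfunD; [exact: cf|apply: polyfunN].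
have mu_poly j : polyfun (mu ^~ j).
  by apply: polyfunD => //; apply: polyfunM.
have ga_poly j : polyfun (ga ^~ j).
  by apply: polyfunD => //; apply: polyfunM.
have f_poly j x : polyfun (fun t => f t j x).
  have : polyfun (fun t => (1 - t) * f0 j x + t * f1 j x).
    by apply: polyfunD; apply: polyfunM.
  by case=> p Hp; exists p => t; rewrite -Hp !ffunE.
have e_poly j i x : polyfun (fun t => e4 (f t j) i x).
  have lc (a : K) c : polyfun (fun t => a + c * f t j x).
    by apply: polyfunD => //; apply: polyfunM.
  have := lc 0 1; have := lc (dl K q2 x) (-1); have := lc (dl K q0 x) (-1).
  have := lc (dl K q1 x - dl K q2 x) 1.
  move=> [p2 H2] [p3 H3] [p1 H1] [p0 H0]; exists (by_index p0 p1 p2 p3 i) => t.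
  case: i => [[] []] /=; rewrite -?(H0, H1, H2, H3) 1?ffunE [in LHS]/GRing.scale
    /= !ffunE /GRing.scale /=; ring.
have w_poly (j : 'I_k) i : polyfun (fun t => w4 (mu t j) i).
  by case: i => [[] []] /=.
have w'_poly (j : 'I_k) i : polyfun (fun t => w4' (mu t j) (ga t j) i).
  by case: i => [[] []] /=.
pose Z t (A : {ffun I * 'I_3 * 'I_3 -> K^o}) := forall j : 'I_k,
  ga t j * tri A (e4 (f t j) q0) (dr K a0) (dr K a2) + - (mu t j *
    (tri A (e4 (f t j) q0) (dr K a0) (dr K a1) + tri A (e4 (f t j) q0) (dr K a0) (dr K a2))) = 0 /\
  tri A (e4 (f t j) q1) (dr K a1) (dr K a2) + - (mu t j *
    (tri A (e4 (f t j) q1) (dr K a1) (dr K a0) + tri A (e4 (f t j) q1) (dr K a1) (dr K a2))) = 0.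
have Z_alg : algfam Z.
  have pt j i a b : polylin (fun t A => tri A (e4 (f t j) i) (dr K a : V0) (dr K b)).
    by apply: polylin_tri => // ?; exact: polyfun_cst.
  apply: algfam_all => j; apply: algfam_and; apply: algfam_eq0; apply: polylinD;
    try (by apply: polylinM); try exact: pt;
    by apply: polylinN; apply: polylinM => //; apply: polylinD.
apply: (combine (px := fun l => dl K (node l)) (pv := fun l => dr K l)
  (b := fun _ _ => b4) (c := fun _ _ => c4) e_poly _ w_poly w'_poly _ Z_alg) => //.
- move=> N T sT [sp sy] j; have a0' := four_alpha0 sT sp (sy j).
  have a1' := four_alpha1 sT sp (sy j).
  by rewrite !tri_restr; split; apply/eqP; rewrite subr_eq0; apply/eqP; [exact: a0'|exact: a1'].
- move=> A sA sp ZA.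
  have Z0 (j : nat) (jk : (j < k)%N) := ZA (Ordinal jk).
  have [/= Z00 Z01] := Z0 0%N (ltn_trans (isT : (0 < 2)%N) k_gt2).
  have [/= Z10 Z11] := Z0 1%N (ltn_trans (isT : (1 < 2)%N) k_gt2).
  have [/= Z20 Z21] := Z0 2%N k_gt2.
  move: Z00 Z01 Z10 Z11 Z20 Z21; rewrite /mu /ga /f /f0 /= !subr0 !scale1r !scale0r.
  rewrite !(mul0r, mulr0, mul1r, mulr1, addr0, subr0) !(triDl, triZl) !tri_basis.
  have [p00 p01] := sp a0; have [p10 p11] := sp a1; have [p20 p21] := sp a2.
  have P i l : A (i, l, l) = 0 by have [_ /(_ (dl K i))] := sp l; rewrite tri_basis.
  have Q l a : A (node l, l, a) = 0 by have [/(_ (dr K a))] := sp l; rewrite tri_basis.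
  have Q' l a : A (node l, a, l) = 0 by rewrite sA Q.
  have := Q a0; have := Q a1; have := Q a2; rewrite /node /= => Q2 Q1 Q0.
  have B2 : A (q2, a1, a2) = 0 := Q' a2 a1.
  rewrite ?(Q0, Q1, Q2) B2 !(add0r, addr0, mulN1r) => B1 /eqP; rewrite oppr_eq0 => /eqP B0 B3.
  move=> /eqP; rewrite oppr_eq0 => /eqP B3'; rewrite B3 B3' addr0 sub0r => /eqP.
  rewrite oppr_eq0 => /eqP C3; rewrite oppr0 addr0 (sA q2) (sA q3) C3 oppr0 addr0 sub0r => /eqP.
  rewrite oppr_eq0 => /eqP C2.
  have up i (a b : 'I_3) : (a < b)%N -> A (i, a, b) = 0.
    have inj (l l' : 'I_3) : l = l' :> nat -> l = l' by exact: val_inj.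
    move=> ab; have [|] := eqVneq (b : nat) 1%N => b1.
      have [-> ->] : a = a0 /\ b = a1 by split; apply: inj => //=; lia.
      by case: i => [[] []] //; exact: (Q a1 a0) || exact: Q0 || rewrite sA Q1.
    have -> : b = a2 by apply: inj; have := ltn_ord b; rewrite /=; lia.
    have [|] := eqVneq (a : nat) 0%N => a0E.
      by have -> : a = a0 by [exact: inj]; case: i => [[] []] //; exact: (Q' a2).
    have -> : a = a1 by apply: inj; have := ltn_ord b; rewrite /=; lia.
    by case: i => [[] []].
  apply/ffunP => -[[i a] b]; rewrite ffunE.
  by case: (ltngtP a b) => [/up //|/up H|/val_inj ->]; rewrite ?P // sA.
move=> T sT rT [sp sy].
have fE j : f 1 j = f1 j by rewrite /f subrr scale0r add0r scale1r.
have muE j : mu 1 j = 1 by rewrite /mu subrr mul0r add0r.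
have gaE j : ga 1 j = j.+2%:R by rewrite /ga subrr add0r mul1r.
apply: (residual_eq0 sT rT (o0 := q0) (o1 := q1) _ _ _ _ _ _ _ sp sy) => //.
- move=> j i i' ii'; rewrite muE gaE; apply: w4_det => //; rewrite ?oner_neq0 ?pnatr_eq0 //.
  by rewrite mulr1 -[1]/(1%:R) eqr_nat.
- by move=> j F H; apply: (@e4_basis j) => l; rewrite -[RHS](H l) fE.
- move=> j l F Hb Hp.
  have F1 (a : 'I_3) : \sum_a' F a' * dr K a a' = F a.
    rewrite (bigD1 a) //= big1 ?addr0 => [|u /negPf ne]; first by rewrite ffunE eqxx mulr1.
    by rewrite ffunE ne mulr0.
  have F2 (a b : 'I_3) : \sum_a' F a' * (dr K a + dr K b) a' = F a + F b.
    by rewrite -!F1 -big_split; apply: eq_bigr => u _; rewrite ffunE mulrDr.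
  have S0 : F a0 + F a2 = 0 by rewrite -F2; apply: (Hb q2); rewrite oner_neq0.
  have S1 : F a1 + F a2 = 0 by rewrite -F2; apply: (Hb q3); rewrite oner_neq0.
  have pick (g : 'I_3) l' : l != l' -> dl K (node g) = e4 (f 1 j) l + e4 (f 1 j) l' ->
      F g = 0.
    move=> ll' E; rewrite -F1; apply: (Hp g l' 1 1) => //; rewrite ?oner_neq0 //.
    by rewrite !scale1r.
  have E0 : dl K q0 = e4 (f 1 j) q0 + e4 (f 1 j) q3.
    by rewrite /e4 /= scaleN1r addrC subrK.
  have E1 : dl K q1 = e4 (f 1 j) q1 + e4 (f 1 j) q2.
    by apply/ffunP => x; rewrite /e4 /= !ffunE /GRing.scale /=; ring.
  suff H01 : F a0 = 0 \/ F a1 = 0.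
    have F20 : F a2 = 0 by case: H01 => H0; [move: S0|move: S1]; rewrite H0 add0r.
    move=> a; move: S0 S1; rewrite F20 !addr0 => F00 F10.
    case: a => [[|[|[|//]]] ia]; [rewrite -[RHS]F00|rewrite -[RHS]F10|rewrite -[RHS]F20];
      by congr (F _); apply: val_inj.
  clear Hb Hp; case: l pick => [[] []] pick.
  + by left; apply: (pick a0 q0) => //; rewrite addrC.
  + by right; apply: (pick a1 q1) => //; rewrite addrC.
  + by right; apply: (pick a1 q2).
  + by left; apply: (pick a0 q3).
- move=> j j' jj' D HL HR; apply: (@e4_cross j j' D jj').
    by move=> i z; rewrite -[RHS](HL i z) fE muE gaE; apply: eq_bigr => x _; rewrite mulrC.
  by move=> i z; rewrite -[RHS](HR i z) fE muE gaE; apply: eq_bigr => x _; rewrite mulrC.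
Qed.

End Four.

(** * Numerical conditions *)

Lemma cubic_bound m n :
  Num.ceil (((m%:R ^+ 3 - 2 * m%:R - 5) / 2) : rat) <= n%:Z ->
  (m ^ 3 <= n.*2 + m.*2 + 5)%N.
Proof.
rewrite ceil_le_int ler_pdivrMr ?ltr0n // => H.
rewrite -(ler_nat rat) !natrD natrX -!muln2 !natrM.
move: H; rewrite -pmulrn; lra.
Qed.

(** The parity assumption makes the floor in [sbar] exact. *)
Lemma sbar_double m n : (m <= n + 2)%N -> (odd m \/ ~~ odd n) ->
  ((sbar m n).*2 = m.+1 * (n + 2 - m) + 2)%N.
Proof.
move=> mn par; rewrite /sbar; set p := (m.+1 * _)%N.
suff ep : ~~ odd p by move: p ep => p; lia.
by rewrite /p oddM oddB // oddD; case: par => [/= ->|/= /negPf ->]; case: (odd m).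
Qed.

Lemma superabundant_cubic m n : (3 <= m)%N -> (m <= n + 2)%N -> (odd m \/ ~~ odd n) ->
  (m ^ 3 <= n.*2 + m.*2 + 5)%N -> superabundant m n.
Proof.
move=> m3 mn par H.
suff : (m.+1 * 'C(n.+2, 2) <= sbar m n * (m + n + 1))%N.
  rewrite /superabundant /vdim; move: (m.+1 * _)%N (sbar m n * _)%N => a b.
  by rewrite subr_le0 lez_nat.
have C2 : (2 * 'C(n.+2, 2) = n.+2 * n.+1)%N.
  by rewrite mul2n bin2 even_halfK // oddM /= negbK; case: (odd n).
have S2 : (2 * sbar m n = m.+1 * (n + 2 - m) + 2)%N by rewrite mul2n sbar_double.
rewrite -(leq_pmul2l (isT : 0 < 2)%N) mulnCA C2 [leqRHS]mulnA S2.
clear S2 C2.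
have [d E] : exists d, (n + 2 = m + d)%N by exists (n + 2 - m)%N; rewrite subnKC.
(* The two sides of the doubled inequality differ by 2n + 3m + 2 - m^3, which the cubic bound makes
   at least m - 3. *)
have I : (m.+1 * (n.+2 * n.+1) + (m + n + 1).*2 + m = (m.+1 * d + 2) * (m + n + 1) + m ^ 3)%N.
  case: m m3 E {mn par H} => // m _ E.
  have -> : n.+1 = (m + d)%N by lia.
  have -> : (m.+1 + n + 1 = m.+1 + (m + d))%N by lia.
  by rewrite !expnS expn0 {E}; lia.
rewrite E addKn; move: I H; move: (m ^ 3)%N (m.+1 * (_ * _))%N ((_ + 2) * _)%N => p u v.
by lia.
Qed.

Section Solutions.
Variables (K : numFieldType) (m n : nat).
Hypotheses (m3 : (3 <= m)%N) (bound : (m ^ 3 <= n.*2 + m.*2 + 5)%N).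

Lemma m_lt_n : (m < n + 2)%N.
Proof. have : (9 * m <= m ^ 3)%N by rewrite expnSr leq_pmul2r ?(leq_exp2r 3) //; lia.
by lia. Qed.

Hypothesis par : odd m \/ ~~ odd n.

Lemma card_star r k (I : finType) : #|I| = m.+1 -> forall g,
  (r + k.*2 = n.+1)%N -> ((g + k * m.+1).*2 = m.+1 * (n + 2 - m) + 2)%N ->
  #|{: 'I_r + 'I_k * bool}| = n.+1 /\ #|{: 'I_g + 'I_k * I}| = sbar m n.
Proof.
move=> cI g E1 E2; rewrite !card_sum !card_prod !card_ord card_bool cI; split; first by lia.
by apply: double_inj; rewrite sbar_double // ltnW // m_lt_n.
Qed.

Lemma star_solution h c k (preset : bool) r : (m.+1 = h.+1.*2 + c * 3)%N ->
  (r.+2 = m.+1 + preset)%N -> (r + k.*2 = n.+1)%N ->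
  (preset -> c = 0%N) -> (preset -> 1 < h)%N ->
  exists P : 'I_(sbar m n) -> biproj K m n, \dim (sing_forms P) = 0%N.
Proof.
move=> mE rE kE pc ph.
set I := ('I_h.+1 * bool + 'I_c * 'I_3)%type.
have cI : #|{: I}| = m.+1 by rewrite card_blocks.
set g := if preset then h.+1 else 0%N.
have gr : (g.+1 < r)%N.
  rewrite /g; case: (preset) rE pc ph => /= rE pc ph; last by lia.
  by have := ph isT; have := pc isT; lia.
have rI : (r.+2 = #|{: I}| + preset)%N by rewrite cI.
have cS : ((g.+1 + k * m.+1).*2 = m.+1 * (n + 2 - m) + 2)%N.
  have mn := m_lt_n; rewrite doubleD.
  have [d E] : exists d, (n + 2 = m + d)%N by exists (n + 2 - m)%N; rewrite subnKC // ltnW.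
  rewrite E addKn doubleMl; move: E; rewrite /g; case: (preset) rE pc => /= rE pc E.
    have c0 := pc isT; rewrite c0 addn0 in mE.
    have -> : k.*2 = d.-1 by lia.
    have d0 : (0 < d)%N by clear -mn E; lia.
    by rewrite -[d in RHS](prednK d0) mulnS; lia.
  have -> : k.*2 = d by lia.
  by rewrite mulnC addnC.
have [cJ cSb] := card_star cI kE cS.
(* There are at most (m^3 - 5m + 2)/2 free coordinates without [preset] and (m^3 - 5m)/2 with it; in
   both cases [bound] makes 2k exceed this by at least (m - 3)/2. *)
have enough : (uphalf #|free_set r (@xi h c preset)| <= k)%N.
  have := @card_free_set I r g (@xi h c preset) gr (@xi_inj h c preset).
  rewrite cI; move: #|free_set _ _| => N F.
  suff H : (N + N <= k.*2 + k.*2)%N by rewrite uphalf_half; clear -H; lia.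
  have F2 : (N + N + (g.+1 * r.-1).*2 + (m.+1 * g.+1).*2 <= m.+1 * (r.+1 * r))%N.
    have -> : (r.+1 * r = 2 * 'C(r.+1, 2))%N.
      by rewrite mul2n bin2 even_halfK // oddM /=; case: (odd r).
    by move: F; rewrite mulnCA; move: (_ * _)%N (_ * _)%N (_ * _)%N => a b d; lia.
  clear cS cJ cSb rI cI F; move: bound; rewrite !expnS expn0.
  move: rE F2; rewrite /g; case: (preset) pc ph => /= pc ph rE F b3.
    have rm : r = m by clear -rE; lia.
    have hm : (h.+1.*2 = m.+1)%N by rewrite mE pc // addn0.
    have {hm} mh : m = h.*2.+1 by clear -hm; lia.
    by move: F b3 kE m3; rewrite rm mh -!addnn /=; clear; lia.
  have rm : m = r.+1 by clear -rE; lia.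
  move: F b3 kE m3; rewrite rm; clear; case: r => // p /=.
  by rewrite !muln1 mul1n; lia.
have ph' : preset -> (0 < h)%N by move=> pr; exact: (ltnW (ph pr)).
have [x [y xy]] := star_config K rI gr pc ph' enough.
by have [P HP] := rigid_config cI cJ xy; move: P HP; rewrite cSb => P HP; exists P.
Qed.

Lemma four_solution k : (m = 3)%N -> (3 + k.*2 = n.+1)%N -> (2 < k)%N ->
  exists P : 'I_(sbar m n) -> biproj K m n, \dim (sing_forms P) = 0%N.
Proof.
move=> mE kE k2; have cI : #|{: bool * bool}| = m.+1 by rewrite card_prod card_bool mE.
have cS : ((3 + k * m.+1).*2 = m.+1 * (n + 2 - m) + 2)%N by rewrite mE; lia.
have [cJ cSb] := card_star cI kE cS.
have [x [y xy]] := four_config K k2.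
by have [P HP] := rigid_config cI cJ xy; move: P HP; rewrite cSb => P HP; exists P.
Qed.
End Solutions.

Theorem theorem4p15 (R : realType) (m n : nat)
  (hm : (3 <= m)%N)
  (hn : Num.ceil (((m%:R ^+ 3 - 2 * m%:R - 5) / 2) : rat) <= n%:Z)
  (hpar : ~ (~~ odd m /\ odd n)) :
  superabundant m n /\ non_defective R[i] m n.
Proof.
have bound := cubic_bound hn.
have par : odd m \/ ~~ odd n.
  by case: (boolP (odd m)) => om; [left|right]; apply/negP => on; apply: hpar.
have mn := ltnW (m_lt_n hm bound).
have sup : superabundant m n by exact: superabundant_cubic.
split=> //; apply: non_defective_superabundant => //.
have [on|en] := boolP (odd n).
  have om : odd m by case: par; rewrite ?on.
  by apply: (@star_solution _ m n _ _ _ m./2 0 (n + 2 - m)./2 false m.-1) => //; lia.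
have [om|em] := boolP (odd m); last first.
  (* Here m + 1 is odd, whence one triple besides the pairs. *)
  by apply: (@star_solution _ m n _ _ _ (m - 4)./2 1 (n + 2 - m)./2 false m.-1) => //; lia.
(* For m = 3 the [preset] configuration would have h = 1, too small for a spare coordinate of V0. *)
have [m3|m3] := eqVneq m 3.
  apply: (@four_solution _ m n _ _ _ (n./2.-1)) => //; first by lia.
  by move: bound; rewrite m3; lia.
by apply: (@star_solution _ m n _ _ _ m./2 0 (n + 1 - m)./2 true m) => //; lia.
Qed.
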